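(* Fix an integer $p$ and $s>1/2$. There exists $\nu_0>0$ and for $0<\nu<\nu_0$ there exists $\mathcal{C}_\nu\subset[1,2]^2$ asymptotically of full measure (i.e. $\lim_{\nu\to0}\operatorname{meas}([1,2]^2\setminus\mathcal{C}_\nu)=0$) such that for $\rho=(\rho_1,\rho_2)\in\mathcal{C}_\nu$ there exists a quasi-periodic solution $(u,v)$ of the system $$\begin{cases} i\partial_tu+\partial_{xx}u=|v|^2u+\dfrac{\partial g}{\partial\overline u}(u,\overline u,v,\overline v),\\[2mm] i\partial_tv+\partial_{xx}v=|u|^2v+\dfrac{\partial g}{\partial\overline v}(u,\overline u,v,\overline v),\end{cases}\qquad (t,x)\in\mathbb{R}\times\mathbb{T},$$ of the form $$u(x,t)=\sum_{j\in\mathbb{Z}}u_j(t\omega)e^{ijx},\qquad v(x,t)=\sum_{j\in\mathbb{Z}}v_j(t\omega)e^{ijx},$$ where $U(\cdot)=(u_j(\cdot))_{j\in\mathbb{Z}}$ and $V(\cdot)=(v_j(\cdot))_{j\in\mathbb{Z}}$ are analytic functions from $\mathbb{T}^2$ into $\ell^2_s$ satisfying, uniformly in $\theta\in\mathbb{T}^2$, $$\big||u_p(\theta)|-\sqrt{\nu\rho_1}\big|^2+\sum_{j\neq p}(1+j^2)^s|u_j(\theta)|^2=\mathcal{O}(\nu^3),$$ $$\big||v_p(\theta)|-\sqrt{\nu\rho_2}\big|^2+\sum_{j\neq p}(1+j^2)^s|v_j(\theta)|^2=\mathcal{O}(\nu^3),$$ and where $\omega\equiv\omega(\rho)\in\mathbb{R}^2$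 is a nonresonant frequency vector that satisfies $$\omega=(p^2,p^2)+\mathcal{O}(\nu^{3/2}).$$ Furthermore this solution is linearly stable.
   Context: $\mathbb{T}=\mathbb{R}/2\pi\mathbb{Z}$. $\ell^2_s=\{x=(x_k)_{k\in\mathbb{Z}}\in\mathbb{C}^{\mathbb{Z}}:\ \sum_k(1+|k|^2)^s|x_k|^2<\infty\}$. Assumptions on $g$: $g$ is a real (i.e. $g(z_1,\overline z_1,z_2,\overline z_2)\in\mathbb{R}$) analytic function on a neighborhood of the origin in $\mathbb{C}^4$, of order at least $5$ in $(u,\overline u,v,\overline v)$, and of the form $g(u,\overline u,v,\overline v)=F(|u|^2,|v|^2)$ for some function $F$. The system is Hamiltonian, with phase-space variables the Fourier coefficients $(a_j,\overline a_j,b_j,\overline b_j)_{j\in\mathbb{Z}}$ of $(u,\overline u,v,\overline v)$ and symplectic form $-i\sum_j da_j\wedge d\overline a_j-i\sum_j db_j\wedge d\overline b_j$. A frequency vector $\omega$ is nonresonant if $\omega\cdot k\neq0$ for all $k\in\mathbb{Z}^2\setminus\{0\}$. The solution (equivalently, the invariant torus $\theta\in\mathbb{T}^2\mapsto(U(\theta),V(\theta))$ carrying it) is linearly stable if the system linearized around this torus has no hyperbolic direction: the linear part of the linearized dynamics in the normal directions, reduced to constant coefficients, has the form $-iA$ with $A$ block diagonal and Hermitian, so that all its eigenvalues are purely imaginary. *)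

(* Defs.v *)
From HB Require Import structures.
From mathcomp Require Import all_boot all_order all_algebra finmap.
From mathcomp Require Import all_classical all_reals all_analysis.
From mathcomp Require Import complex.

Set Implicit Arguments.
Unset Strict Implicit.
Unset Printing Implicit Defensive.

Import Order.TTheory GRing.Theory Num.Theory numFieldNormedType.Exports.

Local Open Scope classical_set_scope.
Local Open Scope complex_scope.
Local Open Scope ring_scope.

(* [Rcomplex R] is R[i] with its structure of real vector space; sequences of
   Fourier coefficients are thus real vectors, as the linearized equations
   below are only R-linear. *)
Definition modes (R : realType) := int -> Rcomplex R.

(* A point of the phase space: [w false] are the coefficients (a_j) of u and
   [w true] the coefficients (b_j) of v; (conj a_j, conj b_j) are implied. *)
Definition phase (R : realType) := bool -> modes R.

(* Coordinates (phi, r, zeta) adapted to a two-dimensional torus. *)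
Definition ncoord (R : realType) := ((R * R) * (R * R) * phase R)%type.

(* Unconditional convergence: the finite partial sums converge to [l] along the
   directed set of finite subsets of [I], the distance being measured by [N]. *)
Definition has_sum (R : realType) (I : choiceType) (V : zmodType)
    (N : V -> \bar R) (f : I -> V) (l : V) : Prop :=
  forall e : R, 0 < e -> exists A : {fset I}, forall B : {fset I},
    (A `<=` B)%fset -> (N (\sum_(i <- B) f i - l)%R < e%:E)%E.

Definition total_sum (R : realType) (I : choiceType) (V : zmodType)
    (N : V -> \bar R) (f : I -> V) : V := xget 0 [set l | has_sum N f l].

Section Definitions.
Variable R : realType.
Local Notation C := (R[i]).
Implicit Types (s t x : R) (p : int) (theta omega : R * R).

Definition modulus (z : C) : R := Normc.normc z.
Definition cnorm (z : C) : \bar R := (modulus z)%:E.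
Definition expi (y : R) : C := cos y +i* sin y.

Definition hs_weight s (k : int) : R := (1 + (k%:~R : R) ^+ 2) `^ s.

Definition hs_sq s (a : modes R) : \bar R :=
  (\esum_(k in [set: int]) (hs_weight s k * modulus (a k) ^+ 2)%:E)%E.

Definition ell2 s : set (modes R) := [set a | (hs_sq s a < +oo)%E].

Definition fourier (a : modes R) x : C :=
  total_sum cnorm (fun k : int => (a k : C) * expi (k%:~R * x)).

Definition phase_sq s (w : phase R) : \bar R :=
  (hs_sq s (w false) + hs_sq s (w true))%E.

Definition phase_space s : set (phase R) :=
  [set w | forall c, ell2 s (w c)].

Definition is_cderive (f : R -> C) t (l : C) : Prop :=
  is_derive t 1 (fun y : R => complex.Re (f y)) (complex.Re l) /\
  is_derive t 1 (fun y : R => complex.Im (f y)) (complex.Im l).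

Definition is_cderive2 (f : R -> C) t (l : C) : Prop :=
  exists f' : R -> C, (forall y, is_cderive f y (f' y)) /\ is_cderive f' t l.

Definition cderive (f : R -> C) t : C :=
  derive1 (fun y : R => complex.Re (f y)) t
  +i* derive1 (fun y : R => complex.Im (f y)) t.

(* Functions on the torus are 2pi-periodic functions on R^2. *)
Definition torus_periodic (T : Type) (f : R * R -> T) : Prop :=
  forall theta (k1 k2 : int),
    f (theta.1 + 2 * pi * k1%:~R, theta.2 + 2 * pi * k2%:~R) = f theta.

(* Analytic as a map into ell^2_s: the local expansions have coefficients in
   ell^2_s and converge in its norm ([hs_sq] is the squared norm). *)
Definition torus_analytic s (W : R * R -> modes R) : Prop :=
  [/\ torus_periodic W,
      forall theta, ell2 s (W theta) &
      forall theta0, exists (r : R) (c : nat * nat -> modes R),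
        [/\ 0 < r, forall m, ell2 s (c m) &
            forall theta,
              `|theta.1 - theta0.1| < r -> `|theta.2 - theta0.2| < r ->
              has_sum (hs_sq s)
                (fun m : nat * nat =>
                   ((theta.1 - theta0.1) ^+ m.1 * (theta.2 - theta0.2) ^+ m.2)
                     *: c m)
                (W theta)]].

Definition line theta omega t : R * R :=
  (theta.1 + t * omega.1, theta.2 + t * omega.2).

Definition nonresonant omega : Prop :=
  forall k1 k2 : int, (k1, k2) != (0, 0) ->
    omega.1 * k1%:~R + omega.2 * k2%:~R != 0.

Definition vec4 (a b c d : C) : 'I_4 -> C := fun i => nth 0 [:: a; b; c; d] i.

Definition diag4 (u v : C) : 'I_4 -> C := vec4 u (conjc u) v (conjc v).

Definition power_series_at (z : 'I_4 -> C) (g : ('I_4 -> C) -> C)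
    (c : {ffun 'I_4 -> nat} -> C) (w : 'I_4 -> C) : Prop :=
  has_sum cnorm
    (fun m : {ffun 'I_4 -> nat} => c m * \prod_i (w i - z i) ^+ m i) (g w).

(* [D] is open: it contains a polydisc around each of its points. *)
Definition analytic_on (D : set ('I_4 -> C)) (g : ('I_4 -> C) -> C) : Prop :=
  forall z, D z -> exists (r : R) (c : {ffun 'I_4 -> nat} -> C), 0 < r /\
    forall w, (forall i, modulus (w i - z i) < r) ->
      D w /\ power_series_at z g c w.

Definition order_at_least (n : nat) (g : ('I_4 -> C) -> C) : Prop :=
  exists (r : R) (c : {ffun 'I_4 -> nat} -> C),
    [/\ 0 < r,
        forall m : {ffun 'I_4 -> nat}, (\sum_i m i < n)%N -> c m = 0 &
        forall w, (forall i, modulus (w i) < r) ->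
          power_series_at (fun=> 0) g c w].

Definition admissible (D : set ('I_4 -> C)) (g : ('I_4 -> C) -> C) : Prop :=
  [/\ D (fun=> 0),
      analytic_on D g,
      forall u v : C, D (diag4 u v) -> complex.Im (g (diag4 u v)) = 0,
      order_at_least 5 g &
      exists F : R -> R -> R, forall u v : C, D (diag4 u v) ->
        g (diag4 u v) = (F (modulus u ^+ 2) (modulus v ^+ 2))%:C].

(* Complex partial derivatives of g in its second (conj u) and fourth (conj v)
   arguments, taken at (u, conj u, v, conj v). *)
Definition dg_du_bar (g : ('I_4 -> C) -> C) (u v : C) : C :=
  derive1 (fun z : C^o => g (vec4 u z v (conjc v)) : C^o) (conjc u : C^o).

Definition dg_dv_bar (g : ('I_4 -> C) -> C) (u v : C) : C :=
  derive1 (fun z : C^o => g (vec4 u (conjc u) v z) : C^o) (conjc v : C^o).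

Definition nonlinearity (g : ('I_4 -> C) -> C) (c : bool) (u v : C) : C :=
  if c then (modulus u ^+ 2)%:C * v + dg_dv_bar g u v
       else (modulus v ^+ 2)%:C * u + dg_du_bar g u v.

(* Classical solutions; the point (u, conj u, v, conj v) stays in the domain of
   analyticity of g, outside which the values of g are meaningless. *)
Definition solves_system (D : set ('I_4 -> C)) (g : ('I_4 -> C) -> C)
    (u v : R -> R -> C) : Prop :=
  forall t x, D (diag4 (u t x) (v t x)) /\
    exists ut uxx vt vxx : C,
      [/\ is_cderive (fun y => u y x) t ut, is_cderive2 (u t) x uxx,
          is_cderive (fun y => v y x) t vt & is_cderive2 (v t) x vxx] /\
      'i%C * ut + uxx = nonlinearity g false (u t x) (v t x) /\
      'i%C * vt + vxx = nonlinearity g true (u t x) (v t x).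

Definition torus_map (U V : R * R -> modes R) theta : phase R :=
  fun c => if c then V theta else U theta.

Definition dnonlinearity (g : ('I_4 -> C) -> C) (c : bool) (u v w z : C) : C :=
  cderive (fun e : R => nonlinearity g c (u + e%:C * w) (v + e%:C * z)) 0.

Definition phase_continuous s (X : R -> phase R) : Prop :=
  (forall t, phase_space s (X t)) /\
  forall t, (fun y : R => phase_sq s (X y - X t)) @ t --> 0%E.

(* The linearized system i a_t + a_xx = dN(u, v)[a, b] along the orbit starting
   at [theta0]; [h] are the Fourier coefficients of the right-hand side. *)
Definition linearized_solution s (g : ('I_4 -> C) -> C) (W : R * R -> phase R)
    omega theta0 (X : R -> phase R) : Prop :=
  phase_continuous s X /\
  forall t, exists h : phase R,
    [/\ phase_space s h,
        forall c x,
          fourier (h c) x =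
          dnonlinearity g c
            (fourier (W (line theta0 omega t) false) x)
            (fourier (W (line theta0 omega t) true) x)
            (fourier (X t false) x) (fourier (X t true) x) &
        forall c (j : int),
          is_cderive (fun y => X y c j) t
            (- 'i%C * (((j%:~R : R) ^+ 2)%:C * (X t c j : C) + (h c j : C)))].

Definition ang (y : ncoord R) : R * R := y.1.1.
Definition act (y : ncoord R) : R * R := y.1.2.
Definition nrm (y : ncoord R) : phase R := y.2.

(* The normal variables zeta are indexed by the modes other than p. *)
Definition ncoord_space s p : set (ncoord R) :=
  [set y | phase_space s (nrm y) /\ forall c, nrm y c p = 0].

Definition ncoord_sq s (y : ncoord R) : \bar R :=
  (((ang y).1 ^+ 2 + (ang y).2 ^+ 2 + (act y).1 ^+ 2 + (act y).2 ^+ 2)%:E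
   + phase_sq s (nrm y))%E.

(* -i sum da_j /\ d(conj a_j) - i sum db_j /\ d(conj b_j), evaluated on w, w'. *)
Definition symplectic_form (w w' : phase R) : R :=
  total_sum (fun y : R => `|y|%:E)
    (fun k : int => 2 * (complex.Im ((w false k : C) * conjc (w' false k))
                       + complex.Im ((w true k : C) * conjc (w' true k)))).

(* dphi /\ dr - i sum dzeta /\ d(conj zeta); with a = sqrt r * e^(i phi) one has
   - i da /\ d(conj a) = dphi /\ dr. *)
Definition ncoord_form (y y' : ncoord R) : R :=
  (ang y).1 * (act y').1 + (ang y).2 * (act y').2
  - ((act y).1 * (ang y').1 + (act y).2 * (ang y').2)
  + symplectic_form (nrm y) (nrm y').

Definition real_linear_on (V : lmodType R) (S : set (ncoord R))
    (f : ncoord R -> V) : Prop :=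
  forall (e : R) y y', S y -> S y' -> f (e *: y + y') = e *: f y + f y'.

Definition mode_matrix := bool * int -> bool * int -> C.

Definition hermitian (A : mode_matrix) : Prop :=
  forall a b, A a b = conjc (A b a).

(* The blocks are the sets of modes {(c, k), (c, -k) : c = u, v}. *)
Definition block_diagonal (A : mode_matrix) : Prop :=
  forall a b, `|a.2| != `|b.2| -> A a b = 0.

(* The matrix-vector product A zeta for a block diagonal A. *)
Definition block_apply (A : mode_matrix) (z : phase R) (c : bool) (k : int) :
    C :=
  \sum_(d : bool) \sum_(l <- undup [:: k; - k]) A (c, k) (d, l) * (z d l : C).

(* phi' = B_phi(theta)(r, zeta), r' = 0, zeta' = - i A zeta + B_zeta(theta) r:
   in the normal directions the linear part is the constant operator - i A. *)
Definition normal_form_solution s p (A : mode_matrix)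
    (B : R * R -> ncoord R -> ncoord R) omega theta0 (y : R -> ncoord R) :
    Prop :=
  [/\ forall t, ncoord_space s p (y t),
      phase_continuous s (fun t => nrm (y t)),
      forall t, is_derive t (1 : R) (fun e => ang (y e))
                  (ang (B (line theta0 omega t) (y t))),
      forall t, is_derive t (1 : R) (fun e => act (y e)) 0 &
      forall t c (k : int), k != p ->
        is_cderive (fun e => nrm (y e) c k) t
          (- 'i%C * block_apply A (nrm (y t)) c k
           + (nrm (B (line theta0 omega t) (y t)) c k : C))].

(* The coupling terms: zeta and r may drive phi, and r may drive zeta. *)
Definition triangular_coupling s p (M : R)
    (B : R * R -> ncoord R -> ncoord R) : Prop :=
  forall theta,
    real_linear_on (ncoord_space s p) (B theta) /\
    forall y, ncoord_space s p y ->
      [/\ ncoord_space s p (B theta y),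
          (ncoord_sq s (B theta y) <= M%:E * ncoord_sq s y)%E,
          act (B theta y) = 0,
          act y = 0 -> nrm (B theta y) = 0 &
          act y = 0 -> nrm y = 0 -> B theta y = 0].

(* Linear, boundedly invertible changes of coordinates which are symplectic,
   depend analytically on theta and map d/dphi to the tangent vectors of the
   torus. *)
Definition adapted_frame s p (M : R) (W : R * R -> phase R)
    (L : R * R -> ncoord R -> phase R) : Prop :=
  [/\ forall theta,
        [/\ real_linear_on (ncoord_space s p) (L theta),
            forall y, ncoord_space s p y ->
              (phase_sq s (L theta y) <= M%:E * ncoord_sq s y)%E /\
              (ncoord_sq s y <= M%:E * phase_sq s (L theta y))%E,
            forall w, phase_space s w ->
              exists2 y, ncoord_space s p y & L theta y = w &
            forall y y', ncoord_space s p y -> ncoord_space s p y' ->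
              symplectic_form (L theta y) (L theta y') = ncoord_form y y'],
      forall y c, ncoord_space s p y ->
        torus_analytic s (fun theta => L theta y c) &
      forall theta (phi : R * R) c (k : int),
        is_cderive (fun e => W (line theta phi e) c k) 0
          (L theta (phi, (0, 0), 0) c k)].

(* The frame conjugates the linearized system along every orbit of the torus to
   a normal form whose normal part is - i A, with A Hermitian and block
   diagonal; hence there is no hyperbolic direction. *)
Definition linearly_stable s p (g : ('I_4 -> C) -> C) (W : R * R -> phase R)
    omega : Prop :=
  exists (M : R) (L : R * R -> ncoord R -> phase R)
         (B : R * R -> ncoord R -> ncoord R) (A : mode_matrix),
    [/\ adapted_frame s p M W L,
        triangular_coupling s p M B,
        hermitian A, block_diagonal A &
        forall theta0 (y : R -> ncoord R),
          (forall t, ncoord_space s p (y t)) ->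
          normal_form_solution s p A B omega theta0 y <->
          linearized_solution s g W omega theta0
            (fun t => L (line theta0 omega t) (y t))].

Definition mode_distance s p (amp : R) (a : modes R) : \bar R :=
  (((modulus (a p) - amp) ^+ 2)%:E
   + \esum_(j in [set j : int | j != p])
       (hs_weight s j * modulus (a j) ^+ 2)%:E)%E.

Definition square12 : set (measurableTypeR R * measurableTypeR R) :=
  `[1, 2]%classic `*` `[1, 2]%classic.

Definition area (S : set (measurableTypeR R * measurableTypeR R)) : \bar R :=
  ((@lebesgue_measure R) \x (@lebesgue_measure R))%E S.

End Definitions.

Arguments square12 R : clear implicits.

(* Main.v *)
Require Import Defs.
From mathcomp Require Import all_boot all_order all_algebra finmap.
From mathcomp Require Import all_classical all_reals all_analysis.
From mathcomp Require Import complex ring lra zify.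

(** Since g is a function of |u|^2 and |v|^2, its derivative in conj u at the
    point (x e^(ia), y e^(ib)) is e^(ia) times a real number N_0(x, y), and its
    derivative in conj v is e^(ib) times a real number N_1(x, y). Hence, for
    x = sqrt(nu rho_1) and y = sqrt(nu rho_2), the plane waves
    u = x e^(i(px - W_0 t)) and v = y e^(i(px - W_1 t)) with
    W_0 = p^2 + y^2 + N_0 / x and W_1 = p^2 + x^2 + N_1 / y solve the system
    exactly. Their Fourier coefficients have the prescribed moduli at the index
    p and vanish elsewhere ([plane_wave_solves], [plane_wave_distance]).

    Nonresonance. On the parameter square the frequency map is the twist
    rho -> p^2 + nu (rho_2, rho_1), perturbed by terms with a small Lipschitz
    constant. Each resonance relation therefore confines rho to the graph of a
    Lipschitz function, a negligible set ([resonant_negligible]); the parameters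
    with nonresonant W have full measure in the square
    ([nonresonant_full_measure]).

    Size of the frequency vector. The vector W is only within O(nu) of
    (p^2, p^2). But the frequency vector of a quasi-periodic motion depends on
    the angles chosen on the torus: a torus map that turns m_0 in Z^2 times for
    u and m_1 times for v carries the solution at the frequency omega with
    m_c . omega = - W_c. With m_0 = (-1 - n, n) and m_1 = (-1 - n', n'), this
    equation for omega = (p^2, p^2) + delta reads
    W_0 - p^2 = delta_1 + n (delta_1 - delta_2), and likewise for W_1 and n'.
    As W_0 and W_1 differ, it has solutions with delta as small as desired and
    n, n' distinct ([small_detuning]); omega is nonresonant because W is
    ([nonresonant_winding]).

    Linear stability. Divided by the phases of the waves, the linearized system
    has constant coefficients and couples only the modes k and 2p - k of the two
    components: it is (k^2 - p^2) w_k plus a real symmetric matrix S applied to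
    w_k + conj w_(2p - k) ([linearized_rotating]; the Fourier coefficients of the
    right-hand side are unique by [fourier_inj]). A rotation of the components
    diagonalizes S. As S is small, for each eigenvalue lam and q = k - p a
    Bogoliubov transformation with parameter (1 + 2 lam / q^2)^(1/4) turns the
    pair of modes into two oscillators of real frequency. The two modes k = p
    carry the angles and the actions: the actions are constant and drive the
    angles. The result is a linear symplectic frame in which the flow has the
    required normal form with a real diagonal matrix A
    ([symplectic_frame0], [normal_form_flow], [plane_wave_linearly_stable]).

    The information on g comes from its power series at the origin: the series
    is differentiated termwise, the rotation covariance and the reality of the
    derivatives follow by differentiating the invariance of g, and the order 5
    bounds N by the fourth power of the amplitude ([nonlinearity_structure]). *)

Set Implicit Arguments.
Unset Strict Implicit.
Unset Printing Implicit Defensive.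

Import Order.TTheory GRing.Theory Num.Theory numFieldNormedType.Exports.

Local Open Scope classical_set_scope.
Local Open Scope complex_scope.
Local Open Scope ring_scope.

(** * The modulus and the unit circle *)

Section Modulus.
Variable R : realType.
Local Notation C := R[i].
Implicit Types (z w : C) (x y : R).

Lemma modulus_ge0 z : 0 <= modulus z.
Proof. by rewrite /modulus; case: z => a b /=; exact: sqrtr_ge0. Qed.

Lemma modulus0 : modulus (0 : C) = 0.
Proof. exact: Normc.normc0. Qed.

Lemma modulus_eq0 z : modulus z = 0 -> z = 0.
Proof. exact: Normc.eq0_normc. Qed.

Lemma modulus_triangle z w : modulus (z + w) <= modulus z + modulus w.
Proof. exact: le_normcD. Qed.

Lemma modulusN z : modulus (- z) = modulus z.
Proof. exact: normcN. Qed.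

Lemma modulusM z w : modulus (z * w) = modulus z * modulus w.
Proof. exact: Normc.normcM. Qed.

Lemma modulus_sq z : modulus z ^+ 2 = complex.Re z ^+ 2 + complex.Im z ^+ 2.
Proof. by case: z => a b; rewrite /modulus /= sqr_sqrtr ?addr_ge0 ?sqr_ge0. Qed.

Lemma modulus_real x : modulus x%:C = `|x|.
Proof. by rewrite /modulus /= expr0n addr0 sqrtr_sqr. Qed.

Lemma modulus_conj z : modulus (conjc z) = modulus z.
Proof. by case: z => a b; rewrite /modulus /= sqrrN. Qed.

Lemma modulusB z w : modulus (z - w) <= modulus z + modulus w.
Proof. by rewrite -[modulus w]modulusN modulus_triangle. Qed.

Lemma Re_le_modulus z : `|complex.Re z| <= modulus z.
Proof.
case: z => a b; rewrite /modulus /= -sqrtr_sqr ler_sqrt ?lerDl ?sqr_ge0 //.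
by rewrite addr_ge0 ?sqr_ge0.
Qed.

Lemma Im_le_modulus z : `|complex.Im z| <= modulus z.
Proof.
case: z => a b; rewrite /modulus /= -sqrtr_sqr ler_sqrt ?lerDr ?sqr_ge0 //.
by rewrite addr_ge0 ?sqr_ge0.
Qed.

Lemma modulus_le_ReIm z : modulus z <= `|complex.Re z| + `|complex.Im z|.
Proof.
rewrite -(@ler_pXn2r _ 2) ?nnegrE ?modulus_ge0 ?addr_ge0 //.
rewrite modulus_sq sqrrD !real_normK ?num_real //.
by rewrite -addrA [X in _ <= X](_ : _ = (complex.Re z ^+ 2 + complex.Im z ^+ 2) +
   `|complex.Re z| * `|complex.Im z| *+ 2) ?lerDl ?mulrn_wge0 ?mulr_ge0 //; ring.
Qed.

Lemma modulusX z n : modulus (z ^+ n) = modulus z ^+ n.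
Proof.
elim: n => [|n IH]; first by rewrite !expr0; exact: Normc.normc1.
by rewrite !exprS modulusM IH.
Qed.

Lemma modulus_sum (I : Type) (r : seq I) (P : pred I) (f : I -> C) :
  modulus (\sum_(i <- r | P i) f i) <= \sum_(i <- r | P i) modulus (f i).
Proof.
elim/big_ind2: _ => //; first by rewrite modulus0.
by move=> x1 x2 y1 y2 h1 h2; rewrite (le_trans (modulus_triangle _ _))// lerD.
Qed.

Lemma modulus_prod (I : Type) (r : seq I) (P : pred I) (f : I -> C) :
  modulus (\prod_(i <- r | P i) f i) = \prod_(i <- r | P i) modulus (f i).
Proof.
elim/big_ind2: _ => //; first exact: Normc.normc1.
by move=> x1 x2 y1 y2 <- <-; rewrite modulusM.
Qed.

Lemma normcE_modulus z : `|z| = (modulus z)%:C.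
Proof. by rewrite normc_def; case: z. Qed.

Lemma expiD x y : expi (x + y) = expi x * expi y.
Proof.
rewrite /expi cosD sinD; apply/eqP; rewrite eq_complex /=.
by rewrite eqxx /= addrC; apply/eqP; ring.
Qed.

Lemma expi0 : expi (0 : R) = 1.
Proof. by rewrite /expi cos0 sin0. Qed.

Lemma conj_expi x : conjc (expi x) = expi (- x).
Proof. by rewrite /expi /= cosN sinN. Qed.

Lemma modulus_expi x : modulus (expi x) = 1.
Proof. by rewrite /modulus /expi /= cos2Dsin2 sqrtr1. Qed.

Lemma expiNM x : expi (- x) * expi x = 1.
Proof. by rewrite -expiD addNr expi0. Qed.

Lemma expiMN x : expi x * expi (- x) = 1.
Proof. by rewrite -expiD addrN expi0. Qed.

Lemma expi_2pi x (k : int) : expi (x + 2 * pi * k%:~R) = expi x.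
Proof.
have e1 : expi (2 * pi : R) = 1.
  rewrite (_ : 2 * pi = pi + pi); last by ring.
  rewrite expiD /expi cospi sinpi; apply/eqP; rewrite eq_complex /=.
  by apply/andP; split; apply/eqP; ring.
have aux (n : nat) (y : R) : expi (y + 2 * pi * n%:R) = expi y.
  elim: n y => [|n IH] y; first by rewrite mulr0 addr0.
  by rewrite [n.+1%:R]mulrS [1 + _]addrC mulrDr mulr1 addrA expiD IH e1 mulr1.
case: k => n; first exact: aux.
rewrite NegzE -[LHS](aux n.+1); congr expi.
by rewrite mulrNz; ring.
Qed.

End Modulus.

(** * Unconditional summation *)

Section Sums.
Variables (R : realType) (I : choiceType).
Local Notation C := R[i].
Implicit Types (f g : I -> C) (A B : {fset I}).

Definition abs_summable f :=
  exists M : R, forall A : {fset I}, \sum_(i <- A) modulus (f i) <= M.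

Lemma has_sumP f (l : C) :
  has_sum (@cnorm R) f l <-> forall e : R, 0 < e -> exists A : {fset I},
    forall B : {fset I}, (A `<=` B)%fset -> modulus (\sum_(i <- B) f i - l) < e.
Proof.
by split=> h e e0; have [A hA] := h e e0; exists A => B /hA;
  rewrite /cnorm lte_fin.
Qed.

Lemma has_sum_uniq f (l l' : C) :
  has_sum (@cnorm R) f l -> has_sum (@cnorm R) f l' -> l = l'.
Proof.
move=> /has_sumP h /has_sumP h'; apply/eqP; rewrite -subr_eq0; apply/eqP.
apply: modulus_eq0; apply/eqP; rewrite eq_le modulus_ge0 andbT.
apply/ler_addgt0Pr => e e0; rewrite add0r.
have [A hA] := h (e / 2) ltac:(lra); have [A' hA'] := h' (e / 2) ltac:(lra).
have := hA (A `|` A')%fset (fsubsetUl _ _).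
have := hA' (A `|` A')%fset (fsubsetUr _ _).
set S := \sum_(i <- _) _ => h2 h1.
have -> : l - l' = (S - l') - (S - l) by ring.
by have := modulusB (S - l') (S - l); lra.
Qed.

Lemma total_sumE f (l : C) :
  has_sum (@cnorm R) f l -> total_sum (@cnorm R) f = l.
Proof.
by move=> h; apply: xget_unique => // y hy; exact: (has_sum_uniq hy h).
Qed.

Lemma has_sumD f g (l l' : C) : has_sum (@cnorm R) f l ->
  has_sum (@cnorm R) g l' -> has_sum (@cnorm R) (fun i => f i + g i) (l + l').
Proof.
move=> /has_sumP h /has_sumP h'; apply/has_sumP => e e0.
have [A hA] := h (e / 2) ltac:(lra); have [A' hA'] := h' (e / 2) ltac:(lra).
exists (A `|` A')%fset => B; rewrite fsubUset => /andP[/hA h1 /hA' h2].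
rewrite big_split /=.
have -> : \sum_(i <- B) f i + \sum_(i <- B) g i - (l + l') =
  (\sum_(i <- B) f i - l) + (\sum_(i <- B) g i - l') by ring.
by have := modulus_triangle (\sum_(i <- B) f i - l) (\sum_(i <- B) g i - l'); lra.
Qed.

Lemma has_sumZ f (l c : C) : has_sum (@cnorm R) f l ->
  has_sum (@cnorm R) (fun i => c * f i) (c * l).
Proof.
move=> /has_sumP h; apply/has_sumP => e e0.
have m0 := modulus_ge0 c.
have [A hA] := h (e / (modulus c + 1)) ltac:(apply: divr_gt0; lra).
exists A => B /hA; rewrite -mulr_sumr -mulrBr modulusM ltr_pdivlMr; last lra.
set t := modulus _; have : 0 <= t by exact: modulus_ge0.
by nra.
Qed.

Lemma has_sumN f (l : C) : has_sum (@cnorm R) f l ->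
  has_sum (@cnorm R) (fun i => - f i) (- l).
Proof.
move/(has_sumZ (-1)); rewrite mulN1r; congr has_sum.
by apply/funext => i; rewrite mulN1r.
Qed.

Lemma has_sum_conj f (l : C) : has_sum (@cnorm R) f l ->
  has_sum (@cnorm R) (fun i => conjc (f i)) (conjc l).
Proof.
move=> /has_sumP h; apply/has_sumP => e /h[A hA]; exists A => B /hA.
by rewrite -rmorph_sum -rmorphB modulus_conj.
Qed.

Lemma eq_has_sum f g (l : C) : f =1 g -> has_sum (@cnorm R) f l ->
  has_sum (@cnorm R) g l.
Proof. by move/funext => ->. Qed.

Lemma has_sum_single f (i0 : I) : (forall i, i != i0 -> f i = 0) ->
  has_sum (@cnorm R) f (f i0).
Proof.
move=> h; apply/has_sumP => e e0; exists [fset i0]%fset => B.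
rewrite fsub1set => iB; rewrite (big_fsetD1 i0)//= big1_seq ?addr0 ?subrr ?modulus0//.
by move=> i /=; rewrite !inE => /andP[/h].
Qed.

Lemma sum_fsetD (V : nmodType) (F : I -> V) A B : (A `<=` B)%fset ->
  \sum_(i <- B) F i = \sum_(i <- A) F i + \sum_(i <- (B `\` A)%fset) F i.
Proof.
move=> AB; rewrite (big_fsetID _ (mem A) B) /=; congr (_ + _).
  apply: perm_big; apply: uniq_perm => // i; rewrite !inE /= andbC.
  by case: (boolP (i \in A)) => // /(fsubsetP AB) ->.
by apply: perm_big; apply: uniq_perm => // i; rewrite !inE /= andbC.
Qed.

Lemma le_sum_fset (F : I -> R) A B : (forall i, 0 <= F i) -> (A `<=` B)%fset ->
  \sum_(i <- A) F i <= \sum_(i <- B) F i.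
Proof. by move=> F0 /sum_fsetD ->; rewrite lerDl sumr_ge0. Qed.

(** Unconditional convergence of complex families is absolute convergence: the
    partial sums are bounded, so are those over the indices where the real
    part (or the imaginary part) has a given sign, and on these no
    cancellation occurs. *)
Lemma has_sum_abs f (l : C) : has_sum (@cnorm R) f l -> abs_summable f.
Proof.
move=> /has_sumP /(_ 1 ltr01)[A hA].
pose M := modulus l + 1 + \sum_(i <- A) modulus (f i).
have hM B : modulus (\sum_(i <- B) f i) <= M.
  have h1 := ltW (hA (A `|` B)%fset (fsubsetUl _ _)).
  have := sum_fsetD f (fsubsetUr A B) => /eqP; rewrite -subr_eq => /eqP <-.
  rewrite -[X in modulus (X - _)](subrK l).
  apply: le_trans (modulusB _ _) _; rewrite /M; apply: lerD.
    by apply: le_trans (modulus_triangle _ _) _; rewrite addrC lerD2l.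
  apply: le_trans (modulus_sum _ _ _) _; apply: le_sum_fset.
    by move=> i; exact: modulus_ge0.
  by apply/fsubsetP => i; rewrite !inE => /andP[/negbTE -> ] /orP[|].
have real_part (phi : C -> R) : (forall B, phi (\sum_(i <- B) f i) =
    \sum_(i <- B) phi (f i)) -> (forall z, `|phi z| <= modulus z) ->
    forall B, \sum_(i <- B) `|phi (f i)| <= 2 * M.
  move=> phiS phile B.
  have {}hM B' : `|\sum_(i <- B') phi (f i)| <= M.
    by rewrite -phiS (le_trans (phile _)).
  rewrite (bigID (fun i => 0 <= phi (f i))) /= mulr2n mulrDl mul1r lerD//.
    rewrite (eq_bigr (fun i => phi (f i))); last by move=> i; exact: ger0_norm.
    rewrite (le_trans _ (hM [fset i in B | 0 <= phi (f i)]%fset))//.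
    by rewrite big_fset /= ler_norm.
  rewrite (eq_bigr (fun i => - phi (f i))); last first.
    by move=> i; rewrite -ltNge => /ltW; exact: ler0_norm.
  rewrite (le_trans _ (hM [fset i in B | ~~ (0 <= phi (f i))]%fset))//.
  by rewrite big_fset /= sumrN -normrN ler_norm.
exists (2 * M + 2 * M) => B.
apply: (@le_trans _ _ (\sum_(i <- B) (`|complex.Re (f i)| + `|complex.Im (f i)|))).
  by apply: ler_sum => i _; exact: modulus_le_ReIm.
rewrite big_split; apply: lerD; apply: real_part.
- by move=> B'; rewrite (raddf_sum (@complex.Re R : Rcomplex R -> R)).
- exact: Re_le_modulus.
- by move=> B'; rewrite (raddf_sum (@complex.Im R : Rcomplex R -> R)).
- exact: Im_le_modulus.
Qed.

End Sums.

Section Summable.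
Variables (R : realType) (I : choiceType).
Local Notation C := R[i].
Implicit Types (f g : I -> C) (A B : {fset I}).

Lemma nonneg_sum_exists (F : I -> R) (M : R) : (forall i, 0 <= F i) ->
    (forall A : {fset I}, \sum_(i <- A) F i <= M) ->
  exists l : R, forall e : R, 0 < e -> exists A : {fset I}, forall B : {fset I},
    (A `<=` B)%fset -> `|\sum_(i <- B) F i - l| < e.
Proof.
move=> F0 FM; pose S := [set \sum_(i <- A) F i | A in [set: {fset I}]].
have supS : has_sup S.
  by split; [exists 0, fset0; rewrite ?big_seq_fset0 | exists M => _ [A _ <-]].
exists (sup S) => e e0; have [_ [A _ <-] hA] := sup_adherent e0 supS.
exists A => B AB; have h1 := le_sum_fset F0 AB.
have h2 : \sum_(i <- B) F i <= sup S by apply: ub_le_sup; [case: supS | exists B].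
by rewrite ler0_norm; lra.
Qed.

Lemma real_sum_exists (F : I -> R) (M : R) :
    (forall A : {fset I}, \sum_(i <- A) `|F i| <= M) ->
  exists l : R, forall e : R, 0 < e -> exists A : {fset I}, forall B : {fset I},
    (A `<=` B)%fset -> `|\sum_(i <- B) F i - l| < e.
Proof.
move=> FM.
have [l hl] := nonneg_sum_exists (fun i => normr_ge0 (F i)) FM.
have [||l' hl'] := @nonneg_sum_exists (fun i => `|F i| + F i) (M + M).
- by move=> i; have := ler_norm (- F i); rewrite normrN; lra.
- move=> A; rewrite big_split /= lerD ?FM//.
  by rewrite (le_trans _ (FM A))// ler_sum// => i _; exact: ler_norm.
exists (l' - l) => e e0.
have [A hA] := hl (e / 2) ltac:(lra); have [A' hA'] := hl' (e / 2) ltac:(lra).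
exists (A `|` A')%fset => B; rewrite fsubUset => /andP[/hA h1 /hA'].
rewrite big_split /= => h2.
set a := \sum_(i <- B) `|F i| in h1 h2 *; set b := \sum_(i <- B) F i in h2 *.
by rewrite (_ : b - _ = (a + b - l') - (a - l)); [have := ler_normB (a + b - l') (a - l); lra | ring].
Qed.

Lemma abs_summable_ex f : abs_summable f -> exists l, has_sum (@cnorm R) f l.
Proof.
move=> [M hM].
have [|x hx] := @real_sum_exists (fun i => complex.Re (f i)) M.
  move=> A; apply: le_trans (hM A); apply: ler_sum => i _; exact: Re_le_modulus.
have [|y hy] := @real_sum_exists (fun i => complex.Im (f i)) M.
  move=> A; apply: le_trans (hM A); apply: ler_sum => i _; exact: Im_le_modulus.
exists (x +i* y); apply/has_sumP => e e0.
have [A hA] := hx (e / 2) ltac:(lra); have [A' hA'] := hy (e / 2) ltac:(lra).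
exists (A `|` A')%fset => B; rewrite fsubUset => /andP[/hA h1 /hA' h2].
apply: le_lt_trans (modulus_le_ReIm _) _.
have -> : complex.Re (\sum_(i <- B) f i - (x +i* y)) =
    \sum_(i <- B) complex.Re (f i) - x.
  by rewrite -(raddf_sum (@complex.Re R : Rcomplex R -> R)); case: (\sum_(i <- B) _).
have -> : complex.Im (\sum_(i <- B) f i - (x +i* y)) =
    \sum_(i <- B) complex.Im (f i) - y.
  by rewrite -(raddf_sum (@complex.Im R : Rcomplex R -> R)); case: (\sum_(i <- B) _).
by lra.
Qed.

Lemma has_total_sum f : abs_summable f ->
  has_sum (@cnorm R) f (total_sum (@cnorm R) f).
Proof. by move=> /abs_summable_ex[l h]; rewrite (total_sumE h). Qed.

Lemma has_sum_le f (l : C) (M : R) : has_sum (@cnorm R) f l ->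
  (forall A : {fset I}, \sum_(i <- A) modulus (f i) <= M) -> modulus l <= M.
Proof.
move=> /has_sumP h hM; apply/ler_addgt0Pr => e /h[A /(_ A (fsubset_refl _))].
set S := \sum_(i <- A) f i => h1.
have h2 : modulus S <= M := le_trans (modulus_sum _ _ _) (hM A).
have -> : l = S - (S - l) by ring.
by have := modulusB S (S - l); lra.
Qed.

Lemma abs_summable_le f (F : I -> R) : (exists M, forall A : {fset I}, \sum_(i <- A) F i <= M) ->
  (forall i, modulus (f i) <= F i) -> abs_summable f.
Proof.
move=> [M hM] fF; exists M => A; apply: le_trans (hM A); exact: ler_sum.
Qed.

Lemma bounded_sumD (F G : I -> R) : (exists M, forall A : {fset I}, \sum_(i <- A) F i <= M) ->
  (exists M, forall A : {fset I}, \sum_(i <- A) G i <= M) ->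
  exists M, forall A : {fset I}, \sum_(i <- A) (F i + G i) <= M.
Proof.
by move=> [M hM] [M' hM']; exists (M + M') => A; rewrite big_split lerD.
Qed.

Lemma abs_summableD f g : abs_summable f -> abs_summable g ->
  abs_summable (fun i => f i + g i).
Proof.
move=> hf hg; apply: abs_summable_le (bounded_sumD hf hg) _ => i.
exact: modulus_triangle.
Qed.

(** Summation in C restricted to real parts is the summation in R with the
    distance |x - y|, so that all real series can be handled as complex ones. *)
Lemma total_sum_Re f (l : C) : has_sum (@cnorm R) f l ->
  total_sum (fun y : R => `|y|%:E) (fun i => complex.Re (f i)) = complex.Re l.
Proof.
move=> /has_sumP h; apply: xget_unique.
  move=> e /h[A hA]; exists A => B /hA h1; rewrite lte_fin; apply: le_lt_trans h1.
  rewrite -(raddf_sum (@complex.Re R : Rcomplex R -> R)).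
  by apply: le_trans (Re_le_modulus _); case: l {h hA}; case: (\sum_(i <- B) _).
move=> y hy; have : has_sum (@cnorm R) (fun i => (complex.Re (f i))%:C) y%:C.
  apply/has_sumP => e /hy[A hA]; exists A => B /hA.
  by rewrite lte_fin -modulus_real rmorphB rmorph_sum.
have : has_sum (@cnorm R) (fun i => (complex.Re (f i))%:C) (complex.Re l)%:C.
  apply/has_sumP => e /h[A hA]; exists A => B /hA h1; apply: le_lt_trans h1.
  rewrite -rmorph_sum -rmorphB modulus_real.
  rewrite -(raddf_sum (@complex.Re R : Rcomplex R -> R)).
  by apply: le_trans (Re_le_modulus _); case: l {h hA}; case: (\sum_(i <- B) _).
by move=> h1 h2; have /complexI := has_sum_uniq h2 h1.
Qed.

End Summable.

Section Reindex.
Variables (R : realType) (I J : choiceType).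
Local Notation C := R[i].

Lemma has_sum_reindex (h : I -> J) (h' : J -> I) (f : J -> C) (l : C) :
  cancel h h' -> cancel h' h -> has_sum (@cnorm R) f l ->
  has_sum (@cnorm R) (fun i => f (h i)) l.
Proof.
move=> hK hK' /has_sumP hf; apply/has_sumP => e /hf[A hA].
exists [fset h' j | j in A]%fset => B hB.
have -> : \sum_(i <- B) f (h i) = \sum_(j <- [fset h i | i in B]%fset) f j.
  by rewrite big_imfset //= => x y _ _; exact: can_inj.
apply: hA; apply/fsubsetP => j jA; apply/imfsetP; exists (h' j) => //=.
by apply: (fsubsetP hB); apply/imfsetP; exists j.
Qed.

Lemma bounded_sum_reindex (h : I -> J) (F : J -> R) : injective h ->
  (exists M, forall A : {fset J}, \sum_(j <- A) F j <= M) ->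
  exists M, forall A : {fset I}, \sum_(i <- A) F (h i) <= M.
Proof.
move=> hi [M hM]; exists M => A; apply: le_trans (hM [fset h i | i in A]%fset).
by rewrite big_imfset //= => x y _ _; exact: hi.
Qed.

(** Over a box A x B the sum factors. Boxes are cofinal among the finite sets
    of pairs, and the product family is absolutely summable, so the limit
    along boxes is the sum. *)
Lemma has_sum_prod (f : I -> C) (g : J -> C) (a b : C) :
  has_sum (@cnorm R) f a -> has_sum (@cnorm R) g b ->
  has_sum (@cnorm R) (fun m : I * J => f m.1 * g m.2) (a * b).
Proof.
move=> hf hg.
have box (A : {fset I * J}) : exists (A1 : {fset I}) (A2 : {fset J}),
    (A `<=` A1 `*` A2)%fset.
  exists [fset m.1 | m in A]%fset, [fset m.2 | m in A]%fset.
  apply/fsubsetP => m mA; rewrite in_fsetM; apply/andP; split;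
    by apply/imfsetP; exists m.
have boxE (V : pzSemiRingType) (u : I -> V) (v : J -> V) (A1 : {fset I}) (A2 : {fset J}) :
    \sum_(m <- (A1 `*` A2)%fset) u m.1 * v m.2 =
    (\sum_(i <- A1) u i) * (\sum_(j <- A2) v j).
  rewrite big_distrlr /= -(big_allpairs (F := fun m : I * J => u m.1 * v m.2)) /=.
  apply: perm_big; apply: uniq_perm; first exact: fset_uniq.
    by apply: allpairs_uniq; [exact: fset_uniq|exact: fset_uniq|case=> ? ? [? ?]].
  move=> [i j]; rewrite in_fsetM /=; apply/andP/allpairsP => [[iA jA]|].
    by exists (i, j).
  by move=> [[i' j'] /= [? ? [-> ->]]].
have sm : abs_summable (fun m : I * J => f m.1 * g m.2).
  have [M hM] := has_sum_abs hf; have [M' hM'] := has_sum_abs hg.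
  exists (M * M') => A; have [A1 [A2 AB]] := box A.
  apply: le_trans (le_sum_fset _ AB) _; first by move=> i; exact: modulus_ge0.
  rewrite (eq_bigr (fun m => modulus (f m.1) * modulus (g m.2))); last first.
    by move=> m _; rewrite modulusM.
  rewrite (boxE _ (fun i => modulus (f i)) (fun j => modulus (g j))).
  by rewrite ler_pM// sumr_ge0// => i _; exact: modulus_ge0.
have [l hl] := abs_summable_ex sm.
suff <- : l = a * b by [].
apply/eqP; rewrite -subr_eq0; apply/eqP.
apply: modulus_eq0; apply/eqP; rewrite eq_le modulus_ge0 andbT.
apply/ler_addgt0Pr => e e0; rewrite add0r.
pose K := modulus a + modulus b + 1.
have K0 : 0 < K by rewrite ltr_wpDl// addr_ge0 ?modulus_ge0.
pose d := Num.min 1 (e / (2 * K)).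
have d0 : 0 < d by rewrite lt_min ltr01 divr_gt0// mulr_gt0.
have dK : d * K <= e / 2.
  by rewrite -ler_pdivlMr// ge_min -mulrA -invfM lexx orbT.
have d1 : d <= 1 by rewrite ge_min lexx.
move/has_sumP: hf => /(_ d d0)[A1 hA1]; move/has_sumP: hg => /(_ d d0)[A2 hA2].
move/has_sumP: hl => /(_ (e / 2) ltac:(lra))[A hA].
have [B1 [B2 AB]] := box A.
have sub : (A `<=` (A1 `|` B1) `*` (A2 `|` B2))%fset.
  apply/fsubsetP => m /(fsubsetP AB); rewrite !in_fsetM !inE => /andP[-> ->].
  by rewrite !orbT.
have := hA _ sub; rewrite boxE.
have := hA1 _ (fsubsetUl A1 B1); have := hA2 _ (fsubsetUl A2 B2).
set x := \sum_(i <- _) f i; set y := \sum_(j <- _) g j => h2 h1 h3.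
have -> : l - a * b = - (x * y - l) + ((x - a) * b + (a * (y - b) + (x - a) * (y - b))) by ring.
apply: le_trans (modulus_triangle _ _) _; rewrite modulusN.
have t1 := modulus_triangle ((x - a) * b) (a * (y - b) + (x - a) * (y - b)).
have t2 := modulus_triangle (a * (y - b)) ((x - a) * (y - b)).
rewrite !modulusM in t1 t2.
have a0 := modulus_ge0 a; have b0 := modulus_ge0 b.
have x0 := modulus_ge0 (x - a); have y0 := modulus_ge0 (y - b).
have : modulus (x - a) * modulus b + (modulus a * modulus (y - b) + modulus (x - a) * modulus (y - b)) <= d * K.
  rewrite /K; nra.
by lra.
Qed.

End Reindex.

(** * The exponential series on the unit circle *)

Section ExponentialSeries.
Variable R : realType.
Local Notation C := R[i].

Lemma fset_nat_bound (A : {fset nat}) : exists n, forall i, i \in A -> (i < n)%N.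
Proof.
exists (\max_(i <- A) i).+1 => i iA; rewrite ltnS.
by rewrite (big_fsetD1 i)//= leq_maxl.
Qed.

(** For an absolutely summable family indexed by nat, the initial segments
    suffice to identify the unconditional sum. *)
Lemma has_sum_limit (f : nat -> C) (l : C) : abs_summable f ->
  (fun n => \sum_(0 <= i < n) complex.Re (f i)) @ \oo --> complex.Re l ->
  (fun n => \sum_(0 <= i < n) complex.Im (f i)) @ \oo --> complex.Im l ->
  has_sum (@cnorm R) f l.
Proof.
move=> /abs_summable_ex[l' hl'] hre him.
suff key (phi : C -> R) : (forall (r : seq nat), phi (\sum_(i <- r) f i) =
    \sum_(i <- r) phi (f i)) -> (forall z w, `|phi z - phi w| <= modulus (z - w)) ->
    (fun n => \sum_(0 <= i < n) phi (f i)) @ \oo --> phi l'.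
  suff -> : l = l' by [].
  apply/eqP; rewrite eq_complex; apply/andP; split; apply/eqP.
    apply: (cvg_unique (@norm_hausdorff _ R) hre); apply: (key (@complex.Re R)).
      by move=> r; rewrite (raddf_sum (@complex.Re R : Rcomplex R -> R)).
    by move=> z w; rewrite -(raddfB (@complex.Re R : Rcomplex R -> R)) Re_le_modulus.
  apply: (cvg_unique (@norm_hausdorff _ R) him); apply: (key (@complex.Im R)).
    by move=> r; rewrite (raddf_sum (@complex.Im R : Rcomplex R -> R)).
  by move=> z w; rewrite -(raddfB (@complex.Im R : Rcomplex R -> R)) Im_le_modulus.
move=> phiS phiB; apply/cvgrPdist_lt => e e0.
move/has_sumP: hl' => /(_ e e0)[A hA]; have [N hN] := fset_nat_bound A.
exists N => // n /= Nn; rewrite -phiS distrC (le_lt_trans (phiB _ _))//.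
have := hA [fset i in iota 0 n]%fset; rewrite big_imfset //= /index_iota subn0. rewrite undup_id ?iota_uniq //; apply.
by apply/fsubsetP => i /hN iN; rewrite !inE /= mem_iota /= add0n (leq_trans iN).
Qed.

Definition expi_coeff (x : R) (n : nat) : C := cos_coeff x n +i* sin_coeff x n.

Lemma modulus_expi_coeff x n : modulus (expi_coeff x n) <= exp_coeff `|x| n.
Proof.
apply: le_trans (modulus_le_ReIm _) _.
rewrite /expi_coeff /cos_coeff /sin_coeff /exp_coeff /=.
rewrite !normrM !normfV !normr_nat !normrX !normrN !normr1 !expr1n.
by case: (odd n) => /=; rewrite !(mul0r, mul1r, add0r, addr0).
Qed.

Lemma expi_coeff_summable x : abs_summable (expi_coeff x).
Proof.
exists (expR `|x|) => A; have [N hN] := fset_nat_bound A.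
apply: (@le_trans _ _ (\sum_(i <- A) exp_coeff `|x| i)).
  by apply: ler_sum => i _; exact: modulus_expi_coeff.
apply: (@le_trans _ _ (series (exp_coeff `|x|) N)).
  have NA : (A `<=` [fset i in iota 0 N])%fset.
    by apply/fsubsetP => i /hN iN; rewrite !inE /= mem_iota.
  apply: le_trans (le_sum_fset _ NA) _.
    by move=> i; rewrite exp_coeff_ge0.
  by rewrite big_imfset //= /series /= /index_iota subn0 undup_id ?iota_uniq.
apply: nondecreasing_cvgn_le; last exact: is_cvg_series_exp_coeff.
by apply: nondecreasing_series => i _ _; rewrite exp_coeff_ge0.
Qed.

Lemma has_sum_expi x : has_sum (@cnorm R) (expi_coeff x) (expi x).
Proof.
apply: has_sum_limit; first exact: expi_coeff_summable.
- have : series (cos_coeff x) @ \oo --> cos x by rewrite unlock; exact: is_cvg_series_cos_coeff.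
  by [].
- have : series (sin_coeff x) @ \oo --> sin x by rewrite unlock; exact: is_cvg_series_sin_coeff.
  by [].
Qed.

Lemma expi_coeffM x y n :
  expi_coeff (x * y) n = (y ^+ n)%:C * expi_coeff x n.
Proof.
rewrite /expi_coeff /cos_coeff /sin_coeff /=; apply/eqP; rewrite eq_complex /=.
by rewrite exprMn; apply/andP; split; apply/eqP; ring.
Qed.

End ExponentialSeries.

(** * Weighted square-summable sequences *)

Section WeightedSquareSums.
Variables (R : realType) (s : R).
Hypothesis s_gt : 1 / 2 < s.
Local Notation C := R[i].
Implicit Types (a b : modes R) (z : C).

Lemma s_ge0 : 0 <= s.
Proof. by apply: ltW; apply: lt_trans s_gt; rewrite divr_gt0. Qed.

Lemma hs_weight_gt0 (k : int) : 0 < hs_weight s k.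
Proof. by rewrite powR_gt0// ltr_wpDr ?sqr_ge0. Qed.

Lemma hs_weight_ge1 (k : int) : 1 <= hs_weight s k.
Proof.
have -> : 1 = 1 `^ s :> R by rewrite powR1.
rewrite /hs_weight.
by apply: ge0_ler_powR; rewrite ?nnegrE ?s_ge0 ?addr_ge0 ?sqr_ge0// lerDl sqr_ge0.
Qed.

Lemma hs_term_ge0 a (k : int) : 0 <= hs_weight s k * modulus (a k) ^+ 2.
Proof. by rewrite mulr_ge0 ?sqr_ge0// ltW// hs_weight_gt0. Qed.

Lemma esum_fset_leP (I : choiceType) (F : I -> R) (M : R) :
  (forall A : {fset I}, \sum_(i <- A) F i <= M) ->
  (\esum_(i in [set: I]) (F i)%:E <= M%:E)%E.
Proof.
move=> hM; apply: ge_ereal_sup => _ [X [finX _]] <-.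
by rewrite fsbig_finite//= sumEFin lee_fin.
Qed.

Lemma esum_fset_ge (I : choiceType) (F : I -> R) (A : {fset I}) :
  ((\sum_(i <- A) F i)%:E <= \esum_(i in [set: I]) (F i)%:E)%E.
Proof.
apply: esum_ge; exists [set` A]; first by split => //; exact: finite_fset.
by rewrite fsbig_finite//= set_fsetK sumEFin.
Qed.

Lemma hs_sq_ge0 a : (0 <= hs_sq s a)%E.
Proof. by apply: esum_ge0 => k _; rewrite lee_fin hs_term_ge0. Qed.

Lemma ell2P a : ell2 s a <-> exists M, forall A : {fset int},
  \sum_(k <- A) hs_weight s k * modulus (a k) ^+ 2 <= M.
Proof.
split=> [ha|[M hM]]; last exact: le_lt_trans (esum_fset_leP hM) (ltry _).
exists (fine (hs_sq s a)) => A; rewrite -lee_fin fineK.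
  exact: esum_fset_ge.
by rewrite ge0_fin_numE ?hs_sq_ge0.
Qed.

Lemma hs_sq_mult a b (c : R) : 0 <= c ->
    (forall k, modulus (b k) <= c * modulus (a k)) ->
  (hs_sq s b <= (c ^+ 2)%:E * hs_sq s a)%E.
Proof.
move=> c0 h; apply: ge_ereal_sup => _ [X [finX _]] <-.
rewrite fsbig_finite//= sumEFin.
apply: (@le_trans _ _ ((c ^+ 2)%:E * (\sum_(k <- fset_set X)
    hs_weight s k * modulus (a k) ^+ 2)%:E)%E).
  rewrite -EFinM lee_fin mulr_sumr ler_sum// => k _.
  rewrite [leRHS]mulrCA ler_wpM2l ?(ltW (hs_weight_gt0 _))// -exprMn.
  by rewrite ler_pXn2r ?nnegrE ?modulus_ge0 ?mulr_ge0 ?modulus_ge0.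
by rewrite lee_wpmul2l ?lee_fin ?sqr_ge0//; exact: esum_fset_ge.
Qed.

Lemma eq_hs_sq a b : (forall k, modulus (a k) = modulus (b k)) ->
  hs_sq s a = hs_sq s b.
Proof. by move=> h; rewrite /hs_sq; apply: eq_esum => k _; rewrite h. Qed.

Lemma hs_sqD_le a b :
  (hs_sq s (a + b)%R <= 2%:E * (hs_sq s a + hs_sq s b))%E.
Proof.
apply: ge_ereal_sup => _ [X [finX _]] <-.
rewrite fsbig_finite//= sumEFin.
apply: (@le_trans _ _ (2%:E * ((\sum_(k <- fset_set X) hs_weight s k * modulus (a k) ^+ 2)%:E
  + (\sum_(k <- fset_set X) hs_weight s k * modulus (b k) ^+ 2)%:E))%E).
  rewrite -EFinD -EFinM lee_fin -big_split /= mulr_sumr ler_sum// => k _.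
  rewrite -mulrDr [leRHS]mulrCA ler_wpM2l ?(ltW (hs_weight_gt0 _))//.
  have := modulus_triangle (a k : C) (b k); have := modulus_ge0 (a k : C).
  have := modulus_ge0 (b k : C); have := modulus_ge0 (a k + b k : C).
  rewrite !expr2.
  set x := modulus (a k : C); set y := modulus (b k : C); set z := modulus (a k + b k : C).
  move=> z0 y0 x0 zxy; change (z * z <= 2 * (x * x + y * y)).
  have := sqr_ge0 (x - y); rewrite expr2; nra.
by rewrite lee_wpmul2l// leeD//; exact: esum_fset_ge.
Qed.

Lemma hs_sq0 : hs_sq s 0 = 0%E.
Proof.
by rewrite /hs_sq esum1// => k _; rewrite (_ : modulus _ = 0) ?expr0n ?mulr0 //; exact: modulus0.
Qed.

Lemma hs_sq_single (p : int) a : (forall k, k != p -> a k = 0) ->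
  hs_sq s a = (hs_weight s p * modulus (a p) ^+ 2)%:E.
Proof.
move=> h; rewrite /hs_sq (esumID [set p]) ?setTI; last first.
  by move=> k _; rewrite lee_fin hs_term_ge0.
rewrite esum_set1 ?lee_fin ?hs_term_ge0// esum1 ?adde0// => k kp.
by rewrite h ?modulus0 ?expr0n ?mulr0//; apply/eqP.
Qed.

(** Conjugating a perturbation of a wave e^(ipx) exchanges its modes k and 2p
    - k; the weights at these two modes are comparable, with a constant that
    depends on p. *)
Lemma hs_weight_reflect (p k : int) :
  hs_weight s (2 * p - k) <= (2 + 8 * p%:~R ^+ 2) `^ s * hs_weight s k.
Proof.
have k2 := sqr_ge0 (k%:~R : R); have p2 := sqr_ge0 (p%:~R : R).
rewrite /hs_weight -powRM; last 2 first.
- by rewrite addr_ge0// mulr_ge0.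
- by rewrite addr_ge0.
apply: ge0_ler_powR; rewrite ?nnegrE; first exact: s_ge0.
- by rewrite addr_ge0 ?sqr_ge0.
- by apply: mulr_ge0; apply: addr_ge0 => //; exact: mulr_ge0.
rewrite intrB intrM; have := sqr_ge0 (2 * p%:~R + k%:~R : R).
have : 0 <= (p%:~R : R) ^+ 2 * k%:~R ^+ 2 by rewrite mulr_ge0.
rewrite !expr2 in k2 p2 *; set x := (p%:~R : R) in p2 *; set y := (k%:~R : R) in k2 *.
by nra.
Qed.

Lemma hs_sq_reflect (p : int) a :
  (hs_sq s (fun k => a (2 * p - k))%R <=
    ((2 + 8 * p%:~R ^+ 2) `^ s)%:E * hs_sq s a)%E.
Proof.
apply: ge_ereal_sup => _ [X [finX _]] <-.
rewrite fsbig_finite//= sumEFin.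
pose A := [fset 2 * p - k | k in fset_set X]%fset.
have inv : {in fset_set X &, injective (fun k : int => 2 * p - k)}.
  by move=> x y _ _ /= /addrI /oppr_inj.
apply: (@le_trans _ _ (((2 + 8 * p%:~R ^+ 2) `^ s)%:E * (\sum_(k <- A)
    hs_weight s k * modulus (a k) ^+ 2)%:E)%E); last first.
  by rewrite lee_wpmul2l ?lee_fin ?powR_ge0//; exact: esum_fset_ge.
rewrite -EFinM lee_fin big_imfset //= mulr_sumr ler_sum// => k _.
rewrite [leRHS]mulrA ler_wpM2r ?sqr_ge0//.
by rewrite -{1}[k](_ : 2 * p - (2 * p - k) = k) ?hs_weight_reflect// opprB addrC subrK.
Qed.

Lemma ell2D a b : ell2 s a -> ell2 s b -> ell2 s (a + b).
Proof.
move=> ha hb; apply: le_lt_trans (hs_sqD_le _ _) _.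
by rewrite lte_mul_pinfty// lte_add_pinfty.
Qed.

Lemma ell2_mult a b (c : R) :
  (forall k, modulus (b k) <= c * modulus (a k)) -> ell2 s a -> ell2 s b.
Proof.
move=> h ha; have h' k : modulus (b k) <= `|c| * modulus (a k).
  by rewrite (le_trans (h k))// ler_wpM2r ?modulus_ge0// ler_norm.
apply: le_lt_trans (hs_sq_mult _ h') _ => //.
by rewrite lte_mul_pinfty// lee_fin sqr_ge0.
Qed.

Lemma ell2_reflect (p : int) a : ell2 s a -> ell2 s (fun k => a (2 * p - k)).
Proof.
move=> ha; apply: le_lt_trans (hs_sq_reflect _ _) _.
by rewrite lte_mul_pinfty// lee_fin powR_ge0.
Qed.

Lemma ell2_single (p : int) a : (forall k, k != p -> a k = 0) -> ell2 s a.
Proof. by move=> /hs_sq_single h; rewrite /ell2 /= h ltry. Qed.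

(** Each inverse weight between two consecutive powers of 2 is at most the value at the
    lower one, which turns the sum into a geometric series. *)
Lemma hs_weight_nat_sum : exists M, forall n,
  \sum_(1 <= i < n) (hs_weight s (i : int))^-1 <= M.
Proof.
pose u (i : nat) : R := (hs_weight s i)^-1.
have u0 i : 0 <= u i by rewrite invr_ge0 ltW ?hs_weight_gt0.
pose q : R := 2 `^ (1 - 2 * s).
have q0 : 0 < q by exact: powR_gt0.
have q1 : q < 1.
  have s1 : 0 < 2 * s - 1 by rewrite subr_gt0 -ltr_pdivrMl// mulrC.
  rewrite /q -[1 - 2 * s]opprB powRN invf_lt1 ?powR_gt0//.
  have := gt0_ltr_powR s1 (_ : 1 \in Num.nneg) (_ : 2 \in Num.nneg) (_ : 1 < 2 :> R).
  by rewrite powR1 !nnegrE; apply => //; rewrite ltr1n.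
have u_le i j : (i <= j)%N -> u j <= u i.
  move=> ij; rewrite lef_pV2 ?posrE ?hs_weight_gt0//.
  apply: ge0_ler_powR; rewrite ?nnegrE ?addr_ge0 ?sqr_ge0//; first exact: s_ge0.
  by rewrite lerD2l lerXn2r ?nnegrE ?ler0z ?ler_int.
have u_pow j : (2 ^ j)%:R * u (2 ^ j)%N <= q ^+ j.
  have -> : q ^+ j = (2 ^ j)%:R * (((2 ^ j)%:R ^+ 2) `^ s)^-1 :> R.
    rewrite -powR_mulrn ?ltW// /q -!powRrM natrX -!powR_mulrn// ?powR_ge0//.
    rewrite -!powRrM -powRN -powRD; last by apply/implyP => _; lra.
    congr powR; lra.
  rewrite ler_wpM2l// lef_pV2 ?posrE ?hs_weight_gt0 ?powR_gt0 ?exprn_gt0 ?ltr0n ?expn_gt0//.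
  apply: ge0_ler_powR; rewrite ?nnegrE ?addr_ge0 ?sqr_ge0//; first exact: s_ge0.
  by rewrite lerDr.
have dyadic j : \sum_(1 <= i < 2 ^ j) u i <= (1 - q ^+ j) / (1 - q).
  elim: j => [|j IH]; first by rewrite expn0 big_geq// expr0 subrr mul0r.
  rewrite (@big_cat_nat _ _ _ (2 ^ j)) ?expn_gt0 ?leq_exp2l//=.
  have -> : (1 - q ^+ j.+1) / (1 - q) = (1 - q ^+ j) / (1 - q) + q ^+ j.
    by rewrite exprS; field; rewrite subr_eq0 gt_eqF.
  apply: lerD => //; apply: le_trans (u_pow j).
  apply: (@le_trans _ _ (\sum_(2 ^ j <= i < 2 ^ j.+1) u (2 ^ j)%N)).
    by apply: ler_sum_nat => i /andP[h _]; exact: u_le.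
  by rewrite sumr_const_nat expnS mul2n -addnn addnK mulr_natl.
exists (1 / (1 - q)) => n.
apply: (@le_trans _ _ (\sum_(1 <= i < 2 ^ n) u i)).
  case: n => [|n]; first by rewrite big_geq// expn0 big_geq.
  rewrite [leRHS](@big_cat_nat _ _ _ n.+1) //=; last exact: ltnW (ltn_expl _ _).
  by rewrite lerDl sumr_ge0.
apply: le_trans (dyadic n) _; rewrite ler_pM2r ?invr_gt0 ?subr_gt0//.
by rewrite gerBl exprn_ge0// ltW.
Qed.

Lemma hs_weight_sum : exists M, forall A : {fset int},
  \sum_(k <- A) (hs_weight s k)^-1 <= M.
Proof.
have [M hM] := hs_weight_nat_sum.
have u0 (k : int) : 0 <= (hs_weight s k)^-1 by rewrite invr_ge0 ltW ?hs_weight_gt0.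
have {}hM n : \sum_(0 <= i < n) (hs_weight s (i : int))^-1 <= (hs_weight s 0)^-1 + M.
  case: n => [|n]; last by rewrite big_ltn// lerD2l.
  by rewrite big_geq// addr_ge0//; have := hM 0%N; rewrite big_geq.
have half (B : {fset int}) : {in B &, injective absz} ->
    \sum_(k <- B) (hs_weight s k)^-1 <= (hs_weight s 0)^-1 + M.
  move=> inj; have [N hN] := fset_nat_bound [fset absz k | k in B]%fset.
  apply: le_trans (hM N).
  have -> : \sum_(k <- B) (hs_weight s k)^-1 =
      \sum_(i <- [fset absz k | k in B]%fset) (hs_weight s (i : int))^-1.
    rewrite big_imfset //=; apply: eq_bigr => k _.
    by case: k => n //=; rewrite /hs_weight NegzE mulrNz sqrrN.
  rewrite -[leRHS](_ : \sum_(i <- [fset i in iota 0 N]%fset) (hs_weight s (i : int))^-1 = _).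
    apply: le_sum_fset => //.
    by apply/fsubsetP => i /hN iN; rewrite !inE /= mem_iota.
  by rewrite big_imfset //= undup_id ?iota_uniq// /index_iota subn0.
exists (((hs_weight s 0)^-1 + M) + ((hs_weight s 0)^-1 + M)) => A.
rewrite (big_fsetID _ (fun k : int => 0 <= k) A) /=; apply: lerD; apply: half.
  move=> x y; rewrite !inE /= => /andP[_ x0] /andP[_ y0] xy.
  by rewrite -(gez0_abs x0) -(gez0_abs y0) xy.
move=> x y; rewrite !inE /= -!ltNge => /andP[_ x0] /andP[_ y0] xy.
by apply: oppr_inj; rewrite -(ltz0_abs x0) -(ltz0_abs y0) xy.
Qed.

(** Since s > 1/2 the inverse weights are summable, and 2 |a_k| is at most w_k
    |a_k|^2 + 1 / w_k. *)
Lemma ell2_abs_summable a : ell2 s a -> abs_summable (a : int -> C).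
Proof.
move=> /ell2P ha.
apply: abs_summable_le (bounded_sumD ha hs_weight_sum) _ => k.
have w0 := hs_weight_gt0 k; have a0 := modulus_ge0 (a k : C).
set w := hs_weight s k in w0 *; set x := modulus _ in a0 *.
have : 0 <= w * (x - w^-1) ^+ 2 by rewrite mulr_ge0 ?sqr_ge0// ltW.
have -> : w * (x - w^-1) ^+ 2 = w * x ^+ 2 - 2 * x + w^-1 by field; rewrite gt_eqF.
by lra.
Qed.

End WeightedSquareSums.

(** * Uniqueness of Fourier coefficients *)

Section FourierSeries.
Variables (R : realType) (s : R).
Hypothesis s_gt : 1 / 2 < s.
Local Notation C := R[i].
Implicit Types (a b : modes R) (z : C) (x : R).

Lemma abs_summable_expi (f : int -> C) (phi : int -> R) : abs_summable f ->
  abs_summable (fun k => f k * expi (phi k)).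
Proof.
by move=> hf; apply: abs_summable_le hf _ => k; rewrite modulusM modulus_expi mulr1.
Qed.

Lemma has_sum_fourier a x : ell2 s a ->
  has_sum (@cnorm R) (fun k : int => (a k : C) * expi (k%:~R * x)) (fourier a x).
Proof.
move=> /(ell2_abs_summable s_gt) ha; apply: has_total_sum.
exact: (@abs_summable_expi _ (fun k => k%:~R * x)).
Qed.

Lemma expiX x n : expi x ^+ n = expi (n%:R * x).
Proof.
elim: n => [|n IH]; first by rewrite expr0 mul0r expi0.
by rewrite exprS IH -expiD [in RHS]mulrS mulrDl mul1r.
Qed.

Lemma expi_neq1 x : 0 < `|x| < 2 * pi -> expi x != 1.
Proof.
wlog x0 : x / 0 <= x => [hw|] /andP[xpos xlt].
  have [x0|/ltW x0] := leP 0 x; first by apply: hw => //; rewrite xpos.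
  rewrite -[x]opprK -conj_expi; apply/eqP => /(congr1 conjc).
  rewrite conjcK rmorph1; apply/eqP/hw; first by rewrite oppr_ge0.
  by rewrite normrN xpos.
rewrite ger0_norm// in xpos xlt.
have s0 : 0 < sin (x / 2) by rewrite sin_gt0_pi// divr_gt0//= ltr_pdivrMr// mulrC.
apply/eqP => /(congr1 (@complex.Re R)) /=.
have -> : cos x = 1 - 2 * sin (x / 2) ^+ 2.
  rewrite (_ : cos x = cos (x / 2 + x / 2)); last by congr cos; field.
  by rewrite cosD -!expr2 cos2sin2; ring.
have q : 0 < sin (x / 2) ^+ 2 by rewrite exprn_gt0.
by move=> h; lra.
Qed.

Lemma sum_unity_roots (N : nat) (m : int) : (0 < N)%N -> (0 < absz m < N)%N ->
  \sum_(n < N) expi (m%:~R * (2 * pi * (n%:R / N%:R)) : R) = 0.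
Proof.
move=> N0 /andP[m0 mN].
pose y : R := m%:~R * (2 * pi / N%:R).
rewrite (eq_bigr (fun n : 'I_N => expi y ^+ n)); last first.
  by move=> n _; rewrite expiX /y; congr expi; ring.
have y1 : expi y != 1.
  apply: expi_neq1; rewrite normrM -intr_norm -abszE ger0_norm; last first.
    by rewrite divr_ge0// mulr_ge0// pi_ge0.
  have p0 : 0 < 2 * pi / N%:R :> R by rewrite divr_gt0 ?ltr0n// mulr_gt0 ?pi_gt0.
  rewrite mulr_gt0 ?ltr0z//=; last first.
  rewrite mulrCA -[ltRHS]mulr1 ltr_pM2l ?mulr_gt0 ?pi_gt0//.
  by rewrite ltr_pdivrMr ?ltr0n// mul1r -pmulrn ltr_nat.
have := subrX1 (expi y) N; rewrite expiX /y (_ : N%:R * _ = 0 + 2 * pi * m%:~R); last first.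
  by field; rewrite pnatr_eq0 -lt0n.
rewrite expi_2pi expi0 subrr => /esym/eqP; rewrite mulf_eq0 subr_eq0.
by rewrite -/y (negbTE y1) /= => /eqP.
Qed.

Lemma has_sum_sum (I : choiceType) (N : nat) (F : 'I_N -> I -> C) (l : 'I_N -> C) :
  (forall n, has_sum (@cnorm R) (F n) (l n)) ->
  has_sum (@cnorm R) (fun i => \sum_(n < N) F n i) (\sum_(n < N) l n).
Proof.
elim: N F l => [|N IH] F l h.
  rewrite big_ord0; apply/has_sumP => e e0; exists fset0 => B _.
  by rewrite big1 ?subrr ?modulus0// => i _; rewrite big_ord0.
rewrite big_ord_recr /=; apply: (@eq_has_sum _ _ (fun i =>
  \sum_(n < N) F (widen_ord (leqnSn N) n) i + F ord_max i)) => [i|].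
  by rewrite big_ord_recr.
by apply: has_sumD => //; exact: IH.
Qed.

Lemma summable_tail (I : choiceType) (c : I -> C) (e : R) : abs_summable c -> 0 < e ->
  exists A : {fset I}, forall B : {fset I}, [disjoint A & B]%fset ->
    \sum_(k <- B) modulus (c k) <= e.
Proof.
move=> [M hM] e0.
have [S hS] := nonneg_sum_exists (fun k => modulus_ge0 (c k)) hM.
have [A hA] := hS (e / 2) ltac:(lra).
exists A => B dAB; have := hA _ (fsubset_refl A); have := hA _ (fsubsetUl A B).
rewrite (sum_fsetD _ (fsubsetUl A B)).
have -> : ((A `|` B) `\` A)%fset = B.
  by rewrite fsetDUl fsetDv fset0U; apply/fsetDidPl; rewrite fdisjoint_sym.
set t := \sum_(k <- B) _; set u := \sum_(k <- A) _.
by move=> /ltr_normlP[h1 h2] /ltr_normlP[h3 h4]; lra.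
Qed.

(** Averaging the series over the N-th roots of unity keeps only the
    coefficients whose index is a multiple of N; for N large, the coefficient of
    index 0 is thus the average up to an arbitrarily small tail. *)
Lemma fourier_mean_unique (c : int -> C) : abs_summable c ->
    (forall x, has_sum (@cnorm R) (fun k : int => c k * expi (k%:~R * x)) 0) ->
  c 0 = 0.
Proof.
move=> hc h0; apply: modulus_eq0; apply/eqP; rewrite eq_le modulus_ge0 andbT.
apply/ler_addgt0Pr => e e0; rewrite add0r.
have e20 : 0 < e / 2 by rewrite divr_gt0.
have [A hA] := summable_tail hc e20.
have [N' hN'] := fset_nat_bound [fset absz k | k in A]%fset.
pose N := N'.+1.
pose mult (k : int) : C :=
  N%:R^-1 * \sum_(n < N) expi (k%:~R * (2 * pi * (n%:R / N%:R)) : R).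
have NR0 : N%:R != 0 :> C by rewrite pnatr_eq0.
have mult_le k : modulus (mult k) <= 1.
  rewrite /mult; have -> : (N%:R^-1 : C) = (N%:R^-1 : R)%:C by rewrite fmorphV rmorph_nat.
  rewrite modulusM modulus_real ger0_norm// ler_pdivrMl ?ltr0n// mulr1.
  apply: le_trans (modulus_sum _ _ _) _; under eq_bigr do rewrite modulus_expi.
  by rewrite sumr_const card_ord.
have mult0 : mult 0 = 1.
  rewrite /mult (eq_bigr (fun=> 1)); first by rewrite sumr_const card_ord mulVf.
  by move=> n _; rewrite mul0r expi0.
have hm : has_sum (@cnorm R) (fun k => c k * mult k) 0.
  have := has_sum_sum (fun n : 'I_N => h0 (2 * pi * (n%:R / N%:R))).
  rewrite big1// => /(has_sumZ N%:R^-1); rewrite mulr0; apply: eq_has_sum => k.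
  by rewrite /mult -mulr_sumr mulrCA.
move/has_sumP: hm => /(_ _ e20)[A' hA'].
pose B := (0 |` (A `|` A'))%fset.
have A'B : (A' `<=` B)%fset.
  by apply/fsubsetP => k kA'; rewrite !inE kA' !orbT.
have := hA' B A'B; rewrite subr0.
have -> : \sum_(k <- B) c k * mult k = c 0 + \sum_(k <- (B `\` (0 |` A))%fset) c k * mult k.
  have sub : (0 |` A `<=` B)%fset.
    by apply/fsubsetP => k; rewrite !inE => /orP[->|->]; rewrite ?orbT.
  rewrite (sum_fsetD _ sub).
  congr (_ + _); rewrite (big_fsetD1 0) ?inE ?eqxx//= mult0 mulr1 big1_seq ?addr0//.
  move=> k; rewrite !inE => /= /andP[k0]; rewrite (negbTE k0) /= => kA.
  rewrite /mult sum_unity_roots ?mulr0// absz_gt0 k0 /=.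
  by rewrite ltnS ltnW// hN'//; apply/imfsetP; exists k.
set t := \sum_(k <- (B `\` _)%fset) _ => h1.
have h2 : modulus t <= e / 2.
  apply: le_trans (modulus_sum _ _ _) _; apply: le_trans (hA (B `\` (0 |` A))%fset _).
    by apply: ler_sum => k _; rewrite modulusM ler_piMr ?modulus_ge0.
  by apply/fdisjointP => k kA; rewrite !inE kA orbT.
have -> : c 0 = (c 0 + t) - t by ring.
by have := modulusB (c 0 + t) t; lra.
Qed.

(** Multiplication by e^(-ikx) moves the coefficient of index k to index 0,
    where the mean value determines it. *)
Lemma fourier_inj a b : ell2 s a -> ell2 s b ->
  (forall x, fourier a x = fourier b x) -> forall k, a k = b k.
Proof.
move=> ha hb hab k; apply/eqP; rewrite -subr_eq0; apply/eqP.
pose c (j : int) : C := (a (j + k) : C) - b (j + k).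
have := @fourier_mean_unique c; rewrite /c add0r; apply.
  apply: abs_summableD; first exact: bounded_sum_reindex (addIr k) (ell2_abs_summable s_gt ha).
  have := bounded_sum_reindex (addIr k) (ell2_abs_summable s_gt hb).
  by move=> hb'; apply: abs_summable_le hb' _ => j; rewrite modulusN.
move=> x.
have := has_sumD (has_sum_fourier x ha) (has_sumN (has_sum_fourier x hb)).
rewrite hab subrr => /(has_sum_reindex (addrK k) (subrK k)) /(has_sumZ (expi (- (k%:~R * x)))).
rewrite mulr0; apply: eq_has_sum => j; rewrite intrD mulrDl expiD.
have := expiNM (k%:~R * x); set u := expi (- _); set v := expi (k%:~R * x) => uv.
transitivity (((a (j + k) : C) - (b (j + k) : C)) * expi (j%:~R * x) * (u * v)).
  move: (a (j + k)) (b (j + k)) => A B; rewrite -[Rcomplex R]/C in A B *.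
  by ring.
by rewrite uv mulr1.
Qed.

End FourierSeries.

(** * Derivatives of complex-valued functions *)

Section ComplexDerivatives.
Variable R : realType.
Local Notation C := R[i].
Implicit Types (f g : R -> C) (z w l : C) (t x : R).

Lemma ReM z w : complex.Re (z * w) = complex.Re z * complex.Re w - complex.Im z * complex.Im w.
Proof. by case: z => a b; case: w. Qed.

Lemma ImM z w : complex.Im (z * w) = complex.Re z * complex.Im w + complex.Im z * complex.Re w.
Proof. by case: z => a b; case: w. Qed.

Lemma ReD z w : complex.Re (z + w) = complex.Re z + complex.Re w.
Proof. by case: z => a b; case: w. Qed.

Lemma ImD z w : complex.Im (z + w) = complex.Im z + complex.Im w.
Proof. by case: z => a b; case: w. Qed.

Lemma ReB z w : complex.Re (z - w) = complex.Re z - complex.Re w.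
Proof. exact: (raddfB (@complex.Re R : Rcomplex R -> R)). Qed.

Lemma ImB z w : complex.Im (z - w) = complex.Im z - complex.Im w.
Proof. exact: (raddfB (@complex.Im R : Rcomplex R -> R)). Qed.

Lemma is_derive_epsP (f : R -> R) (t l : R) : is_derive t (1 : R) f l <->
  forall e, 0 < e -> exists2 d, 0 < d & forall h, `|h| < d ->
    `|f (t + h) - f t - h * l| <= e * `|h|.
Proof.
split=> [[df dl] e e0|H].
  have : (fun h => h^-1 *: ((f \o shift t) (h *: (1 : R)) - f t)) @ 0^' --> l.
    by rewrite -dl; exact: df.
  move=> /cvgrPdist_le /(_ e e0); rewrite near_withinE => /(@nbhs_norm0P _ R^o)[d d0 hd].
  exists d => // h hlt; have [->|h0] := eqVneq h 0.
    by rewrite addr0 mul0r !subrr normr0 mulr0.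
  have := hd h hlt h0; rewrite /= /GRing.scale /= mulr1 [h + t]addrC => hq.
  have -> : f (t + h) - f t - h * l = - (h * (l - h^-1 * (f (t + h) - f t))).
    by field.
  by rewrite normrN normrM mulrC ler_wpM2r.
have cv : (fun h => h^-1 *: ((f \o shift t) (h *: (1 : R)) - f t)) @ 0^' --> l.
  apply/cvgrPdist_le => e e0; rewrite near_withinE; apply/(@nbhs_norm0P _ R^o).
  have [d d0 hd] := H e e0; exists d => // h hlt h0 /=.
  rewrite /GRing.scale /= mulr1 [h + t]addrC.
  have -> : l - h^-1 * (f (t + h) - f t) = - (h^-1 * (f (t + h) - f t - h * l)).
    by field.
  by rewrite normrN normrM normfV ler_pdivrMl ?normr_gt0// [leRHS]mulrC hd.
by split; [apply/cvg_ex; exists l | apply: cvg_lim => //].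
Qed.

(** A complex-valued function of a real variable is differentiable exactly
    when it has a first-order expansion in modulus; estimates on power series
    produce derivatives in this form. *)
Lemma is_cderiveP f t l : is_cderive f t l <->
  forall e, 0 < e -> exists2 d, 0 < d & forall h, `|h| < d ->
    modulus (f (t + h) - f t - h%:C * l) <= e * `|h|.
Proof.
have eR h : complex.Re (f (t + h) - f t - h%:C * l) =
    complex.Re (f (t + h)) - complex.Re (f t) - h * complex.Re l.
  by rewrite !ReB ReM /= mul0r subr0.
have eI h : complex.Im (f (t + h) - f t - h%:C * l) =
    complex.Im (f (t + h)) - complex.Im (f t) - h * complex.Im l.
  by rewrite !ImB ImM /= mul0r addr0.
split=> [[/is_derive_epsP hR /is_derive_epsP hI] e e0|H].
  have [d d0 hd] := hR (e / 2) ltac:(lra); have [d' d0' hd'] := hI (e / 2) ltac:(lra).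
  exists (Num.min d d'); first by rewrite lt_min d0.
  move=> h; rewrite lt_min => /andP[/hd h1 /hd' h2].
  by apply: le_trans (modulus_le_ReIm _) _; rewrite eR eI; lra.
by split; apply/is_derive_epsP => e /H[d d0 hd]; exists d => // h /hd;
  apply: le_trans; rewrite -?eR -?eI ?Re_le_modulus ?Im_le_modulus.
Qed.

(** A quadratic bound on the remainder determines the derivative in the
    complex sense, which is the one that defines the Wirtinger derivatives of
    g. *)
Lemma derive1_complex (f : C -> C) (a l : C) (K d : R) : 0 < d ->
    (forall h : C, modulus h < d ->
      modulus (f (h + a) - f a - h * l) <= K * modulus h ^+ 2) ->
  derive1 (f : C^o -> C^o) (a : C^o) = l.
Proof.
move=> d0 hd; apply: cvg_lim; first exact: norm_hausdorff.
apply/cvgrPdist_le => e e0; rewrite near_withinE; apply/(@nbhs_norm0P _ C^o).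
have e0' : 0 < complex.Re e by move: e0; rewrite ltcE => /andP[].
have eE : e = (complex.Re e)%:C.
  by move: e0; rewrite ltcE => /andP[/eqP]; case: e {e0'} => x y /= ->.
have K0 : 0 < `|K| + 1 by rewrite ltr_wpDl.
exists (Num.min d (complex.Re e / (`|K| + 1)))%:C.
  by rewrite /= ltcR lt_min d0 divr_gt0.
move=> h /=; rewrite normcE_modulus ltcR lt_min => /andP[h1 h2] h0 /=.
have -> : l - h^-1 *: (f (h + a) - f a) = - (h^-1 * (f (h + a) - f a - h * l)).
  by rewrite /GRing.scale /=; field.
rewrite normrN normcE_modulus eE lecR modulusM.
have mh : 0 < modulus h.
  by rewrite lt_neqAle modulus_ge0 andbT eq_sym; apply: contra h0 => /eqP/modulus_eq0/eqP.
rewrite [modulus h^-1](Normc.normcV h) ler_pdivrMl//.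
apply: le_trans (hd h h1) _; rewrite expr2 mulrCA ler_wpM2l ?modulus_ge0//.
rewrite ltr_pdivlMr// in h2; apply: le_trans (ltW h2).
rewrite mulrC ler_wpM2l ?modulus_ge0//; have := ler_norm K; lra.
Qed.

Lemma is_cderive_ext f g t l : f =1 g -> is_cderive f t l -> is_cderive g t l.
Proof. by move/funext ->. Qed.

Lemma is_cderive_cst z t : is_cderive (fun=> z) t 0.
Proof. by split => /=; exact: is_derive_cst. Qed.

Lemma is_cderiveD f g t l l' : is_cderive f t l -> is_cderive g t l' ->
  is_cderive (fun y => f y + g y) t (l + l').
Proof.
move=> [fr fi] [gr gi].
have eR : (fun y : R => complex.Re (f y + g y)) = (fun y => complex.Re (f y)) + (fun y => complex.Re (g y)).
  by apply/funext => y; rewrite ReD.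
have eI : (fun y : R => complex.Im (f y + g y)) = (fun y => complex.Im (f y)) + (fun y => complex.Im (g y)).
  by apply/funext => y; rewrite ImD.
split; rewrite ?eR ?eI.
  by rewrite ReD; exact: is_deriveD.
by rewrite ImD; exact: is_deriveD.
Qed.

Lemma is_cderiveM f g t l l' : is_cderive f t l -> is_cderive g t l' ->
  is_cderive (fun y => f y * g y) t (l * g t + f t * l').
Proof.
move=> [fr fi] [gr gi].
have eR : (fun y : R => complex.Re (f y * g y)) =
    (fun y => complex.Re (f y)) * (fun y => complex.Re (g y)) -
    (fun y => complex.Im (f y)) * (fun y => complex.Im (g y)).
  by apply/funext => y; rewrite ReM.
have eI : (fun y : R => complex.Im (f y * g y)) =
    (fun y => complex.Re (f y)) * (fun y => complex.Im (g y)) +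
    (fun y => complex.Im (f y)) * (fun y => complex.Re (g y)).
  by apply/funext => y; rewrite ImM.
split.
  rewrite eR; apply: (is_derive_eq (is_deriveB (is_deriveM fr gr) (is_deriveM fi gi))).
  rewrite ReD !ReM.
  by rewrite /GRing.scale /=; ring.
rewrite eI; apply: (is_derive_eq (is_deriveD (is_deriveM fr gi) (is_deriveM fi gr))).
rewrite ImD !ImM.
by rewrite /GRing.scale /=; ring.
Qed.

Lemma is_cderiveZ f z t l : is_cderive f t l ->
  is_cderive (fun y => z * f y) t (z * l).
Proof.
move=> h; have := is_cderiveM (is_cderive_cst z t) h; rewrite mul0r add0r; exact.
Qed.

Lemma is_cderive_conj f t l : is_cderive f t l ->
  is_cderive (fun y => conjc (f y)) t (conjc l).
Proof.
move=> /is_cderiveP H; apply/is_cderiveP => e /H[d d0 hd]; exists d => // h /hd.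
by rewrite -modulus_conj !rmorphB rmorphM /= oppr0.
Qed.

Lemma is_cderive_uniq f t l l' : is_cderive f t l -> is_cderive f t l' -> l = l'.
Proof.
move=> [[_ a] [_ b]] [[_ a'] [_ b']]; apply/eqP; rewrite eq_complex.
by rewrite -a -b -a' -b' !eqxx.
Qed.

Lemma cderiveE f t l : is_cderive f t l -> cderive f t = l.
Proof.
move=> [[_ a] [_ b]]; rewrite /cderive !derive1E a b; by case: l {a b}.
Qed.

Lemma is_cderive_real (f : R -> R) t (l : R) : is_derive t (1 : R) f l ->
  is_cderive (fun y => (f y)%:C) t l%:C.
Proof. by move=> h; split => //=; exact: is_derive_cst. Qed.

Lemma is_cderive_expi (a b t : R) :
  is_cderive (fun y => expi (b + y * a)) t ('i%C * a%:C * expi (b + t * a)).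
Proof.
have dl : is_derive t (1 : R) (fun y : R => b + y * a) a.
  by apply: (is_derive_eq (is_deriveD (is_derive_cst b t 1) (is_deriveM (is_derive_id t 1) (is_derive_cst a t 1)))); rewrite /GRing.scale /=; ring.
split; rewrite /expi /=.
  have := @is_derive1_comp _ (@cos R) (fun y => b + y * a) t _ _ (is_derive_cos _) dl.
  by move=> h; apply: (is_derive_eq h); ring.
have := @is_derive1_comp _ (@sin R) (fun y => b + y * a) t _ _ (is_derive_sin _) dl.
by move=> h; apply: (is_derive_eq h); ring.
Qed.

End ComplexDerivatives.

(** * Power series in several variables *)

Section Monomials.
Variables (R : realType) (n : nat).
Local Notation C := R[i].
Local Notation idx := {ffun 'I_n -> nat}.
Implicit Types (m : idx) (w h : 'I_n -> C) (t k : R).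

Definition monomial m w : C := \prod_i w i ^+ m i.
Definition mdegree m : nat := (\sum_i m i)%N.
Definition mincr i m : idx := [ffun j => (m j + (j == i))%N].
Definition mdecr i m : idx := [ffun j => (m j - (j == i))%N].
(** First-order part at [w] in the increment [h]. *)
Definition dmonomial m w h : C :=
  \sum_i (m i)%:R * h i * monomial (mdecr i m) w.

Lemma mdegree_incr i m : mdegree (mincr i m) = (mdegree m).+1.
Proof.
rewrite /mdegree (eq_bigr (fun j => (m j + (j == i))%N)); last by move=> j _; rewrite ffunE.
have -> : (\sum_j (m j + (j == i)) = \sum_j m j + \sum_j (j == i))%N by rewrite big_split.
rewrite [X in (_ + X)%N](_ : _ = 1%N) ?addn1// (bigD1 i)//= eqxx big1//.
by move=> j /negbTE ->.
Qed.

Lemma monomial_incr i m w : monomial (mincr i m) w = w i * monomial m w.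
Proof.
rewrite /monomial (bigD1 i)//= [in RHS](bigD1 i)//= ffunE eqxx addn1 exprS -mulrA.
congr (_ * (_ * _)); apply: eq_bigr => j ji.
by rewrite ffunE (negbTE ji) addn0.
Qed.

Lemma mdecr_incr i m : mdecr i (mincr i m) = m.
Proof. by apply/ffunP => j; rewrite !ffunE addnK. Qed.

Lemma mincr_decr i m : (0 < m i)%N -> mincr i (mdecr i m) = m.
Proof.
move=> mi; apply/ffunP => j; rewrite !ffunE; apply: subnK.
by case: eqP => // ->.
Qed.

Lemma mdecr_incrC i j m : (0 < m i)%N -> mdecr i (mincr j m) = mincr j (mdecr i m).
Proof.
move=> mi; apply/ffunP => l; rewrite !ffunE addnBAC//.
by case: eqP => // ->.
Qed.

Lemma mdegree_decr i m : (0 < m i)%N -> mdegree m = (mdegree (mdecr i m)).+1.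
Proof. by move=> mi; rewrite -(mdegree_incr i) mincr_decr. Qed.

Lemma mle_degree i m : (m i <= mdegree m)%N.
Proof. by rewrite /mdegree (bigD1 i)//= leq_addr. Qed.

(** Every exponent is reached from 0 by increasing one entry at a time;
    estimates on monomials are proved along this induction. *)
Lemma mdegree_ind (P : idx -> Prop) : P [ffun=> 0%N] ->
  (forall i m, P m -> P (mincr i m)) -> forall m, P m.
Proof.
move=> P0 PS m; move: {2}(mdegree m) (leqnn (mdegree m)) => d.
elim: d m => [|d IH] m.
  rewrite leqn0 => /eqP m0; rewrite (_ : m = [ffun=> 0%N])//.
  by apply/ffunP => i; rewrite ffunE; apply/eqP; rewrite -leqn0 -m0 mle_degree.
have [[i mi]|h _] := pselect (exists i, (0 < m i)%N).
  by rewrite (mdegree_decr mi) ltnS => /IH /(PS i); rewrite mincr_decr.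
rewrite (_ : m = [ffun=> 0%N])//; apply/ffunP => i; rewrite ffunE.
by apply/eqP; rewrite -leqn0 leqNgt; apply/negP => mi; apply: h; exists i.
Qed.

Lemma dmonomial_incr i m w h :
  dmonomial (mincr i m) w h = w i * dmonomial m w h + h i * monomial m w.
Proof.
have -> : h i * monomial m w = \sum_j (j == i)%:R * h j * monomial m w.
  rewrite (bigD1 i)//= eqxx mul1r big1 ?addr0// => j /negbTE ->.
  by rewrite !mul0r.
rewrite /dmonomial mulr_sumr -big_split; apply: eq_bigr => j _ /=.
rewrite ffunE natrD; have [mj0|mj] := posnP (m j).
  rewrite mj0; have [->|_] := eqVneq j i; last by rewrite !(addr0, mul0r, mulr0).
  by rewrite mdecr_incr !mul0r mulr0 !add0r.
rewrite mdecr_incrC// monomial_incr.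
case: eqVneq mj => [->|_] mj; last by rewrite mulr0n; ring.
have := monomial_incr i (mdecr i m) w; rewrite mincr_decr// => ->.
by rewrite mulr1n; ring.
Qed.

Lemma mdegree0 : mdegree ([ffun=> 0%N] : idx) = 0%N.
Proof. by rewrite /mdegree big1// => i _; rewrite ffunE. Qed.

Lemma monomial_le m w t : (forall i, modulus (w i) <= t) ->
  modulus (monomial m w) <= t ^+ mdegree m.
Proof.
move=> wt; rewrite /monomial modulus_prod /mdegree -prodrXr.
by apply: ler_prod => i _; rewrite modulus_ge0 modulusX lerXn2r ?nnegrE ?modulus_ge0// (le_trans _ (wt i))// modulus_ge0.
Qed.

Lemma monomial0 w : monomial [ffun=> 0%N] w = 1.
Proof. by rewrite /monomial big1// => i _; rewrite ffunE expr0. Qed.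

Lemma dmonomial0 w h : dmonomial [ffun=> 0%N] w h = 0.
Proof. by rewrite /dmonomial big1// => i _; rewrite ffunE !mul0r. Qed.

Lemma dmonomial_le m w h t k : 0 <= k -> 0 <= t -> (forall i, modulus (w i) <= t) ->
  (forall i, modulus (h i) <= t * k) ->
  modulus (dmonomial m w h) <= (mdegree m)%:R * k * t ^+ mdegree m.
Proof.
move=> k0 t0 wt ht; elim/mdegree_ind: m => [|i m IH].
  by rewrite dmonomial0 modulus0 mdegree0 !mul0r.
rewrite dmonomial_incr mdegree_incr; apply: le_trans (modulus_triangle _ _) _.
rewrite !modulusM (exprS t).
have -> : (mdegree m).+1%:R * k * (t * t ^+ mdegree m) =
  t * ((mdegree m)%:R * k * t ^+ mdegree m) + t * k * t ^+ mdegree m.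
  by rewrite -natr1; ring.
by apply: lerD; apply: ler_pM; rewrite ?modulus_ge0// monomial_le.
Qed.

(** Multiplying by one more variable adds to the second-order remainder only
    the product of the increment with the previous first-order term, hence the
    quadratic growth in the degree. *)
Lemma monomial_remainder m w h t k : 0 <= k -> 0 <= t ->
  (forall i, modulus (w i) <= t) -> (forall i, modulus (w i + h i) <= t) ->
  (forall i, modulus (h i) <= t * k) ->
  modulus (monomial m (fun i => w i + h i) - monomial m w - dmonomial m w h)
    <= (mdegree m)%:R ^+ 2 * k ^+ 2 * t ^+ mdegree m.
Proof.
move=> k0 t0 wt wht ht; elim/mdegree_ind: m => [|i m IH].
  by rewrite !monomial0 dmonomial0 !subrr modulus0 mdegree0 expr0n !mul0r.
rewrite dmonomial_incr mdegree_incr !monomial_incr.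
set a := monomial m _ in IH *; set b := monomial m w in IH *.
set d := dmonomial m w h in IH *.
have -> : (w i + h i) * a - w i * b - (w i * d + h i * b) =
  (w i + h i) * (a - b - d) + h i * d by ring.
apply: le_trans (modulus_triangle _ _) _; rewrite !modulusM (exprS t).
have d_le := dmonomial_le m k0 t0 wt ht.
set N := (mdegree m)%:R in IH d_le *; set T := t ^+ mdegree m in IH d_le *.
apply: (@le_trans _ _ (t * (N ^+ 2 * k ^+ 2 * T) + t * k * (N * k * T))).
  by apply: lerD; apply: ler_pM; rewrite ?modulus_ge0.
have N0 : 0 <= N by rewrite ler0n.
have T0 : 0 <= T by rewrite exprn_ge0.
have -> : (mdegree m).+1%:R = N + 1 by rewrite -natr1.
have -> : (N + 1) ^+ 2 * k ^+ 2 * (t * T) =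
  (t * (N ^+ 2 * k ^+ 2 * T) + t * k * (N * k * T)) + (N + 1) * (k ^+ 2 * (t * T)).
  by ring.
by rewrite lerDl mulr_ge0 ?addr_ge0// mulr_ge0 ?sqr_ge0// mulr_ge0.
Qed.

End Monomials.

Section PowerSums.
Variables (R : realType) (n : nat) (I : choiceType).
Local Notation C := R[i].
Local Notation idx := {ffun 'I_n -> nat}.
Implicit Types (c : I -> C) (e : I -> idx) (w h : 'I_n -> C) (r t k M : R).

(** A power series with coefficients [c x] and exponents [e x], indexed by an
    arbitrary type: formal differentiation then acts on [c] and [e] termwise,
    without any reindexing of the sum. *)
Definition psum c e w : C :=
  total_sum (@cnorm R) (fun x => c x * monomial (e x) w).

Definition dcoef (i : 'I_n) c e (x : I) : C := (e x i)%:R * c x.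
Definition dexp (i : 'I_n) e (x : I) : idx := mdecr i (e x).

(** Absolute convergence on the closed polydisc of radius [r], with the sum
    bounded by [M]. *)
Definition majorized c e r M :=
  forall A : {fset I}, \sum_(x <- A) modulus (c x) * r ^+ mdegree (e x) <= M.

Lemma majorized_ge0 c e r M : majorized c e r M -> 0 <= M.
Proof. by move=> /(_ fset0); rewrite big_seq_fset0. Qed.

Lemma psum_term_le c e w r x : (forall i, modulus (w i) <= r) ->
  modulus (c x * monomial (e x) w) <= modulus (c x) * r ^+ mdegree (e x).
Proof. by move=> wr; rewrite modulusM ler_wpM2l ?modulus_ge0 ?monomial_le. Qed.

Lemma has_psum c e w r M : majorized c e r M -> (forall i, modulus (w i) <= r) ->
  has_sum (@cnorm R) (fun x => c x * monomial (e x) w) (psum c e w).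
Proof.
move=> hM wr; apply: has_total_sum; exists M => A; apply: le_trans (hM A).
by apply: ler_sum => x _; exact: psum_term_le.
Qed.

(** A series that starts in degree k is O(t^k) on the polydisc of radius t, by
    comparison with its value at radius r. *)
Lemma psum_small c e w r t M (k : nat) : majorized c e r M -> 0 < r -> t <= r ->
    (forall x, c x != 0 -> (k <= mdegree (e x))%N) ->
    (forall i, modulus (w i) <= t) -> 0 <= t ->
  modulus (psum c e w) <= M * (t / r) ^+ k.
Proof.
move=> hM r0 tr ck wt t0.
have wr i : modulus (w i) <= r by exact: le_trans (wt i) tr.
apply: has_sum_le (has_psum hM wr) _ => A.
have q0 : 0 <= t / r by rewrite divr_ge0// ltW.
have q1 : t / r <= 1 by rewrite ler_pdivrMr// mul1r.
apply: (@le_trans _ _ (\sum_(x <- A) modulus (c x) * r ^+ mdegree (e x) * (t / r) ^+ k)).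
  apply: ler_sum => x _; have [->|/ck kx] := eqVneq (c x) 0.
    by rewrite mul0r modulus0 !mul0r.
  apply: le_trans (psum_term_le _ _ _ wt) _.
  rewrite -mulrA ler_wpM2l ?modulus_ge0//.
  have -> : t = r * (t / r) by rewrite mulrCA divff ?mulr1// gt_eqF.
  rewrite exprMn mulrAC divff ?gt_eqF// mul1r ler_wpM2l ?exprn_ge0 ?(ltW r0)//.
  by rewrite -(subnK kx) exprD ler_piMl ?exprn_ge0// exprn_ile1.
by rewrite -mulr_suml ler_wpM2r ?exprn_ge0.
Qed.

(** Differentiation multiplies a coefficient by an exponent, at most the
    degree d; halving the radius gains 2^-d, which absorbs it. *)
Lemma majorized_dcoef i c e r M : 0 < r -> majorized c e r M ->
  majorized (dcoef i c e) (dexp i e) (r / 2) (2 / r * M).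
Proof.
move=> r0 hM A.
apply: (@le_trans _ _ (2 / r * \sum_(x <- A) modulus (c x) * r ^+ mdegree (e x))); last first.
  by rewrite ler_wpM2l// divr_ge0// ltW.
rewrite mulr_sumr; apply: ler_sum => x _; rewrite /dcoef modulusM.
have -> : modulus ((e x i)%:R : C) = (e x i)%:R.
  by rewrite -(rmorph_nat (real_complex R)) modulus_real normr_nat.
have [->|ei] := posnP (e x i).
  by rewrite !mul0r mulr_ge0 ?divr_ge0 ?mulr_ge0 ?modulus_ge0 ?exprn_ge0 ?ltW.
rewrite (mdegree_decr ei) /dexp; set d := mdegree _.
have ed : (e x i)%:R <= 2 ^+ d :> R.
  rewrite -natrX ler_nat; apply: leq_trans (ltn_expl d (ltnSn 1)).
  by have := mle_degree i (e x); rewrite (mdegree_decr ei).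
rewrite exprS.
have -> : 2 / r * (modulus (c x) * (r * r ^+ d)) = modulus (c x) * (2 * r ^+ d).
  by field; rewrite gt_eqF.
rewrite [_ * modulus _]mulrC -mulrA ler_wpM2l ?modulus_ge0// expr_div_n.
have rd : 0 <= r ^+ d by rewrite exprn_ge0 ?(ltW r0).
rewrite mulrA ler_pdivrMr ?exprn_gt0//.
apply: (@le_trans _ _ (2 ^+ d * r ^+ d)); first by rewrite ler_wpM2r.
by rewrite mulrAC ler_wpM2r// ler_peMl ?exprn_ge0 ?ler1n.
Qed.

(** Summing the remainders of the monomials costs a factor d^2 in degree d,
    absorbed by 4^-d on the polydisc of radius r / 4. *)
Lemma psum_expand c e w h r M k : 0 < r -> majorized c e r M -> 0 <= k ->
  (forall i, modulus (w i) <= r / 4) -> (forall i, modulus (w i + h i) <= r / 4) ->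
  (forall i, modulus (h i) <= r / 4 * k) ->
  modulus (psum c e (fun i => w i + h i) - psum c e w
     - \sum_i h i * psum (dcoef i c e) (dexp i e) w) <= M * k ^+ 2.
Proof.
move=> r0 hM k0 wt wht ht; set t := r / 4 in wt wht ht.
have t0 : 0 < t by rewrite divr_gt0.
have tr : t <= r by rewrite /t ler_pdivrMr// ler_peMr ?ler1n// ltW.
have tr2 : t <= r / 2 by rewrite ler_pM2l// lef_pV2 ?posrE// ler_nat.
have h1 := has_psum hM (fun i => le_trans (wht i) tr).
have h2 := has_psum hM (fun i => le_trans (wt i) tr).
have h3 i := has_psum (majorized_dcoef i r0 hM) (fun i => le_trans (wt i) tr2).
have h4 := has_sum_sum (fun i : 'I_n => has_sumZ (h i) (h3 i)).
have := has_sumD (has_sumD h1 (has_sumN h2)) (has_sumN h4).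
move/has_sum_le; apply => A.
apply: (@le_trans _ _ (\sum_(x <- A) modulus (c x) * r ^+ mdegree (e x) * k ^+ 2)); last first.
  by rewrite -mulr_suml ler_wpM2r ?exprn_ge0.
apply: ler_sum => x _.
have -> : c x * monomial (e x) (fun i => w i + h i) + - (c x * monomial (e x) w) +
    - (\sum_(i < n) h i * (dcoef i c e x * monomial (dexp i e x) w)) =
  c x * (monomial (e x) (fun i => w i + h i) - monomial (e x) w - dmonomial (e x) w h).
  rewrite !mulrBr; congr (_ - _); rewrite /dmonomial mulr_sumr; apply: eq_bigr => i _.
  by rewrite /dcoef /dexp; ring.
rewrite modulusM -mulrA ler_wpM2l ?modulus_ge0//.
apply: le_trans (monomial_remainder _ k0 (ltW t0) wt wht ht) _.
set d := mdegree _; rewrite mulrAC ler_wpM2r ?sqr_ge0// /t expr_div_n.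
rewrite mulrA ler_pdivrMr ?exprn_gt0// mulrC ler_wpM2l ?exprn_ge0 ?(ltW r0)//.
have -> : 4 ^+ d = (2 ^+ d) ^+ 2 :> R.
  by rewrite -exprM mulnC exprM; congr (_ ^+ _); rewrite expr2 -natrM.
by rewrite lerXn2r ?nnegrE ?exprn_ge0// -natrX ler_nat ltnW// ltn_expl.
Qed.

(** Finitely many conditions that hold near 0 hold on a common neighbourhood;
    a sum of inverses avoids a finite minimum. *)
Lemma uniform_radius (P : 'I_n -> R -> Prop) :
  (forall i, exists2 d, 0 < d & forall y, `|y| < d -> P i y) ->
  exists2 d, 0 < d & forall y, `|y| < d -> forall i, P i y.
Proof.
move=> hP.
have {}hP i : {d : R | 0 < d /\ forall y, `|y| < d -> P i y}.
  by apply: cid; have [d] := hP i; exists d.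
pose d i := projT1 (hP i); pose S := 1 + \sum_i (d i)^-1.
have di0 i : 0 < d i by case: (projT2 (hP i)).
have Sd i : (d i)^-1 <= S.
  rewrite /S (bigD1 i)//= addrCA lerDl addr_ge0// sumr_ge0// => j _.
  by rewrite invr_ge0 ltW.
have S0 : 0 < S by rewrite ltr_pwDl// sumr_ge0// => i _; rewrite invr_ge0 ltW.
exists S^-1; first by rewrite invr_gt0.
move=> y yS i; have [_] := projT2 (hP i); apply; apply: lt_le_trans yS _.
by rewrite -/(d i) -[leRHS]invrK lef_pV2 ?posrE ?invr_gt0.
Qed.

(** The chain rule: along the path the increment is linear up to a small
    multiple of the time, and the expansion of the series is quadratic in the
    increment. *)
Lemma is_cderive_psum c e r M (gam : R -> 'I_n -> C) (gam' : 'I_n -> C) (x : R) :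
  0 < r -> majorized c e r M ->
  (forall i, is_cderive (fun y => gam y i) x (gam' i)) ->
  (forall i, modulus (gam x i) < r / 4) ->
  is_cderive (fun y => psum c e (gam y)) x
    (\sum_i gam' i * psum (dcoef i c e) (dexp i e) (gam x)).
Proof.
move=> r0 hM dgam gamr; apply/is_cderiveP => eps eps0.
have M0 := majorized_ge0 hM.
pose P i := psum (dcoef i c e) (dexp i e) (gam x).
pose S := \sum_i modulus (P i); pose G := \sum_i modulus (gam' i).
have S0 : 0 <= S by rewrite sumr_ge0// => i _; exact: modulus_ge0.
have G0 : 0 <= G by rewrite sumr_ge0// => i _; exact: modulus_ge0.
have Gi i : modulus (gam' i) <= G.
  by rewrite /G (bigD1 i)//= lerDl sumr_ge0// => j _; exact: modulus_ge0.
have G10 : 0 < G + 1 by rewrite ltr_wpDl.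
pose eps1 := Num.min 1 (eps / (2 * (S + 1))).
have eps10 : 0 < eps1 by rewrite lt_min ltr01 divr_gt0// mulr_gt0// ltr_wpDl.
have eps11 : eps1 <= 1 by rewrite ge_min lexx.
have eps1S : eps1 * S <= eps / 2.
  apply: (@le_trans _ _ (eps / (2 * (S + 1)) * (S + 1))).
    by apply: ler_pM => //; rewrite ?(ltW eps10) ?ge_min ?lexx ?orbT// lerDl.
  by rewrite invfM mulrA mulfVK// gt_eqF// ltr_wpDl.
pose q := (G + 1) * (4 / r).
have q0 : 0 <= q by rewrite mulr_ge0 ?addr_ge0// divr_ge0// ltW.
have [d d0 hd] : exists2 d, 0 < d & forall y, `|y| < d -> forall i,
    modulus (gam (x + y) i - gam x i - y%:C * gam' i) <= eps1 * `|y| /\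
    modulus (gam (x + y) i) <= r / 4.
  apply: uniform_radius => i.
  have [d d0 hd] := (is_cderiveP _ _ _).1 (dgam i) eps1 eps10.
  exists (Num.min d ((r / 4 - modulus (gam x i)) / (G + 1))).
    by rewrite lt_min d0 divr_gt0 ?subr_gt0// ltr_wpDl.
  move=> y; rewrite lt_min => /andP[/hd h1]; rewrite ltr_pdivlMr// => h2.
  split=> //; have -> : gam (x + y) i = (gam (x + y) i - gam x i - y%:C * gam' i) +
     (gam x i + y%:C * gam' i) by ring.
  apply: le_trans (modulus_triangle _ _) _.
  have := modulus_triangle (gam x i) (y%:C * gam' i); rewrite modulusM modulus_real.
  have := Gi i; have := normr_ge0 y; move: h1 h2; nra.
exists (Num.min d (eps / (2 * (M * q ^+ 2 + 1)))).
  by rewrite lt_min d0 divr_gt0// mulr_gt0// ltr_wpDl// mulr_ge0 ?sqr_ge0.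
move=> y; rewrite lt_min => /andP[/hd {}hd].
have Mq0 : 0 < M * q ^+ 2 + 1 by rewrite ltr_wpDl// mulr_ge0 ?sqr_ge0.
rewrite ltr_pdivlMr ?mulr_gt0// => hy.
pose D i := gam (x + y) i - gam x i.
have gamD : (fun i => gam x i + D i) = gam (x + y).
  by apply/funext => i; rewrite /D addrC subrK.
have Dle i : modulus (D i) <= r / 4 * (q * `|y|).
  have [h1 _] := hd i.
  have -> : r / 4 * (q * `|y|) = (G + 1) * `|y| by rewrite /q; field; rewrite gt_eqF.
  have -> : D i = (gam (x + y) i - gam x i - y%:C * gam' i) + y%:C * gam' i.
    by rewrite /D; ring.
  apply: le_trans (modulus_triangle _ _) _; rewrite modulusM modulus_real.
  have := Gi i; have := normr_ge0 y; nra.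
have := @psum_expand c e (gam x) D r M (q * `|y|) r0 hM.
rewrite gamD => /(_ (mulr_ge0 q0 (normr_ge0 _)) (fun i => ltW (gamr i))).
move=> /(_ (fun i => (eq_ind_r (fun f : 'I_n -> C => modulus (f i) <= r / 4) (proj2 (hd i)) gamD)) Dle).
set X := psum c e (gam (x + y)); set Y := psum c e (gam x) => h1.
have -> : X - Y - y%:C * (\sum_i gam' i * P i) =
    (X - Y - \sum_i D i * P i) + \sum_i (D i - y%:C * gam' i) * P i.
  have -> : \sum_i (D i - y%:C * gam' i) * P i =
      \sum_i D i * P i - y%:C * (\sum_i gam' i * P i).
    by rewrite mulr_sumr -sumrB; apply: eq_bigr => i _; ring.
  by ring.
apply: le_trans (modulus_triangle _ _) _.
have h2 : modulus (\sum_i (D i - y%:C * gam' i) * P i) <= eps1 * `|y| * S.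
  apply: le_trans (modulus_sum _ _ _) _; rewrite mulr_sumr ler_sum// => i _.
  by rewrite modulusM ler_wpM2r ?modulus_ge0//; have [] := hd i.
have h3 : M * (q * `|y|) ^+ 2 <= eps / 2 * `|y|.
  rewrite exprMn (expr2 `|y|) mulrA mulrA ler_wpM2r//.
  have : M * q ^+ 2 * `|y| <= (M * q ^+ 2 + 1) * `|y| by rewrite ler_wpM2r// lerDl.
  by move: hy; set u := M * q ^+ 2; move=> hy h; lra.
have : eps1 * `|y| * S <= eps / 2 * `|y| by rewrite mulrAC ler_wpM2r.
lra.
Qed.

End PowerSums.

(** * The nonlinearity along plane waves *)

Section LocalDerivatives.
Variable R : realType.
Local Notation C := R[i].

Lemma conjcM (z w : C) : conjc (z * w) = conjc z * conjc w.
Proof. exact: rmorphM. Qed.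

Lemma conjcD (z w : C) : conjc (z + w) = conjc z + conjc w.
Proof. exact: rmorphD. Qed.

Lemma conjcN (z : C) : conjc (- z) = - conjc z.
Proof. exact: rmorphN. Qed.

Lemma conjc_i : conjc 'i%C = - 'i%C :> C.
Proof. by apply/eqP; rewrite eq_complex /= oppr0 !eqxx. Qed.

Lemma is_cderive_near (f g : R -> C) (t d : R) (l : C) : 0 < d ->
  (forall y, `|y| < d -> f (t + y) = g (t + y)) ->
  is_cderive f t l -> is_cderive g t l.
Proof.
move=> d0 fg /is_cderiveP H; apply/is_cderiveP => e /H[d' d'0 hd].
exists (Num.min d d'); first by rewrite lt_min d0.
move=> y; rewrite lt_min => /andP[h1 h2]; rewrite -fg//.
by have := fg 0; rewrite normr0 addr0 => <- //; exact: hd.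
Qed.

Lemma is_cderive_path (u w : C) (t : R) :
  is_cderive (fun y => u + y%:C * w) t w.
Proof.
have := is_cderiveD (is_cderive_cst u t)
  (is_cderiveM (is_cderive_real (is_derive_id t 1)) (is_cderive_cst w t)).
by rewrite mulr0 addr0 add0r mul1r.
Qed.

Lemma modulus_path_small (u w : C) (rho : R) : modulus u < rho ->
  exists2 d, 0 < d & forall y : R, `|y| < d -> modulus (u + y%:C * w) < rho.
Proof.
move=> ur; have w0 : 0 < modulus w + 1 by rewrite ltr_wpDl// modulus_ge0.
exists ((rho - modulus u) / (modulus w + 1)); first by rewrite divr_gt0// subr_gt0.
move=> y; rewrite ltr_pdivlMr// => h.
apply: le_lt_trans (modulus_triangle _ _) _; rewrite modulusM modulus_real.
by have := normr_ge0 y; nra.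
Qed.

End LocalDerivatives.

Section Nonlinearity.
Variable R : realType.
Local Notation C := R[i].
Local Notation idx := {ffun 'I_4 -> nat}.

Definition o0 : 'I_4 := @Ordinal 4 0 isT.
Definition o1 : 'I_4 := @Ordinal 4 1 isT.
Definition o2 : 'I_4 := @Ordinal 4 2 isT.
Definition o3 : 'I_4 := @Ordinal 4 3 isT.

Lemma sum_ord4 (V : nmodType) (F : 'I_4 -> V) :
  \sum_i F i = F o0 + F o1 + F o2 + F o3.
Proof.
rewrite !big_ord_recl big_ord0 addr0 !addrA.
by congr (F _ + F _ + F _ + F _); apply: val_inj.
Qed.

Lemma vec4_forall (P : C -> Prop) (a b c d : C) : P a -> P b -> P c -> P d ->
  forall i, P (vec4 a b c d i).
Proof. by move=> ? ? ? ? [[|[|[|[|]]]]]. Qed.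

Variables (D : set ('I_4 -> C)) (g : ('I_4 -> C) -> C).
Hypothesis g_adm : admissible D g.

(** All the analytic information on g near the origin: one power series, with
    a common polydisc for it and for its first two derivatives. *)
Lemma local_expansion : exists (r M : R) (c : idx -> C),
  [/\ 0 < r, majorized c id r M, forall m, c m != 0 -> (5 <= mdegree m)%N,
      forall w, (forall i, modulus (w i) < r) -> g w = psum c id w &
      forall w, (forall i, modulus (w i) < r) -> D w].
Proof.
case: g_adm => D0 Dan _ [r [c [r0 c0 hc]]] _.
have [r' [c' [r'0 hD]]] := Dan _ D0.
pose q := Num.min r r' / 2.
have q0 : 0 < q by rewrite divr_gt0// lt_min r0.
have qr : q < r.
  by rewrite ltr_pdivrMr// (@le_lt_trans _ _ r) ?ge_min ?lexx// ltr_pMr// ltr1n.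
have qr' : q < r'.
  by rewrite ltr_pdivrMr// (@le_lt_trans _ _ r') ?ge_min ?lexx ?orbT// ltr_pMr// ltr1n.
have hs w : (forall i, modulus (w i) < r) ->
    has_sum (@cnorm R) (fun m => c m * monomial (id m) w) (g w).
  move=> /hc; apply: eq_has_sum => m; congr (_ * _).
  by apply: eq_bigr => i _; rewrite subr0.
have mq : modulus (q%:C) = q by rewrite modulus_real gtr0_norm.
have [M hM] : abs_summable (fun m => c m * monomial m (fun=> q%:C)).
  by apply: has_sum_abs (hs _ _) => i; rewrite mq.
exists q, M, c; split=> //.
- move=> A; apply: le_trans (hM A); apply: ler_sum => m _.
  rewrite modulusM /monomial modulus_prod /mdegree -prodrXr.
  have -> : \prod_i modulus (q%:C ^+ m i) = \prod_i q ^+ m i.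
    by apply: eq_bigr => i _; rewrite modulusX mq.
  by [].
- by move=> m; apply: contraNT; rewrite -ltnNge => /c0 ->.
- move=> w wq; have wr i : modulus (w i) < r by apply: lt_trans (wq i) qr.
  by have := hs w wr => /total_sumE <-.
- by move=> w wq; apply: (proj1 (hD w _)) => i; rewrite subr0 (lt_trans (wq i)).
Qed.

Variables (r M : R) (c : idx -> C).
Hypotheses (r0 : 0 < r) (hM : majorized c id r M).
Hypothesis c5 : forall m, c m != 0 -> (5 <= mdegree m)%N.
Hypothesis gE : forall w, (forall i, modulus (w i) < r) -> g w = psum c id w.
Hypothesis DE : forall w, (forall i, modulus (w i) < r) -> D w.

Let rho := r / 8.
Let M0 : 0 <= M. Proof. exact: majorized_ge0 hM. Qed.
Let rho0 : 0 < rho. Proof. by rewrite divr_gt0. Qed.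
Let rho_r : rho < r.
Proof. by rewrite ltr_pdivrMr// ltr_pMr// ltr1n. Qed.
Let rho_r4 : rho < r / 4.
Proof. by rewrite ltr_pM2l// ltf_pV2 ?posrE// ltr_nat. Qed.
Let rho_r24 : rho = r / 2 / 4.
Proof. by rewrite /rho; field. Qed.

Definition pd1 (i : 'I_4) (w : 'I_4 -> C) : C := psum (dcoef i c id) (dexp i id) w.
Definition pd2 (i j : 'I_4) (w : 'I_4 -> C) : C :=
  psum (dcoef j (dcoef i c id) (dexp i id)) (dexp j (dexp i id)) w.

Lemma pd2C i j w : i != j -> pd2 i j w = pd2 j i w.
Proof.
move=> ij; rewrite /pd2 /psum; congr total_sum; apply/funext => m.
rewrite /dcoef /dexp !ffunE (negbTE ij) eq_sym (negbTE ij) !subn0 mulrCA.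
congr (_ * monomial _ _); apply/ffunP => k; rewrite !ffunE.
by rewrite -!subnDA addnC.
Qed.

Lemma modulus_diag4 (u v : C) (t : R) : modulus u < t -> modulus v < t ->
  forall i, modulus (diag4 u v i) < t.
Proof.
by move=> ut vt; apply: (vec4_forall (P := fun z => modulus z < t)); rewrite ?modulus_conj.
Qed.

Lemma mem_D_diag4 (u v : C) : modulus u < rho -> modulus v < rho -> D (diag4 u v).
Proof.
move=> ut vt; apply: DE => i.
by apply: lt_trans rho_r; exact: modulus_diag4.
Qed.

Lemma pd1_small i w t : 0 <= t -> t < rho -> (forall i, modulus (w i) <= t) ->
  modulus (pd1 i w) <= 2 / r * M * (t / (r / 2)) ^+ 4.
Proof.
move=> t0 trho wt; apply: (psum_small (majorized_dcoef i r0 hM)) => //.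
- by rewrite divr_gt0.
- apply: le_trans (ltW trho) _; rewrite rho_r24 ler_pdivrMr// ler_peMr ?ler1n//.
  by rewrite ltW// divr_gt0.
- move=> m; rewrite /dcoef mulf_eq0 negb_or => /andP[mi /c5].
  have {}mi : (0 < m i)%N by rewrite lt0n; apply: contra mi => /eqP ->.
  by rewrite (mdegree_decr mi).
Qed.

Lemma pd2_small i j w t : 0 <= t -> t < rho -> (forall i, modulus (w i) <= t) ->
  modulus (pd2 i j w) <= 2 / (r / 2) * (2 / r * M) * (t / (r / 2 / 2)) ^+ 3.
Proof.
move=> t0 trho wt.
have r20 : 0 < r / 2 by rewrite divr_gt0.
apply: (psum_small (majorized_dcoef j r20 (majorized_dcoef i r0 hM))) => //.
- by rewrite divr_gt0.
- by apply: le_trans (ltW trho) _; rewrite rho_r24 ler_pM2l// lef_pV2 ?posrE// ler_nat.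
- move=> m; rewrite /dcoef !mulf_eq0 !negb_or => /and3P[mj mi /c5].
  have {}mi : (0 < m i)%N by rewrite lt0n; apply: contra mi => /eqP ->.
  have {}mj : (0 < mdecr i m j)%N.
    by rewrite lt0n; apply: contra mj => /eqP; rewrite /dexp => ->.
  by rewrite (mdegree_decr mi) (mdegree_decr mj).
Qed.

Lemma is_cderive_g (gam : R -> 'I_4 -> C) (gam' : 'I_4 -> C) (t d : R) : 0 < d ->
  (forall y i, `|y| < d -> modulus (gam (t + y) i) < rho) ->
  (forall i, is_cderive (fun y => gam y i) t (gam' i)) ->
  is_cderive (fun y => g (gam y)) t (\sum_i gam' i * pd1 i (gam t)).
Proof.
move=> d0 hd dgam.
apply: (@is_cderive_near _ (fun y => psum c id (gam y)) _ _ _ _ d0).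
  by move=> y yd; rewrite gE// => i; exact: lt_trans (hd _ _ yd) rho_r.
apply: (is_cderive_psum r0 hM dgam) => i.
by have := hd 0 i; rewrite normr0 addr0 => h; apply: lt_trans (h d0) rho_r4.
Qed.

Lemma is_cderive_pd1 i (gam : R -> 'I_4 -> C) (gam' : 'I_4 -> C) (t : R) :
  (forall j, modulus (gam t j) < rho) ->
  (forall j, is_cderive (fun y => gam y j) t (gam' j)) ->
  is_cderive (fun y => pd1 i (gam y)) t (\sum_j gam' j * pd2 i j (gam t)).
Proof.
move=> hd dgam; have r20 : 0 < r / 2 by rewrite divr_gt0.
by apply: (is_cderive_psum r20 (majorized_dcoef i r0 hM) dgam) => j; rewrite -rho_r24.
Qed.

(** A partial derivative of g is the value of the termwise differentiated
    series, read off from the second-order expansion in one variable. *)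
Lemma derive1_g (j : 'I_4) (w : 'I_4 -> C) (gam : C -> 'I_4 -> C) (a : C) :
  (forall i, modulus (w i) < rho) ->
  (forall (h : C) i, gam (h + a) i = w i + (if i == j then h else 0)) ->
  derive1 (fun z : C^o => g (gam z) : C^o) (a : C^o) = pd1 j w.
Proof.
move=> wr hgam.
have [d d0 hd] : exists2 d, 0 < d & forall y : R, `|y| < d -> forall i, modulus (w i) + `|y| < rho.
  apply: uniform_radius => i; exists (rho - modulus (w i)); first by rewrite subr_gt0.
  by move=> y h; lra.
apply: (@derive1_complex _ (fun z => g (gam z)) a _ (M * (4 / r) ^+ 2) d d0) => h hh.
have gamE : gam (h + a) = (fun i => w i + (if i == j then h else 0)).
  by apply/funext => i; exact: hgam.
have gamE0 : gam a = w.
  by apply/funext => i; rewrite -[a]add0r hgam; case: ifP; rewrite addr0.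
have mh i : modulus (if i == j then h else 0) <= modulus h.
  by case: ifP => //; rewrite modulus0 modulus_ge0.
have wh i : modulus (w i + (if i == j then h else 0)) < rho.
  apply: le_lt_trans (modulus_triangle _ _) _.
  apply: (@le_lt_trans _ _ (modulus (w i) + `|modulus h|)).
    by rewrite lerD2l ger0_norm ?modulus_ge0.
  by apply: hd; rewrite ger0_norm ?modulus_ge0.
rewrite gamE gamE0 !gE; last 2 first.
- by move=> i; exact: lt_trans (wr i) rho_r.
- by move=> i; exact: lt_trans (wh i) rho_r.
have := @psum_expand _ _ _ c id w (fun i => if i == j then h else 0) r M (modulus h * (4 / r)) r0 hM.
rewrite (bigD1 j)//= eqxx [X in _ * _ + X]big1 ?addr0; last first.
  by move=> i /negbTE ->; rewrite mul0r.
have -> : M * (4 / r) ^+ 2 * modulus h ^+ 2 = M * (modulus h * (4 / r)) ^+ 2.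
  by rewrite exprMn; ring.
apply.
- by rewrite mulr_ge0 ?modulus_ge0// divr_ge0// ltW.
- by move=> i; exact: ltW (lt_trans (wr i) rho_r4).
- by move=> i; exact: ltW (lt_trans (wh i) rho_r4).
- move=> i; have -> : r / 4 * (modulus h * (4 / r)) = modulus h by field; rewrite gt_eqF.
  exact: mh.
Qed.

Lemma dg_du_barE (u v : C) : modulus u < rho -> modulus v < rho ->
  dg_du_bar g u v = pd1 o1 (diag4 u v).
Proof.
move=> ur vr; apply: (derive1_g (gam := fun z => vec4 u z v (conjc v))).
  exact: modulus_diag4.
by move=> h [[|[|[|[|]]]]] //= ?; rewrite /diag4 /vec4 /= ?addr0// addrC.
Qed.

Lemma dg_dv_barE (u v : C) : modulus u < rho -> modulus v < rho ->
  dg_dv_bar g u v = pd1 o3 (diag4 u v).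
Proof.
move=> ur vr; apply: (derive1_g (gam := fun z => vec4 u (conjc u) v z)).
  exact: modulus_diag4.
by move=> h [[|[|[|[|]]]]] //= ?; rewrite /diag4 /vec4 /= ?addr0// addrC.
Qed.

(** The two derivatives in conj u and conj v, indexed by the component. *)
Definition dg_bar (b : bool) (u v : C) : C := pd1 (if b then o3 else o1) (diag4 u v).

Lemma is_cderive_diag4 (u v : R -> C) (u' v' : C) (t : R) (i : 'I_4) :
  is_cderive u t u' -> is_cderive v t v' ->
  is_cderive (fun y => diag4 (u y) (v y) i) t (diag4 u' v' i).
Proof.
move=> hu hv; case: i => [[|[|[|[|]]]]] // ?; rewrite /diag4 /vec4 //=.
  exact: is_cderive_conj.
exact: is_cderive_conj.
Qed.

Lemma is_cderive_g_line (u v w z : C) : modulus u < rho -> modulus v < rho ->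
  is_cderive (fun y : R => g (diag4 (u + y%:C * w) (v + y%:C * z))) 0
    (w * pd1 o0 (diag4 u v) + conjc w * pd1 o1 (diag4 u v)
     + z * pd1 o2 (diag4 u v) + conjc z * pd1 o3 (diag4 u v)).
Proof.
move=> ur vr.
have [d d0 hd] := modulus_path_small w ur; have [d' d'0 hd'] := modulus_path_small z vr.
have := @is_cderive_g (fun y => diag4 (u + y%:C * w) (v + y%:C * z)) (diag4 w z) 0 (Num.min d d').
rewrite sum_ord4 !mul0r !addr0; apply; first by rewrite lt_min d0.
  move=> y i; rewrite add0r lt_min => /andP[h1 h2].
  by apply: modulus_diag4; [exact: hd | exact: hd'].
by move=> i; apply: is_cderive_diag4; exact: is_cderive_path.
Qed.

Lemma g_diag4_eq (u v u' v' : C) : modulus u < rho -> modulus v < rho ->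
  modulus u' = modulus u -> modulus v' = modulus v ->
  g (diag4 u' v') = g (diag4 u v).
Proof.
case: g_adm => _ _ _ _ [F hF] ur vr eu ev.
by rewrite !hF ?eu ?ev//; apply: mem_D_diag4; rewrite ?eu ?ev.
Qed.

(** A real-linear form on C has a unique decomposition into a C-linear and an
    antilinear part; the values at 1 and i determine it. *)
Lemma eq_Wirtinger (a b a' b' : C) (E : C) :
  (forall w, E * w * a + conjc (E * w) * b = w * a' + conjc w * b') ->
  conjc E * b = b'.
Proof.
move=> h; have := h 1; have := h 'i%C; rewrite !conjcM conjc1 conjc_i.
set Eb := conjc E.
have i2 : 'i%C * 'i%C = -1 :> C by rewrite -expr2 sqr_i.
move=> hi h1.
have : 'i%C * (E * 'i%C * a + Eb * (- 'i%C) * b) = 'i%C * ('i%C * a' + - 'i%C * b') by rewrite hi.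
have -> : 'i%C * (E * 'i%C * a + Eb * (- 'i%C) * b) = ('i%C * 'i%C) * (E * a - Eb * b) by ring.
have -> : 'i%C * ('i%C * a' + - 'i%C * b') = ('i%C * 'i%C) * (a' - b') by ring.
rewrite i2 => h2.
have : 2 * (Eb * b) = 2 * b'.
  transitivity ((E * 1 * a + Eb * 1 * b) + (-1) * (E * a - Eb * b)); first by ring.
  by rewrite h1 h2; ring.
by apply: mulfI; rewrite pnatr_eq0.
Qed.

(** The Wirtinger derivative of a function of |u|^2 and |v|^2 inherits the
    rotation invariance of the function. *)
Lemma dg_bar_rot (s s' : R) (b : bool) (u v : C) : modulus u < rho -> modulus v < rho ->
  dg_bar b (expi s * u) (expi s' * v) = (if b then expi s' else expi s) * dg_bar b u v.
Proof.
move=> ur vr.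
have eur : modulus (expi s * u) < rho by rewrite modulusM modulus_expi mul1r.
have evr : modulus (expi s' * v) < rho by rewrite modulusM modulus_expi mul1r.
have key w z := is_cderive_uniq (is_cderive_g_line (expi s * w) (expi s' * z) eur evr).
have {}key w z : expi s * w * pd1 o0 (diag4 (expi s * u) (expi s' * v))
  + conjc (expi s * w) * pd1 o1 (diag4 (expi s * u) (expi s' * v))
  + expi s' * z * pd1 o2 (diag4 (expi s * u) (expi s' * v))
  + conjc (expi s' * z) * pd1 o3 (diag4 (expi s * u) (expi s' * v)) =
  w * pd1 o0 (diag4 u v) + conjc w * pd1 o1 (diag4 u v)
     + z * pd1 o2 (diag4 u v) + conjc z * pd1 o3 (diag4 u v).
  apply: key.
  have [d d0 hd] := modulus_path_small w ur; have [d' d'0 hd'] := modulus_path_small z vr.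
  apply: (@is_cderive_near _ _ _ _ (Num.min d d') _ _ _ (is_cderive_g_line w z ur vr)).
    by rewrite lt_min d0.
  move=> y; rewrite add0r lt_min => /andP[/hd h1 /hd' h2].
  rewrite -(g_diag4_eq h1 h2 (u' := expi s * (u + y%:C * w)) (v' := expi s' * (v + y%:C * z))).
  - by congr (g (diag4 _ _)); ring.
  - by rewrite modulusM modulus_expi mul1r.
  - by rewrite modulusM modulus_expi mul1r.
have unrot x (a a' : C) : conjc (expi x) * a = a' -> a = expi x * a'.
  by move=> <-; rewrite conj_expi mulrA expiMN mul1r.
rewrite /dg_bar; case: b; apply: unrot.
  apply: (@eq_Wirtinger (pd1 o2 (diag4 (expi s * u) (expi s' * v))) _
    (pd1 o2 (diag4 u v))) => w.
  by have := key 0 w; rewrite mulr0 conjc0 !mul0r !add0r.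
apply: (@eq_Wirtinger (pd1 o0 (diag4 (expi s * u) (expi s' * v))) _
  (pd1 o0 (diag4 u v))) => w.
by have := key w 0; rewrite mulr0 conjc0 !mul0r !addr0.
Qed.

Lemma is_cderive_Im0 (f : R -> C) (t d : R) (l : C) : 0 < d ->
  (forall y, `|y| < d -> complex.Im (f (t + y)) = 0) ->
  is_cderive f t l -> complex.Im l = 0.
Proof.
move=> d0 h [_ hI].
have h0 y : `|y| < d -> (complex.Im (f (t + y)))%:C = 0 :> C by move=> /h ->.
have := is_cderive_uniq (is_cderive_near d0 h0 (is_cderive_real hI)) (is_cderive_cst 0 t).
by move=> /(congr1 (@complex.Re R)).
Qed.

(** At real points, invariance under complex conjugation turns the Wirtinger
    derivative into half a real partial derivative. *)
Lemma dg_bar_real (b : bool) (x y : R) : `|x| < rho -> `|y| < rho ->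
  complex.Im (dg_bar b x%:C y%:C) = 0.
Proof.
move=> xr yr.
have ur : modulus x%:C < rho by rewrite modulus_real.
have vr : modulus y%:C < rho by rewrite modulus_real.
have line_im w z : complex.Im (w * pd1 o0 (diag4 x%:C y%:C) + conjc w * pd1 o1 (diag4 x%:C y%:C)
     + z * pd1 o2 (diag4 x%:C y%:C) + conjc z * pd1 o3 (diag4 x%:C y%:C)) = 0.
  have [d d0 hd] := modulus_path_small w ur; have [d' d'0 hd'] := modulus_path_small z vr.
  apply: (@is_cderive_Im0 _ _ (Num.min d d') _ _ _ (is_cderive_g_line w z ur vr)).
    by rewrite lt_min d0.
  move=> t; rewrite add0r lt_min => /andP[/hd h1 /hd' h2].
  by case: g_adm => _ _ h _ _; rewrite h//; exact: mem_D_diag4.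
have sym w z : conjc w * pd1 o0 (diag4 x%:C y%:C) + w * pd1 o1 (diag4 x%:C y%:C)
     + conjc z * pd1 o2 (diag4 x%:C y%:C) + z * pd1 o3 (diag4 x%:C y%:C) =
  w * pd1 o0 (diag4 x%:C y%:C) + conjc w * pd1 o1 (diag4 x%:C y%:C)
     + z * pd1 o2 (diag4 x%:C y%:C) + conjc z * pd1 o3 (diag4 x%:C y%:C).
  have := is_cderive_g_line (conjc w) (conjc z) ur vr; rewrite !conjcK => /is_cderive_uniq; apply.
  have [d d0 hd] := modulus_path_small w ur; have [d' d'0 hd'] := modulus_path_small z vr.
  apply: (@is_cderive_near _ _ _ _ (Num.min d d') _ _ _ (is_cderive_g_line w z ur vr)).
    by rewrite lt_min d0.
  move=> t; rewrite add0r lt_min => /andP[/hd h1 /hd' h2].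
  rewrite -(g_diag4_eq h1 h2 (u' := x%:C + t%:C * conjc w) (v' := y%:C + t%:C * conjc z))//.
  - by rewrite -[RHS]modulus_conj rmorphD rmorphM /= !oppr0.
  - by rewrite -[RHS]modulus_conj rmorphD rmorphM /= !oppr0.
have aux (a b' : C) : (forall w, conjc w * a + w * b' = w * a + conjc w * b') ->
    complex.Im (1 * a + conjc 1 * b') = 0 -> complex.Im b' = 0.
  case: a b' => a1 a2 [b1 b2] /(_ 'i%C) /eqP.
  rewrite eq_complex /= => /andP[/eqP e1 /eqP e2].
  rewrite !(mul0r, mul1r, oppr0, addr0, add0r); lra.
rewrite /dg_bar; case: b; [apply: (aux (pd1 o2 (diag4 x%:C y%:C))) | apply: (aux (pd1 o0 (diag4 x%:C y%:C)))].
- by move=> w; have := sym 0 w; rewrite !(mul0r, conjc0, add0r).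
- by have := line_im 0 1; rewrite !(mul0r, conjc0, add0r).
- by move=> w; have := sym w 0; rewrite !(mul0r, conjc0, addr0).
- by have := line_im 1 0; rewrite !(mul0r, conjc0, addr0).
Qed.

Definition dg_bar_idx (b : bool) : 'I_4 := if b then o3 else o1.

(** The real amplitude N_b(x, y) by which the derivative of g multiplies the
    phase of the wave of moduli x and y. *)
Definition dg_amp (b : bool) (x y : R) : R := complex.Re (dg_bar b x%:C y%:C).

(** The real partial derivatives of the amplitude: along real directions both
    arguments u and conj u move together. *)
Definition dg_amp' (b d : bool) (x y : R) : R :=
  complex.Re (if d then pd2 (dg_bar_idx b) o2 (diag4 x%:C y%:C)
                        + pd2 (dg_bar_idx b) o3 (diag4 x%:C y%:C)
              else pd2 (dg_bar_idx b) o0 (diag4 x%:C y%:C)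
                   + pd2 (dg_bar_idx b) o1 (diag4 x%:C y%:C)).

Lemma dg_bar_amp b (x y : R) : `|x| < rho -> `|y| < rho ->
  dg_bar b x%:C y%:C = (dg_amp b x y)%:C.
Proof.
move=> xr yr; apply/eqP; rewrite eq_complex /= eqxx /=.
by rewrite dg_bar_real.
Qed.

Lemma is_cderive_dg_bar b (u v : R -> C) (u' v' : C) (t : R) :
  modulus (u t) < rho -> modulus (v t) < rho ->
  is_cderive u t u' -> is_cderive v t v' ->
  is_cderive (fun y => dg_bar b (u y) (v y)) t
    (u' * pd2 (dg_bar_idx b) o0 (diag4 (u t) (v t))
     + conjc u' * pd2 (dg_bar_idx b) o1 (diag4 (u t) (v t))
     + v' * pd2 (dg_bar_idx b) o2 (diag4 (u t) (v t))
     + conjc v' * pd2 (dg_bar_idx b) o3 (diag4 (u t) (v t))).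
Proof.
move=> ur vr hu hv.
have := @is_cderive_pd1 (dg_bar_idx b) (fun y => diag4 (u y) (v y)) (diag4 u' v') t.
rewrite sum_ord4; apply; first exact: modulus_diag4.
by move=> i; exact: is_cderive_diag4.
Qed.

Lemma is_cderive_expi0 : is_cderive (fun t : R => expi t) 0 'i%C.
Proof.
have := is_cderive_expi 1 0 (0 : R).
have -> : 'i%C * 1%:C * expi (0 + 0 * 1) = 'i%C :> C.
  by rewrite mul0r addr0 expi0 mulr1 -[1%:C]/(1 : C) mulr1.
by apply: is_cderive_ext => t; rewrite add0r mulr1.
Qed.

(** Moving along real directions computes the sum of the two Wirtinger
    derivatives of dg_bar in one variable; moving along rotations, where
    dg_bar is known by covariance, computes their difference. *)
Lemma dg_bar_partials b (x y : R) : 0 < x < rho -> 0 < y < rho ->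
  let G := pd2 (dg_bar_idx b) ^~ (diag4 x%:C y%:C) in
  [/\ G o0 + G o1 = (dg_amp' b false x y)%:C, G o2 + G o3 = (dg_amp' b true x y)%:C,
      x%:C * (G o0 - G o1) = (if b then 0 else (dg_amp b x y)%:C) &
      y%:C * (G o2 - G o3) = (if b then (dg_amp b x y)%:C else 0)].
Proof.
move=> /andP[x0 xr] /andP[y0 yr] G.
have ur : modulus x%:C < rho by rewrite modulus_real gtr0_norm.
have vr : modulus y%:C < rho by rewrite modulus_real gtr0_norm.
have real_line (h : R) (h0 : 0 < h < rho) : 0 < rho - h /\
    forall t, `|t| < rho - h -> `|h + t| < rho.
  split; first by case/andP: h0; rewrite subr_gt0.
  by move=> t; have := ler_normD h t; case/andP: h0 => ? _; rewrite (gtr0_norm (x := h)) //; lra.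
have idR (t : R) : is_cderive (fun y : R => y%:C) t 1 by exact: is_cderive_real (is_derive_id t 1).
split.
- have [d0 hd] := real_line x ltac:(by rewrite x0).
  have := @is_cderive_dg_bar b (fun t => t%:C) (fun=> y%:C) _ _ x ur vr (idR x) (is_cderive_cst y%:C x).
  rewrite conjc0 !mul0r !addr0 conjc1 !mul1r => H.
  have := is_cderive_Im0 d0 _ H => HI; apply/eqP; rewrite eq_complex /= eqxx /= HI// => t td.
  by rewrite dg_bar_real// ?hd// gtr0_norm.
- have [d0 hd] := real_line y ltac:(by rewrite y0).
  have := @is_cderive_dg_bar b (fun=> x%:C) (fun t => t%:C) _ _ y ur vr (is_cderive_cst x%:C y) (idR y).
  rewrite conjc0 !mul0r !add0r conjc1 !mul1r => H.
  have := is_cderive_Im0 d0 _ H => HI; apply/eqP; rewrite eq_complex /= eqxx /= HI// => t td.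
  by rewrite dg_bar_real// ?hd// gtr0_norm.
- have dex' := is_cderive_expi0.
  have := is_cderiveM dex' (is_cderive_cst x%:C 0).
  rewrite mulr0 addr0 => du.
  have ur0 : modulus (expi 0 * x%:C) < rho by rewrite expi0 mul1r.
  have := @is_cderive_dg_bar b (fun t => expi t * x%:C) (fun=> y%:C) _ _ 0 ur0 vr du (is_cderive_cst y%:C 0).
  rewrite conjc0 !mul0r !addr0 expi0 mul1r conjcM conjc_i conjc_real -/G => H.
  have e (t : R) : dg_bar b (expi t * x%:C) y%:C = (if b then 1 else expi t) * (dg_amp b x y)%:C.
    have := dg_bar_rot t 0 b ur vr; rewrite expi0 mul1r => ->.
    by rewrite dg_bar_amp// gtr0_norm.
  have H' := is_cderive_ext e H.
  have i0 : 'i%C != 0 :> C by apply/eqP => /(congr1 (@complex.Im R)) /= /eqP; rewrite oner_eq0.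
  apply: (mulfI i0).
  transitivity ('i%C * x%:C * G o0 + - 'i%C * x%:C * G o1); first by ring.
  apply: (is_cderive_uniq H'); case: (b) => /=.
    by rewrite mulr0; apply: is_cderive_ext (is_cderive_cst (1 * (dg_amp true x y)%:C) 0).
  have := is_cderiveM dex' (is_cderive_cst (dg_amp false x y)%:C 0).
  by rewrite mulr0 addr0.
- have dex' := is_cderive_expi0.
  have := is_cderiveM dex' (is_cderive_cst y%:C 0).
  rewrite mulr0 addr0 => du.
  have vr0 : modulus (expi 0 * y%:C) < rho by rewrite expi0 mul1r.
  have := @is_cderive_dg_bar b (fun=> x%:C) (fun t => expi t * y%:C) _ _ 0 ur vr0 (is_cderive_cst x%:C 0) du.
  rewrite conjc0 !mul0r !add0r expi0 mul1r conjcM conjc_i conjc_real -/G => H.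
  have e (t : R) : dg_bar b x%:C (expi t * y%:C) = (if b then expi t else 1) * (dg_amp b x y)%:C.
    have := dg_bar_rot 0 t b ur vr; rewrite expi0 mul1r => ->.
    by rewrite dg_bar_amp// gtr0_norm.
  have H' := is_cderive_ext e H.
  have i0 : 'i%C != 0 :> C by apply/eqP => /(congr1 (@complex.Im R)) /= /eqP; rewrite oner_eq0.
  apply: (mulfI i0).
  transitivity ('i%C * y%:C * G o2 + - 'i%C * y%:C * G o3); first by ring.
  apply: (is_cderive_uniq H'); case: (b) => /=.
    have := is_cderiveM dex' (is_cderive_cst (dg_amp true x y)%:C 0).
    by rewrite mulr0 addr0.
  by rewrite mulr0; apply: is_cderive_ext (is_cderive_cst (1 * (dg_amp false x y)%:C) 0).
Qed.

(** The differences of Wirtinger derivatives in the other variable vanish by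
    covariance, so both mixed derivatives reduce to the same second derivative
    of g. This symmetry is what makes the linearization Hermitian. *)
Lemma dg_amp'C (x y : R) : 0 < x < rho -> 0 < y < rho ->
  dg_amp' true false x y = dg_amp' false true x y.
Proof.
move=> hx hy; have [e1 _ e2 _] := dg_bar_partials true hx hy.
have [_ e3 _ e4] := dg_bar_partials false hx hy.
apply: complexI; rewrite -e1 -e3 /= in e2 e4 *.
have x0 : x%:C != 0 :> C by apply/eqP => /complexI h; rewrite h ltxx in hx.
have y0 : y%:C != 0 :> C by apply/eqP => /complexI h; rewrite h ltxx in hy.
move/eqP: e2; rewrite mulf_eq0 (negbTE x0) subr_eq0 /= => /eqP ->.
move/eqP: e4; rewrite mulf_eq0 (negbTE y0) subr_eq0 /= => /eqP ->.
by rewrite /= (@pd2C o3 o1).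
Qed.

Lemma is_derive_dg_amp b (x y : R) : 0 < x < rho -> 0 < y < rho ->
  is_derive x (1 : R) (dg_amp b ^~ y) (dg_amp' b false x y) /\
  is_derive y (1 : R) (dg_amp b x) (dg_amp' b true x y).
Proof.
move=> /andP[x0 xr] /andP[y0 yr].
have ur : modulus x%:C < rho by rewrite modulus_real gtr0_norm.
have vr : modulus y%:C < rho by rewrite modulus_real gtr0_norm.
have idR (t : R) : is_cderive (fun y : R => y%:C) t 1 by exact: is_cderive_real (is_derive_id t 1).
split.
  have [+ _] := @is_cderive_dg_bar b (fun t => t%:C) (fun=> y%:C) _ _ x ur vr (idR x) (is_cderive_cst y%:C x).
  by rewrite conjc0 !mul0r !addr0 conjc1 !mul1r.
have [+ _] := @is_cderive_dg_bar b (fun=> x%:C) (fun t => t%:C) _ _ y ur vr (is_cderive_cst x%:C y) (idR y).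
by rewrite conjc0 !mul0r !add0r conjc1 !mul1r.
Qed.

(** As g has order 5, its first and second derivatives have orders 4 and 3. *)
Lemma dg_amp_small : exists2 K : R, 0 <= K & forall b d (x y t : R),
  0 < x <= t -> 0 < y <= t -> t < rho ->
  `|dg_amp b x y| <= K * t ^+ 4 /\ `|dg_amp' b d x y| <= K * t ^+ 3.
Proof.
pose K1 := 2 / r * M * (2 / r) ^+ 4.
pose K2 := 2 / (r / 2) * (2 / r * M) * (4 / r) ^+ 3.
have r1 := ltW r0.
have K10 : 0 <= K1.
  apply: mulr_ge0; last by apply: exprn_ge0; exact: divr_ge0.
  by apply: mulr_ge0 => //; exact: divr_ge0.
have K20 : 0 <= K2.
  apply: mulr_ge0; last by apply: exprn_ge0; exact: divr_ge0.
  apply: mulr_ge0; first by apply: divr_ge0 => //; exact: divr_ge0.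
  by apply: mulr_ge0 => //; exact: divr_ge0.
exists (K1 + 2 * K2); first by rewrite addr_ge0// mulr_ge0.
move=> b d x y t /andP[x0 xt] /andP[y0 yt] trho.
have t0 : 0 <= t by rewrite (le_trans (ltW x0)).
have wt i : modulus (diag4 x%:C y%:C i) <= t.
  apply: (vec4_forall (P := fun z => modulus z <= t));
    by rewrite ?modulus_conj modulus_real gtr0_norm.
have k1 i : modulus (pd1 i (diag4 x%:C y%:C)) <= K1 * t ^+ 4.
  apply: le_trans (pd1_small i t0 trho wt) _.
  by rewrite /K1 -[leRHS]mulrA -exprMn (_ : 2 / r * t = t / (r / 2))//; field; rewrite gt_eqF.
have k2 i j : modulus (pd2 i j (diag4 x%:C y%:C)) <= K2 * t ^+ 3.
  apply: le_trans (pd2_small i j t0 trho wt) _.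
  by rewrite /K2 -[leRHS]mulrA -exprMn (_ : 4 / r * t = t / (r / 2 / 2))//; field; rewrite gt_eqF.
have t4 : 0 <= t ^+ 4 by rewrite exprn_ge0.
have t3 : 0 <= t ^+ 3 by rewrite exprn_ge0.
split.
  apply: le_trans (Re_le_modulus _) _; apply: le_trans (k1 _) _.
  by rewrite ler_wpM2r// lerDl mulr_ge0.
apply: le_trans (Re_le_modulus _) _; apply: (@le_trans _ _ (K2 * t ^+ 3 + K2 * t ^+ 3)).
  by case: d; apply: le_trans (modulus_triangle _ _) _; rewrite lerD ?k2.
by rewrite -mulrDl ler_wpM2r//; lra.
Qed.

(** Decompose each direction into its radial (real) and angular (imaginary)
    parts: the former differentiates the amplitude, the latter rotates the
    phase. *)
Lemma is_cderive_dg_bar_line b (x y : R) (w z : C) : 0 < x < rho -> 0 < y < rho ->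
  is_cderive (fun e : R => dg_bar b (x%:C + e%:C * w) (y%:C + e%:C * z)) 0
    ((dg_amp b x y / (if b then y else x))%:C * (if b then z else w)
     + ((dg_amp' b b x y - dg_amp b x y / (if b then y else x))
         * complex.Re (if b then z else w))%:C
     + (dg_amp' b (~~ b) x y * complex.Re (if b then w else z))%:C).
Proof.
move=> hx hy; have [e1 e2 e3 e4] := dg_bar_partials b hx hy.
case/andP: hx hy => x0 xr /andP[y0 yr].
have ur : modulus (x%:C + 0%:C * w) < rho by rewrite mul0r addr0 modulus_real gtr0_norm.
have vr : modulus (y%:C + 0%:C * z) < rho by rewrite mul0r addr0 modulus_real gtr0_norm.
have := @is_cderive_dg_bar b (fun e => x%:C + e%:C * w) (fun e => y%:C + e%:C * z) _ _ 0 ur vr (is_cderive_path x%:C w 0) (is_cderive_path y%:C z 0).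
rewrite !mul0r !addr0; move: e1 e2 e3 e4 => /=.
move: (pd2 _ o0 _) (pd2 _ o1 _) (pd2 _ o2 _) (pd2 _ o3 _) => P Q S T e1 e2 e3 e4.
have xC : x%:C != 0 :> C by apply/eqP => /complexI h; rewrite h ltxx in x0.
have yC : y%:C != 0 :> C by apply/eqP => /complexI h; rewrite h ltxx in y0.
have lin (a b' q : C) : q * a + conjc q * b' =
    (complex.Re q)%:C * (a + b') + 'i%C * (complex.Im q)%:C * (a - b').
  case: q a b' => q1 q2 [a1 a2] [b1 b2]; apply/eqP; rewrite eq_complex /=.
  by apply/andP; split; apply/eqP; ring.
have qE (q : C) (n a : R) : (complex.Re q)%:C * a%:C + 'i%C * (complex.Im q)%:C * n%:C =
    n%:C * q + ((a - n) * complex.Re q)%:C.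
  case: q => q1 q2; apply/eqP; rewrite eq_complex /=.
  by apply/andP; split; apply/eqP; ring.
suff -> : w * P + conjc w * Q + z * S + conjc z * T =
  (dg_amp b x y / (if b then y else x))%:C * (if b then z else w)
     + ((dg_amp' b b x y - dg_amp b x y / (if b then y else x))
         * complex.Re (if b then z else w))%:C
     + (dg_amp' b (~~ b) x y * complex.Re (if b then w else z))%:C by [].
rewrite -addrA !lin e1 e2.
case: b e1 e2 e3 e4 {ur vr} => /= _ _ e3 e4.
  move/eqP: e3; rewrite mulf_eq0 (negbTE xC) /= => /eqP ->.
  have -> : S - T = (dg_amp true x y / y)%:C.
    by apply: (mulfI yC); rewrite e4 -rmorphM /= mulrCA divff ?mulr1// gt_eqF.
  by rewrite mulr0 addr0 qE addrC; congr (_ + _); rewrite mulrC rmorphM.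
move/eqP: e4; rewrite mulf_eq0 (negbTE yC) /= => /eqP ->.
have -> : P - Q = (dg_amp false x y / x)%:C.
  by apply: (mulfI xC); rewrite e3 -rmorphM /= mulrCA divff ?mulr1// gt_eqF.
by rewrite mulr0 addr0 qE; congr (_ + _); rewrite mulrC rmorphM.
Qed.

End Nonlinearity.

Section NonlinearityStructure.
Variable R : realType.
Local Notation C := R[i].

Definition dbar (g : ('I_4 -> C) -> C) (b : bool) : C -> C -> C :=
  if b then dg_dv_bar g else dg_du_bar g.

(** All that the construction uses about g: its derivatives along waves of
    moduli x and y are real amplitudes N times the phase of the wave, with
    symmetric mixed partial derivatives and small size; the last item
    differentiates in the frame that rotates with the wave, where only real
    parts of the perturbation are coupled. *)
Lemma nonlinearity_structure (D : set ('I_4 -> C)) (g : ('I_4 -> C) -> C) :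
  admissible D g ->
  exists (rho K : R) (N : bool -> R -> R -> R) (A : bool -> bool -> R -> R -> R),
    [/\ 0 < rho, 0 <= K &
     forall x y : R, 0 < x < rho -> 0 < y < rho ->
     [/\ forall a a', D (diag4 (expi a * x%:C) (expi a' * y%:C)),
         forall b a a', dbar g b (expi a * x%:C) (expi a' * y%:C) =
           expi (if b then a' else a) * (N b x y)%:C,
         forall b, is_derive x (1 : R) (N b ^~ y) (A b false x y) /\
                   is_derive y (1 : R) (N b x) (A b true x y),
         A true false x y = A false true x y /\
         forall b d t, x <= t -> y <= t -> t < rho ->
           `|N b x y| <= K * t ^+ 4 /\ `|A b d x y| <= K * t ^+ 3 &
         forall b a a' (w z : C), is_cderive (fun e : R =>
           dbar g b (expi a * x%:C + e%:C * (expi a * w))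
                    (expi a' * y%:C + e%:C * (expi a' * z))) 0
           (expi (if b then a' else a) *
             ((N b x y / (if b then y else x))%:C * (if b then z else w)
              + ((A b b x y - N b x y / (if b then y else x))
                 * complex.Re (if b then z else w))%:C
              + (A b (~~ b) x y * complex.Re (if b then w else z))%:C))]].
Proof.
move=> g_adm; have [r [M [c [r0 hM c5 gE DE]]]] := local_expansion g_adm.
have [K K0 hK] := dg_amp_small r0 hM c5.
exists (r / 8), K, (dg_amp c), (dg_amp' c); split=> //; first by rewrite divr_gt0.
have dbarE b (u v : C) : modulus u < r / 8 -> modulus v < r / 8 ->
    dbar g b u v = dg_bar c b u v.
  by move=> ur vr; case: b; [exact: (dg_dv_barE r0 hM gE) | exact: (dg_du_barE r0 hM gE)].
move=> x y hx hy; case/andP: (hx) (hy) => x0 xr /andP[y0 yr].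
have ur a : modulus (expi a * x%:C) < r / 8 by rewrite modulusM modulus_expi mul1r modulus_real gtr0_norm.
have vr a : modulus (expi a * y%:C) < r / 8 by rewrite modulusM modulus_expi mul1r modulus_real gtr0_norm.
have xr' : modulus x%:C < r / 8 by rewrite modulus_real gtr0_norm.
have yr' : modulus y%:C < r / 8 by rewrite modulus_real gtr0_norm.
split.
- by move=> a a'; exact: (mem_D_diag4 r0 DE).
- move=> b a a'; rewrite dbarE//; rewrite (dg_bar_rot g_adm r0 hM gE DE)//.
  by rewrite (dg_bar_amp g_adm r0 hM gE DE) ?gtr0_norm//; case: b.
- by move=> b; exact: (is_derive_dg_amp r0 hM).
- split; first exact: (dg_amp'C g_adm r0 hM gE DE).
  by move=> b d t xt yt tr; apply: hK => //; rewrite ?x0 ?y0.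
- move=> b a a' w z.
  have xw0 : modulus (x%:C + 0%:C * w) < r / 8 by rewrite mul0r addr0.
  have [d d0 hd] := modulus_path_small w xr'; have [d' d'0 hd'] := modulus_path_small z yr'.
  have H := is_cderiveZ (expi (if b then a' else a))
    (is_cderive_dg_bar_line g_adm r0 hM gE DE b w z hx hy).
  apply: (@is_cderive_near _ _ _ _ (Num.min d d') _ _ _ H); first by rewrite lt_min d0.
  move=> e; rewrite add0r lt_min => /andP[/hd h1 /hd' h2].
  have e1 : expi a * x%:C + e%:C * (expi a * w) = expi a * (x%:C + e%:C * w) by ring.
  have e2 : expi a' * y%:C + e%:C * (expi a' * z) = expi a' * (y%:C + e%:C * z) by ring.
  rewrite e1 e2 dbarE ?modulusM ?modulus_expi ?mul1r//.
  by rewrite (dg_bar_rot g_adm r0 hM gE DE)//; case: b {H}.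
Qed.

End NonlinearityStructure.

(** * Negligible subsets of the plane *)

Section NullSets.
Variable R : realType.
Local Notation T := (measurableTypeR R * measurableTypeR R)%type.
Local Notation mu := ((@lebesgue_measure R) \x (@lebesgue_measure R))%E.

Definition box (sw : bool) (X Y : set (measurableTypeR R)) : set T :=
  if sw then Y `*` X else X `*` Y.

Definition fstsw (sw : bool) (z : T) : R := if sw then z.2 else z.1.

Lemma area_interval_box sw (a b c d : R) : a <= b -> c <= d ->
  mu (box sw `[a, b]%classic `[c, d]%classic) = ((b - a) * (d - c))%:E.
Proof.
move=> ab cd.
have len (u v : R) : u <= v -> lebesgue_measure (`[u, v]%classic : set R) = (v - u)%:E.
  move=> uv; rewrite lebesgue_measure_itv /= lte_fin.
  by case: ltP => // vu; rewrite (le_anti (introT andP (conj uv vu))) subrr.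
case: sw; rewrite /box product_measure1E //; first rewrite mulrC.
  by rewrite EFinM; congr (_ * _)%E; exact: len.
by rewrite EFinM; congr (_ * _)%E; exact: len.
Qed.

(** A set on which one coordinate is a 2-Lipschitz function of the other is
    covered, for every n, by n + 2 boxes of total area O(1/n). *)
Lemma Lipschitz_graph_negligible sw (E : set T) :
  (forall z, E z -> 1 <= fstsw (~~ sw) z <= 2) ->
  (forall z z', E z -> E z' ->
     `|fstsw sw z - fstsw sw z'| <= 2 * `|fstsw (~~ sw) z - fstsw (~~ sw) z'|) ->
  mu.-negligible E.
Proof.
move=> E12 Elip.
pose J (n j : nat) := `[1 + j%:R / n.+1%:R, 1 + j.+1%:R / n.+1%:R]%classic : set (measurableTypeR R).
pose pt (n j : nat) : R := xget 0 [set x | exists2 z, E z & x = fstsw sw z /\ J n j (fstsw (~~ sw) z)].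
pose X (n j : nat) := `[pt n j - 2 / n.+1%:R, pt n j + 2 / n.+1%:R]%classic : set (measurableTypeR R).
pose B n := \big[setU/set0]_(j < n.+2) box sw (X n j) (J n j).
have mbox n j : measurable (box sw (X n j) (J n j)).
  by rewrite /box; case: (sw); apply: measurableX; exact: measurable_itv.
have mB n : measurable (B n) by exact: bigsetU_measurable.
have n0 n : 0 < n.+1%:R :> R by rewrite ltr0n.
have EB n : E `<=` B n.
  move=> z Ez; have /andP[z1 z2] := E12 z Ez.
  pose t := (fstsw (~~ sw) z - 1) * n.+1%:R.
  have t0 : 0 <= t by rewrite mulr_ge0// subr_ge0.
  pose j := Num.truncn t.
  have /andP[jt tj] : j%:R <= t < j.+1%:R by apply: truncn_itv.
  have jn : (j < n.+2)%N.
    rewrite -(ltr_nat R); apply: (le_lt_trans jt); rewrite /t.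
    apply: (@le_lt_trans _ _ n.+1%:R); last by rewrite ltr_nat.
    by rewrite ler_piMl//; lra.
  have zJ : J n j (fstsw (~~ sw) z).
    rewrite /J /= in_itv /=; apply/andP; split.
      by rewrite -lerBrDl ler_pdivrMr.
    by rewrite -lerBlDl ler_pdivlMr// ltW.
  have zX : X n j (fstsw sw z).
    have [z' Ez' [pt' zJ']] : [set x | exists2 z, E z & x = fstsw sw z /\ J n j (fstsw (~~ sw) z)] (pt n j).
      by apply: (@xgetPex _ 0); exists (fstsw sw z), z.
    have := Elip z z' Ez Ez'; rewrite -pt'.
    move: zJ zJ'; rewrite /J /X /= !in_itv /= => /andP[a1 a2] /andP[b1 b2].
    have e : 1 + j.+1%:R / n.+1%:R = 1 + j%:R / n.+1%:R + n.+1%:R^-1 :> R.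
      by rewrite -natr1 mulrDl mul1r addrA.
    have dle : `|fstsw (~~ sw) z - fstsw (~~ sw) z'| <= n.+1%:R^-1.
      rewrite e in a2 b2; move: a1 a2 b1 b2.
      set v := 1 + _; set u := (n.+1%:R : R)^-1; move: (fstsw _ z) (fstsw _ z') => F F'.
      by move=> a1 a2 b1 b2; rewrite ler_norml; apply/andP; split; lra.
    move=> h; have : `|fstsw sw z - pt n j| <= 2 / n.+1%:R.
      by apply: le_trans h _; rewrite ler_wpM2l.
    move: (fstsw sw z) (pt n j) (2 / _) => F G u.
    by rewrite ler_norml => /andP[h1 h2]; apply/andP; split; lra.
  rewrite /B -(bigcup_mkord n.+2 (fun j => box sw (X n j) (J n j))); exists j => //=.
  by move: zX zJ; rewrite /fstsw /box; case: (sw).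
have muB n : (mu (B n) <= (8 / n.+1%:R)%:E)%E.
  apply: le_trans (@Boole_inequality _ _ _ mu (fun j => box sw (X n j) (J n j)) n.+2 _) _ => //.
  rewrite (eq_bigr (fun=> (4 / n.+1%:R ^+ 2)%:E)); last first.
    move=> j _; apply: etrans (area_interval_box sw _ _) _.
    - by rewrite lerD2l// ge0_cp// divr_ge0.
    - by rewrite lerD2l ler_pM2r ?invr_gt0// ler_nat.
    have -> : (j.+1)%:R = (j : nat)%:R + 1 :> R by rewrite natr1.
    congr EFin; field.
    by rewrite ?natr1 ?nat1r ?pnatr_eq0 //; move: (n0 n); rewrite -natr1; lra.
  rewrite sumEFin lee_fin sumr_const card_ord -[_ *+ n.+2]mulr_natl.
  have -> : n.+2%:R = n.+1%:R + 1 :> R by rewrite [RHS]natr1.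
  have := n0 n; have : 1 <= n.+1%:R :> R by rewrite ler1n.
  move: (n.+1%:R : R) => N N1 N0; rewrite ler_pdivlMr//.
  have -> : (N + 1) * (4 / N ^+ 2) * N = 4 * (N + 1) / N by field; rewrite gt_eqF.
  by rewrite ler_pdivrMr//; lra.
exists (\bigcap_n B n); split.
- exact: bigcap_measurable.
- apply/eqP; rewrite eq_le measure_ge0 andbT.
  apply/lee_addgt0Pr => e e0; rewrite add0e.
  pose n := Num.truncn (8 / e).
  apply: (@le_trans _ _ (mu (B n))).
    apply: le_measure; rewrite ?inE//; first exact: bigcap_measurable.
    exact: bigcap_inf.
  apply: le_trans (muB n) _; rewrite lee_fin ler_pdivrMr// mulrC -ler_pdivrMr//.
  by rewrite ltW// truncnS_gt.
- by move=> z Ez n _; exact: EB.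
Qed.

End NullSets.

(** * Resonant parameters *)

Section Frequencies.
Variables (R : realType) (rho K : R) (N : bool -> R -> R -> R)
  (A : bool -> bool -> R -> R -> R).
Hypothesis K0 : 0 <= K.
Hypothesis dN : forall b (x y : R), 0 < x < rho -> 0 < y < rho ->
  is_derive x (1 : R) (N b ^~ y) (A b false x y) /\
  is_derive y (1 : R) (N b x) (A b true x y).
Hypothesis small : forall b d (x y t : R), 0 < x < rho -> 0 < y < rho ->
  x <= t -> y <= t -> t < rho ->
  `|N b x y| <= K * t ^+ 4 /\ `|A b d x y| <= K * t ^+ 3.

(** The contribution of g to the frequency of the wave b of moduli x and y. *)
Definition freq_shift (b : bool) (x y : R) : R := N b x y / (if b then y else x).

Lemma MVT_bound (f df : R -> R) (a b B : R) : a <= b ->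
  (forall x, a <= x <= b -> is_derive x (1 : R) f (df x)) ->
  (forall x, a <= x <= b -> `|df x| <= B) -> `|f b - f a| <= B * (b - a).
Proof.
move=> ab hd hB.
have [||c hc ->] := @MVT_segment _ f df a b ab.
- by move=> x; rewrite in_itv /= => /andP[h1 h2]; apply: hd; rewrite !ltW.
- apply: derivable_within_continuous => x; rewrite in_itv /= => hx.
  by have [] := hd x hx.
by rewrite normrM (ger0_norm (x := b - a)) ?subr_ge0// ler_wpM2r ?subr_ge0// hB// -in_itv.
Qed.

Lemma Lipschitz_sym (f : R -> R) (a b B : R) (P : R -> Prop) :
  (forall u v, P u -> P v -> u <= v -> `|f v - f u| <= B * (v - u)) ->
  P a -> P b -> `|f a - f b| <= B * `|a - b|.
Proof.
move=> h Pa Pb; have [ab|/ltW ba] := leP a b.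
  by rewrite (distrC (f a)) (distrC a) (ger0_norm (x := b - a)) ?subr_ge0// h.
by rewrite (ger0_norm (x := a - b)) ?subr_ge0// h.
Qed.

(** For moduli in [m, 2m] the derivative of N / x is O(m^2): N and its
    derivative have orders 4 and 3, and x is of size m. *)
Lemma shift_Lipschitz_x b (m x x' y : R) : 0 < m -> 2 * m < rho ->
  m <= x <= 2 * m -> m <= x' <= 2 * m -> m <= y <= 2 * m ->
  `|freq_shift b x y - freq_shift b x' y| <= 24 * K * m ^+ 2 * `|x - x'|.
Proof.
move=> m0 mrho hx hx' /andP[my ym].
apply: (Lipschitz_sym (f := freq_shift b ^~ y) (P := fun u => m <= u <= 2 * m)) => //.
move=> u v /andP[mu um] /andP[mv vm] uv.
pose df w := A b false w y / (if b then y else w) - (if b then 0 else N b w y / w ^+ 2).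
apply: (@MVT_bound (fun x0 => freq_shift b x0 y) df) => // w /andP[uw wv].
  have w0 : 0 < w < rho by apply/andP; split; lra.
  have y0 : 0 < y < rho by apply/andP; split; lra.
  have [d1 _] := dN b w0 y0; rewrite /freq_shift /df; case: (b) d1 => d1.
    apply: (is_derive_eq (is_deriveM d1 (is_derive_cst y^-1 w 1))).
    by rewrite /GRing.scale /=; ring.
  have wn0 : w != 0 by rewrite gt_eqF//; case/andP: w0.
  apply: (is_derive_eq (is_deriveM d1 (is_deriveV wn0 (is_derive_id w 1)))).
  by rewrite /GRing.scale /=; field.
have w0 : 0 < w < rho by apply/andP; split; lra.
have y0 : 0 < y < rho by apply/andP; split; lra.
have [hN hA] := small b false w0 y0 (le_trans wv vm) ym mrho.
have div_le (a q B : R) : m <= q -> `|a| <= B * m -> `|a / q| <= B.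
  move=> mq ha; rewrite normrM normfV ler_pdivrMr ?normr_gt0 ?gt_eqF//; last by lra.
  have B0 : 0 <= B * m by apply: le_trans ha.
  rewrite (ger0_norm (x := q)); last by lra.
  apply: le_trans ha _; rewrite ler_wpM2l// -(pmulr_lge0 _ m0); exact: B0.
have m20 : 0 <= K * m ^+ 2 by rewrite mulr_ge0 ?sqr_ge0.
rewrite /df; apply: le_trans (ler_normB _ _) _.
have e24 : 24 * K * m ^+ 2 = 8 * K * m ^+ 2 + 16 * K * m ^+ 2 by ring.
rewrite e24; apply: lerD.
  apply: (div_le _ _ _); first by case: (b); lra.
  by apply: le_trans hA _; rewrite le_eqVlt; apply/orP; left; apply/eqP; ring.
case: (b) hN => hN; first by rewrite normr0; lra.
rewrite expr2 invfM mulrA; apply: (div_le _ _ _); first by lra.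
apply: (div_le _ _ _); first by lra.
by apply: le_trans hN _; rewrite le_eqVlt; apply/orP; left; apply/eqP; ring.
Qed.

End Frequencies.

Section ResonantSet.
Variables (R : realType) (rho K : R) (N : bool -> R -> R -> R)
  (A : bool -> bool -> R -> R -> R).
Hypothesis K0 : 0 <= K.
Hypothesis dN : forall b (x y : R), 0 < x < rho -> 0 < y < rho ->
  is_derive x (1 : R) (N b ^~ y) (A b false x y) /\
  is_derive y (1 : R) (N b x) (A b true x y).
Hypothesis small : forall b d (x y t : R), 0 < x < rho -> 0 < y < rho ->
  x <= t -> y <= t -> t < rho ->
  `|N b x y| <= K * t ^+ 4 /\ `|A b d x y| <= K * t ^+ 3.

Local Notation shift := (freq_shift N).

(** The estimate in the first variable, applied after exchanging u and v. *)
Lemma shift_Lipschitz_y b (m x y y' : R) : 0 < m -> 2 * m < rho ->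
  m <= x <= 2 * m -> m <= y <= 2 * m -> m <= y' <= 2 * m ->
  `|shift b x y - shift b x y'| <= 24 * K * m ^+ 2 * `|y - y'|.
Proof.
move=> m0 mrho hx hy hy'.
have := @shift_Lipschitz_x R rho K (fun b x y => N (~~ b) y x)
  (fun b d x y => A (~~ b) (~~ d) y x) K0 _ _ (~~ b) m y y' x m0 mrho hy hy' hx.
rewrite /freq_shift negbK; case: (b) => /=; apply.
- by move=> {}b u v hu hv; have [h1 h2] := dN (~~ b) hv hu; split.
- by move=> {}b d u v t hu hv ut vt; exact: (small (~~ b) (~~ d) hv hu vt ut).
- by move=> {}b u v hu hv; have [h1 h2] := dN (~~ b) hv hu; split.
- by move=> {}b d u v t hu hv ut vt; exact: (small (~~ b) (~~ d) hv hu vt ut).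
Qed.

Lemma sqrt_scale_bounds (nu u : R) : 0 < nu -> 1 <= u <= 2 ->
  Num.sqrt nu <= Num.sqrt (nu * u) <= 2 * Num.sqrt nu.
Proof.
move=> nu0 /andP[u1 u2]; have s0 := sqrtr_ge0 nu.
rewrite sqrtrM ?(ltW nu0)//.
have : 1 <= Num.sqrt u by rewrite -sqrtr1 ler_sqrt// (le_trans _ u1).
have : Num.sqrt u <= 2.
  rewrite -(@ler_pXn2r _ 2) ?nnegrE// sqr_sqrtr; last by rewrite (le_trans _ u1).
  by rewrite expr2; lra.
by move=> h1 h2; apply/andP; split; nra.
Qed.

Lemma sqrt_scale_Lipschitz (nu u v : R) : 0 < nu -> 1 <= u <= 2 -> 1 <= v <= 2 ->
  `|Num.sqrt (nu * u) - Num.sqrt (nu * v)| <= Num.sqrt nu * `|u - v|.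
Proof.
move=> nu0 /andP[u1 u2] /andP[v1 v2].
rewrite !sqrtrM ?(ltW nu0)// -mulrBr normrM (ger0_norm (sqrtr_ge0 _)) ler_wpM2l ?sqrtr_ge0//.
have su : 1 <= Num.sqrt u by rewrite -sqrtr1 ler_sqrt// (le_trans _ u1).
have sv : 1 <= Num.sqrt v by rewrite -sqrtr1 ler_sqrt// (le_trans _ v1).
have -> : u - v = (Num.sqrt u - Num.sqrt v) * (Num.sqrt u + Num.sqrt v).
  by rewrite -subr_sqr !sqr_sqrtr// (le_trans _ u1, le_trans _ v1).
rewrite normrM ler_peMr// (ger0_norm (x := Num.sqrt u + Num.sqrt v)); lra.
Qed.

Definition frequency (p : int) (nu : R) (b : bool) (z : R * R) : R :=
  p%:~R ^+ 2 + nu * (if b then z.1 else z.2)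
  + shift b (Num.sqrt (nu * z.1)) (Num.sqrt (nu * z.2)).

Section SmallAmplitude.
Variables (p : int) (nu : R).
Hypotheses (nu0 : 0 < nu) (nu_rho : 2 * Num.sqrt nu < rho)
  (nu_K : 192 * K * Num.sqrt nu <= 1).

(** As functions of the parameters in [1, 2]^2 the shifts vary by at most nu /
    8, whereas the frequencies of the cubic system vary by nu. *)
Lemma shift_Lipschitz b (z z' : R * R) :
  1 <= z.1 <= 2 -> 1 <= z.2 <= 2 -> 1 <= z'.1 <= 2 -> 1 <= z'.2 <= 2 ->
  `|shift b (Num.sqrt (nu * z.1)) (Num.sqrt (nu * z.2))
    - shift b (Num.sqrt (nu * z'.1)) (Num.sqrt (nu * z'.2))|
  <= nu / 8 * (`|z.1 - z'.1| + `|z.2 - z'.2|).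
Proof.
move=> h1 h2 h1' h2'; have nr := nu_rho; have nK := nu_K.
set m := Num.sqrt nu in nr nK.
have m0 : 0 < m by rewrite sqrtr_gt0.
have b1 := sqrt_scale_bounds nu0 h1; have b2 := sqrt_scale_bounds nu0 h2.
have b1' := sqrt_scale_bounds nu0 h1'; have b2' := sqrt_scale_bounds nu0 h2'.
have l1 := shift_Lipschitz_x K0 dN small b m0 nr b1 b1' b2.
have l2 := shift_Lipschitz_y b m0 nr b1' b2 b2'.
have s1 := sqrt_scale_Lipschitz nu0 h1 h1'; have s2 := sqrt_scale_Lipschitz nu0 h2 h2'.
rewrite -(subrK (shift b (Num.sqrt (nu * z'.1)) (Num.sqrt (nu * z.2))) (shift b _ (Num.sqrt (nu * z.2)))).
rewrite -addrA; apply: le_trans (ler_normD _ _) _; rewrite mulrDr.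
have c0 : 0 <= 24 * K * m ^+ 2 by rewrite mulr_ge0 ?sqr_ge0// mulr_ge0.
have cm : 24 * K * m ^+ 2 * m <= nu / 8.
  have -> : nu = m ^+ 2 by rewrite sqr_sqrtr// ltW.
  have -> : 24 * K * m ^+ 2 * m = m ^+ 2 / 8 * (192 * K * m) by field.
  by rewrite ler_piMr// divr_ge0// sqr_ge0.
apply: lerD.
  apply: le_trans l1 _; apply: le_trans (ler_wpM2l c0 s1) _.
  by rewrite mulrA ler_wpM2r.
apply: le_trans l2 _; apply: le_trans (ler_wpM2l c0 s2) _.
by rewrite mulrA ler_wpM2r.
Qed.

Local Notation T := (measurableTypeR R * measurableTypeR R)%type.
Local Notation mu := ((@lebesgue_measure R) \x (@lebesgue_measure R))%E.

Definition resonant_set (k1 k2 : int) : set T :=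
  [set z | square12 R z /\
     frequency p nu false z * k1%:~R + frequency p nu true z * k2%:~R = 0].

Lemma square12P (z : T) : square12 R z -> 1 <= z.1 <= 2 /\ 1 <= z.2 <= 2.
Proof. by move=> [] /=; rewrite !in_itv. Qed.

(** The twist of the integrable frequency map (rho_1, rho_2) -> (rho_2, rho_1)
    dominates the contribution of g, so a resonance relation determines one of
    the two parameters as a Lipschitz function of the other. *)
Lemma resonant_negligible (k1 k2 : int) : (k1, k2) != (0, 0) ->
  mu.-negligible (resonant_set k1 k2).
Proof.
move=> k0.
have diff (z z' : T) : resonant_set k1 k2 z -> resonant_set k1 k2 z' ->
    exists2 e : R * R, `|e.1| <= 4^-1 * (`|z.1 - z'.1| + `|z.2 - z'.2|) /\
      `|e.2| <= 4^-1 * (`|z.1 - z'.1| + `|z.2 - z'.2|) &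
      (z.2 - z'.2 + e.1 / 2) * k1%:~R + (z.1 - z'.1 + e.2 / 2) * k2%:~R = 0.
  move=> [/square12P[h1 h2] e1] [/square12P[h1' h2'] e2].
  pose e b := 2 / nu * (shift b (Num.sqrt (nu * z.1)) (Num.sqrt (nu * z.2))
    - shift b (Num.sqrt (nu * z'.1)) (Num.sqrt (nu * z'.2))).
  have eb b : `|e b| <= 4^-1 * (`|z.1 - z'.1| + `|z.2 - z'.2|).
    rewrite /e normrM ger0_norm ?divr_ge0 ?(ltW nu0)//.
    rewrite mulrAC ler_pdivrMr//.
    by have := shift_Lipschitz b h1 h2 h1' h2'; lra.
  exists (e false, e true); first by split; exact: eb.
  apply: (mulfI (lt0r_neq0 nu0)); rewrite mulr0.
  have := congr2 (fun a b => a - b) e1 e2; rewrite subr0 => <-.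
  by rewrite /frequency /e /=; field; rewrite gt_eqF.
have big (a b e1 e2 B : R) : `|e1| <= 4^-1 * (`|a| + `|b|) -> `|e2| <= 4^-1 * (`|a| + `|b|) ->
    forall l1 l2 : int, `|l1| <= `|l2| -> l2 != 0 ->
    (b + e1 / 2) * l1%:~R + (a + e2 / 2) * l2%:~R = 0 -> `|a| <= 2 * `|b|.
  move=> he1 he2 l1 l2 l12 l20 /eqP; rewrite addr_eq0 => /eqP h.
  have L0 : 0 < `|l2%:~R| :> R by rewrite normr_gt0 intr_eq0.
  have L12 : `|l1%:~R| <= `|l2%:~R| :> R by rewrite -!intr_norm ler_int.
  have h' : `|a + e2 / 2| * `|l2%:~R| = `|b + e1 / 2| * `|l1%:~R|.
    by rewrite -!normrM h normrN.
  have {}h' : `|a + e2 / 2| <= `|b + e1 / 2|.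
    by rewrite -(ler_pM2r L0) h' ler_wpM2l.
  have := normr_ge0 b; have := ler_normD b (e1 / 2); have := ler_normB (a + e2 / 2) (e2 / 2).
  rewrite addrK !normrM (ger0_norm (x := 2^-1))//.
  lra.
have [k12|k12] := leP `|k1| `|k2|.
  have k20 : k2 != 0.
    apply: contra k0 => /eqP k20; move: k12; rewrite k20 normr0 normr_le0 => /eqP ->.
    by rewrite xpair_eqE !eqxx.
  apply: (@Lipschitz_graph_negligible R false) => [z [/square12P[]]//|z z' hz hz'].
  have [e [h1 h2] h] := diff z z' hz hz'.
  exact: (big _ _ _ _ 0 h1 h2 _ _ k12 k20 h).
have k10 : k1 != 0 by apply: contraTneq k12 => ->; rewrite normr0 -leNgt normr_ge0.
apply: (@Lipschitz_graph_negligible R true) => [z [/square12P[]]//|z z' hz hz'].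
have [e [h1 h2]] := diff z z' hz hz'; rewrite addrC => h.
rewrite (addrC `|z.1 - z'.1|) in h1 h2.
exact: (big _ _ _ _ 0 h2 h1 _ _ (ltW k12) k10 h).
Qed.

(** The resonant parameters are a countable union of negligible sets. *)
Lemma nonresonant_full_measure : exists S : set T,
  [/\ measurable S, S `<=` square12 R, area (square12 R `\` S) = 0%E &
      forall z : T, S z -> nonresonant (frequency p nu false z, frequency p nu true z)].
Proof.
pose E n : set T := if (choice.unpickle n : option (int * int)) is Some k then
   if k != (0, 0) then resonant_set k.1 k.2 else set0 else set0.
have En n : mu.-negligible (E n).
  rewrite /E; case: (choice.unpickle n) => [[k1 k2]|]; last exact: negligible_set0.
  by case: ifP => [/resonant_negligible//|_]; exact: negligible_set0.
have [B [mB B0 EB]] := negligible_bigcup En.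
have mS : measurable (square12 R) by apply: measurableX; exact: measurable_itv.
exists (square12 R `\` B); split.
- exact: measurableD.
- by move=> z [].
- apply: subset_measure0 B0 => //; first by apply: measurableD => //; exact: measurableD.
  by move=> z [sz]; apply: contra_notP => nB; split.
- move=> z [sz nB] k1 k2 k0 /=; apply/eqP => h; apply: nB; apply: EB.
  exists (choice.pickle (k1, k2)); first exact: I.
  by rewrite /E choice.pickleK k0.
Qed.

End SmallAmplitude.
End ResonantSet.

(** * Winding numbers and rotations of the phases *)

Section ModesAndRotations.
Variables (R : realType) (s : R).
Hypothesis s_gt : 1 / 2 < s.
Local Notation C := R[i].
Implicit Types (a : modes R) (w : phase R) (theta omega : R * R).

Lemma modes_scaleE (e : R) a k : ((e *: a) k : C) = e%:C * (a k : C).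
Proof.
rewrite -[LHS]/(e *: (a k : Rcomplex R)); case: (a k) => x y.
by apply/eqP; rewrite eq_complex /=; apply/andP; split; apply/eqP; ring.
Qed.

Lemma modes_sumE (I : Type) (r : seq I) (f : I -> modes R) k :
  ((\sum_(i <- r) f i) k : C) = \sum_(i <- r) (f i k : C).
Proof. by elim/big_rec2: _ => // i x y _ <-. Qed.

(** The phase of a wave that turns [m.1] and [m.2] times along the two circles
    of the torus. *)
Definition wind (m : int * int) theta : R := theta.1 * m.1%:~R + theta.2 * m.2%:~R.

Lemma wind_line m theta omega t :
  wind m (line theta omega t) = wind m theta + t * wind m omega.
Proof. by rewrite /wind /line /=; ring. Qed.

Lemma expi_wind_periodic m theta (k1 k2 : int) :
  expi (wind m (theta.1 + 2 * pi * k1%:~R, theta.2 + 2 * pi * k2%:~R)) =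
  expi (wind m theta).
Proof.
rewrite -[RHS](expi_2pi _ (k1 * m.1 + k2 * m.2)); congr expi.
by rewrite /wind /= intrD !intrM; ring.
Qed.

(** The expansion at a point is the product of two exponential series, one in
    each angle, applied to a fixed sequence; its norm is controlled by the
    scalar sum. *)
Lemma torus_analytic_wind m a : ell2 s a ->
  torus_analytic s (fun theta k => expi (wind m theta) * (a k : C)).
Proof.
move=> ha.
have ell2Z (z : C) : ell2 s (fun k => z * (a k : C)).
  by apply: ell2_mult ha => // k; rewrite modulusM.
split.
- by move=> theta k1 k2; apply/funext => k; rewrite expi_wind_periodic.
- by move=> theta; exact: ell2Z.
move=> theta0; exists 1, (fun (l : nat * nat) k => expi (wind m theta0) *
  (expi_coeff m.1%:~R l.1 * expi_coeff m.2%:~R l.2) * (a k : C)).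
split=> // theta _ _ e e0.
pose d1 := theta.1 - theta0.1; pose d2 := theta.2 - theta0.2.
pose coef (l : nat * nat) : C := expi (wind m theta0) *
  (expi_coeff (m.1%:~R * d1) l.1 * expi_coeff (m.2%:~R * d2) l.2).
have hc : has_sum (@cnorm R) coef (expi (wind m theta)).
  have := has_sumZ (expi (wind m theta0))
    (has_sum_prod (has_sum_expi (m.1%:~R * d1)) (has_sum_expi (m.2%:~R * d2))).
  rewrite -!expiD (_ : wind m theta0 + _ = wind m theta)//.
  by rewrite /wind /d1 /d2; ring.
have afin : hs_sq s a \is a fin_num by rewrite ge0_fin_numE ?hs_sq_ge0.
pose H := fine (hs_sq s a); have H0 : 0 <= H by rewrite fine_ge0// hs_sq_ge0.
pose d := Num.min 1 (e / (2 * (H + 1))).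
have d0 : 0 < d by rewrite lt_min ltr01 divr_gt0// mulr_gt0// ltr_wpDl.
have d1' : d <= 1 by rewrite ge_min lexx.
have [A hA] := (has_sumP _ _).1 hc d d0.
exists A => B /hA hB.
set z := \sum_(i <- B) coef i - _ in hB.
rewrite (_ : _ - _ = (fun k => z * (a k : C)))%R; last first.
  apply/funext => k; rewrite -[LHS]/(((\sum_(i <- B) _) k : C) - expi (wind m theta) * (a k : C)).
  rewrite modes_sumE /z mulrBl mulr_suml; congr (_ - _); apply: eq_bigr => l _.
  rewrite modes_scaleE /coef !expi_coeffM rmorphM; move: (a k) => A0.
  rewrite -[Rcomplex R]/C in A0 *.
  by rewrite -/d1 -/d2; ring.
apply: le_lt_trans (hs_sq_mult s (a := a) (modulus_ge0 z) _) _.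
  by move=> k; rewrite modulusM; exact: lexx.
rewrite -(fineK afin) -EFinM lte_fin -/H.
apply: (@le_lt_trans _ _ (d * H)).
  rewrite ler_wpM2r// expr2; have := modulus_ge0 z; nra.
have : d * (H + 1) <= e / 2.
  have H1 : 0 < H + 1 by rewrite ltr_wpDl.
  rewrite -ler_pdivlMr//; apply: (@le_trans _ _ (e / (2 * (H + 1)))).
    by rewrite ge_min lexx orbT.
  by rewrite invfM mulrA.
nra.
Qed.

End ModesAndRotations.

Section PhaseContinuity.
Variables (R : realType) (s : R).
Hypothesis s_gt : 1 / 2 < s.
Local Notation C := R[i].
Implicit Types (w : phase R) (X Y : R -> phase R).

Lemma phase_sq_ge0 w : (0 <= phase_sq s w)%E.
Proof. by rewrite adde_ge0 ?hs_sq_ge0. Qed.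

Lemma ereal_cvg0P (f : R -> \bar R) (t : R) : (forall x, 0 <= f x)%E ->
  (f @ t --> 0%E) <-> forall e : R, 0 < e -> exists2 d, 0 < d &
    forall h : R, `|h| < d -> (f (t + h)%R < e%:E)%E.
Proof.
move=> f0; split=> [fc e e0|H].
  have : nbhs 0%E [set x : \bar R | (x < e%:E)%E].
    by apply: open_nbhs_nbhs; split; [exact: open_ereal_lt_ereal | rewrite /= lte_fin].
  move=> /fc /nbhs_normP [d /= d0 hd]; exists d => // h hlt.
  by apply: hd => /=; rewrite opprD addNKr normrN.
move=> B /= [e /= e0 hB]; apply/nbhs_normP.
have [d d0 hd] := H e e0; exists d => // x /=; rewrite distrC => xd.
have := hd _ xd; rewrite [t + _]addrC subrK => fx.
have fin : f x \is a fin_num by rewrite ge0_fin_numE// (lt_trans fx) ?ltry.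
rewrite -(fineK fin); apply: hB => /=; rewrite sub0r normrN ger0_norm.
  by rewrite -lte_fin fineK.
by rewrite fine_ge0.
Qed.

Lemma phase_continuousP X : phase_continuous s X <->
  (forall t, phase_space s (X t)) /\ forall t (e : R), 0 < e ->
    exists2 d, 0 < d & forall h : R, `|h| < d ->
      (phase_sq s (X (t + h) - X t)%R < e%:E)%E.
Proof.
have f0 t x : (0 <= (fun y => phase_sq s (X y - X t)%R) x)%E by exact: phase_sq_ge0.
split=> -[hX hc]; split=> // t; first exact: (ereal_cvg0P t (f0 t)).1 (hc t).
exact: (ereal_cvg0P t (f0 t)).2 (hc t).
Qed.

Definition rotate (al : bool -> R) w : phase R :=
  fun c k => expi (al c) * (w c k : C).

Lemma hs_sq_rotate al w c : hs_sq s (rotate al w c) = hs_sq s (w c).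
Proof. by apply: eq_hs_sq => k; rewrite modulusM modulus_expi mul1r. Qed.

Lemma phase_sq_rotate al w : phase_sq s (rotate al w) = phase_sq s w.
Proof. by rewrite /phase_sq !hs_sq_rotate. Qed.

Lemma phase_space_rotate al w : phase_space s w -> phase_space s (rotate al w).
Proof. by move=> hw c; rewrite /ell2 /= hs_sq_rotate; exact: hw. Qed.

Lemma rotateK al w : rotate (fun c => - al c) (rotate al w) = w.
Proof.
apply/funext => c; apply/funext => k.
by rewrite /rotate mulrA expiNM mul1r.
Qed.

Lemma phase_sqD_le w w' :
  (phase_sq s (w + w')%R <= 2%:E * (phase_sq s w + phase_sq s w'))%E.
Proof.
rewrite /phase_sq addeACA ge0_muleDr ?adde_ge0 ?hs_sq_ge0//.
by apply: leeD; exact: hs_sqD_le.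
Qed.

Lemma phase_sq_fin w : phase_space s w -> phase_sq s w \is a fin_num.
Proof.
move=> hw; rewrite ge0_fin_numE ?phase_sq_ge0// lte_add_pinfty//; exact: hw.
Qed.

(** A rotation with phases affine in t is an isometry that depends
    continuously on t, so conjugating by it preserves continuity in norm. *)
Lemma phase_continuous_rotate (a b : bool -> R) X : phase_continuous s X ->
  phase_continuous s (fun t => rotate (fun c => a c + t * b c) (X t)).
Proof.
move=> /phase_continuousP[hX hc]; apply/phase_continuousP; split.
  by move=> t; exact: phase_space_rotate.
move=> t e e0.
pose H := fine (phase_sq s (X t)).
have HE : phase_sq s (X t) = H%:E by rewrite fineK// phase_sq_fin.
have H0 : 0 <= H by rewrite fine_ge0// phase_sq_ge0.
have [d1 d10 hd1] := hc t (e / 8) ltac:(lra).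
pose q := e / (8 * (H + 1)).
have q0 : 0 < q by rewrite divr_gt0// mulr_gt0// ltr_wpDl.
have cont c : exists2 d, 0 < d & forall h : R, `|h| < d ->
    modulus (expi (a c + (t + h) * b c) - expi (a c + t * b c)) ^+ 2 <= q.
  have /is_cderiveP /(_ 1 ltr01) [d d0 hd] := is_cderive_expi (b c) (a c) t.
  set l := ('i%C * (b c)%:C * expi (a c + t * b c) : C) in hd.
  pose L := modulus l + 1; have L1 : 1 <= L by rewrite lerDr modulus_ge0.
  exists (Num.min d (Num.min 1 q / L ^+ 2)).
    by rewrite lt_min d0 divr_gt0 ?lt_min ?ltr01// exprn_gt0//; lra.
  move=> h; rewrite lt_min => /andP[/hd h1]; rewrite ltr_pdivlMr; last by rewrite exprn_gt0//; lra.
  rewrite lt_min => /andP[h2 h3].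
  set z := (expi (a c + (t + h) * b c) - expi (a c + t * b c) : C) in h1 *.
  have zL : modulus z <= L * `|h|.
    have := modulus_triangle (z - h%:C * l) (h%:C * l); rewrite subrK modulusM modulus_real /L; lra.
  have hp := normr_ge0 h; have zp := modulus_ge0 z.
  apply: (@le_trans _ _ (L ^+ 2 * `|h| ^+ 2)).
    by rewrite -exprMn lerXn2r ?nnegrE// (le_trans zp).
  have hL : `|h| <= 1 by apply: le_trans (ltW h2); rewrite ler_peMr// expr2; nra.
  apply: le_trans (ltW h3); rewrite mulrC ler_wpM2r ?exprn_ge0//; first lra.
  by rewrite expr2 ler_piMr.
have [df df0 hf] := cont false; have [dt dt0 ht] := cont true.
exists (Num.min d1 (Num.min df dt)); first by rewrite !lt_min d10 df0.
move=> h; rewrite !lt_min => /and3P[/hd1 h1 /hf h2 /ht h3].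
set al := fun c => a c + (t + h) * b c.
set be := fun c => a c + t * b c.
pose D : phase R := fun c k => (expi (al c) - expi (be c)) * (X t c k : C).
have -> : (rotate al (X (t + h)) - rotate be (X t))%R = (rotate al (X (t + h) - X t) + D)%R.
  apply/funext => c; apply/funext => k.
  rewrite -[LHS]/(expi (al c) * (X (t + h) c k : C) - expi (be c) * (X t c k : C)).
  rewrite -[RHS]/(expi (al c) * ((X (t + h) c k : C) - (X t c k : C)) + D c k) /D.
  by move: (X (t + h) c k) (X t c k) => u v; rewrite -[Rcomplex R]/C in u v *; ring.
apply: le_lt_trans (phase_sqD_le _ _) _; rewrite phase_sq_rotate.
have Dle : (phase_sq s D <= (q * H)%:E)%E.
  rewrite EFinM -HE /phase_sq ge0_muleDr ?hs_sq_ge0//.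
  have hD c : modulus (expi (al c) - expi (be c)) ^+ 2 <= q by case: c.
  by apply: leeD; (apply: le_trans (hs_sq_mult s (a := X t _) (modulus_ge0 _) _) _;
    [by move=> k; rewrite modulusM; exact: lexx |
     by rewrite lee_wpmul2r ?hs_sq_ge0// lee_fin hD]).
have Dfin : phase_sq s D \is a fin_num.
  by rewrite ge0_fin_numE ?phase_sq_ge0// (le_lt_trans Dle) ?ltry.
have dfin : phase_sq s (X (t + h) - X t)%R \is a fin_num.
  by rewrite ge0_fin_numE ?phase_sq_ge0// (lt_trans h1) ?ltry.
move: h1 Dle; rewrite -(fineK Dfin) -(fineK dfin) lte_fin lee_fin => h1 Dle.
rewrite -EFinD -EFinM lte_fin.
have : q * (H + 1) <= e / 8.
  by rewrite /q invfM mulrA mulfVK// gt_eqF// ltr_wpDl.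
nra.
Qed.

End PhaseContinuity.

(** * Fourier series of transformed sequences *)

Section FourierOperations.
Variables (R : realType) (s : R).
Hypothesis s_gt : 1 / 2 < s.
Local Notation C := R[i].
Implicit Types (a b : modes R) (x : R).

Lemma fourierD a b x : ell2 s a -> ell2 s b ->
  fourier (fun k => (a k : C) + (b k : C)) x = fourier a x + fourier b x.
Proof.
move=> ha hb; apply: total_sumE.
have := has_sumD (has_sum_fourier s_gt x ha) (has_sum_fourier s_gt x hb).
by apply: eq_has_sum => k; rewrite mulrDl.
Qed.

Lemma fourierZ (z : C) a x : ell2 s a ->
  fourier (fun k => z * (a k : C)) x = z * fourier a x.
Proof.
move=> ha; apply: total_sumE; have := has_sumZ z (has_sum_fourier s_gt x ha).
by apply: eq_has_sum => k; rewrite mulrA.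
Qed.

Lemma fourier_conj_reflect (p : int) a x : ell2 s a ->
  fourier (fun k => conjc (a (2 * p - k) : C)) x =
  expi (2 * p%:~R * x) * conjc (fourier a x).
Proof.
move=> ha; apply: total_sumE.
have inv : cancel (fun k : int => 2 * p - k) (fun k => 2 * p - k).
  by move=> k; rewrite opprB addrC subrK.
have := has_sumZ (expi (2 * p%:~R * x))
  (has_sum_reindex inv inv (has_sum_conj (has_sum_fourier s_gt x ha))).
apply: eq_has_sum => k; rewrite conjcM conj_expi mulrCA -expiD; congr (_ * expi _).
by rewrite intrB intrM; ring.
Qed.

Lemma fourier_single (p : int) a x : (forall k, k != p -> a k = 0) ->
  fourier a x = (a p : C) * expi (p%:~R * x).
Proof.
move=> h; apply: total_sumE; apply: has_sum_single => k /h ->.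
by rewrite -[(0 : Rcomplex R)]/(0 : C) mul0r.
Qed.

End FourierOperations.

(** * The linearized system in the rotating frame *)

Section RotatingFrame.
Variables (R : realType) (s : R) (p : int) (g : ('I_4 -> complex R) -> complex R).
Hypothesis s_gt : 1 / 2 < s.
Local Notation C := R[i].
Variables (amp P : bool -> R) (S : bool -> bool -> R) (m : bool -> int * int)
  (omega : R * R).
Hypothesis dnonlinearityE : forall c a b (w z : C),
  dnonlinearity g c (expi a * (amp false)%:C) (expi b * (amp true)%:C)
    (expi a * w) (expi b * z) =
  expi (if c then b else a) * ((P c)%:C * (if c then z else w)
    + (2 * S c false * complex.Re w + 2 * S c true * complex.Re z)%:C).
Hypothesis omegaE : forall c, wind (m c) omega = - (p%:~R ^+ 2 + P c).
Implicit Types (w : phase R) (theta : R * R).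

Definition plane_wave theta : phase R :=
  fun c k => if k == p then expi (wind (m c) theta) * (amp c)%:C else 0.

(** Twice the real part of e^(-ipx) w, seen on Fourier coefficients shifted by
    p: conjugation exchanges k and 2p - k. *)
Definition mirror w : phase R :=
  fun d k => (w d k : C) + conjc (w d (2 * p - k) : C).

Definition coupling w : phase R :=
  fun c k => (S c false)%:C * (mirror w false k : C) + (S c true)%:C * (mirror w true k : C).

(** The generator of the linearized flow after division by the phases of the
    wave; it has constant coefficients. *)
Definition linF w : phase R :=
  fun c k => ((k%:~R : R) ^+ 2 - p%:~R ^+ 2)%:C * (w c k : C) + (coupling w c k : C).

Lemma ell2Z (z : C) (a : modes R) : ell2 s a -> ell2 s (fun k => z * (a k : C)).
Proof. by apply: ell2_mult => k; rewrite modulusM. Qed.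

Lemma ell2_conj_reflect (a : modes R) : ell2 s a ->
  ell2 s (fun k => conjc (a (2 * p - k) : C)).
Proof.
move=> /(ell2_reflect s_gt p); apply: (@ell2_mult _ _ _ _ 1) => k.
by rewrite modulus_conj mul1r.
Qed.

Lemma phase_space_mirror w : phase_space s w -> phase_space s (mirror w).
Proof. by move=> hw c; apply: ell2D => //; exact: ell2_conj_reflect. Qed.

Lemma phase_space_coupling w : phase_space s w -> phase_space s (coupling w).
Proof.
by move=> /phase_space_mirror hw c; apply: ell2D => //; apply: ell2Z; exact: hw.
Qed.

Lemma fourier_plane_wave theta c x : fourier (plane_wave theta c) x =
  expi (wind (m c) theta + p%:~R * x) * (amp c)%:C.
Proof.
rewrite (@fourier_single _ p); last by move=> k /negbTE kp; rewrite /plane_wave kp.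
by rewrite /plane_wave eqxx expiD mulrAC.
Qed.

(** Fourier coefficients of the linearized nonlinearity along the plane wave. *)
Definition lin_coef (al : bool -> R) w : phase R :=
  fun c k => expi (al c) * ((P c)%:C * (w c k : C) + (coupling w c k : C)).

Lemma fourier_lin_coef theta w c x : phase_space s w ->
  let al := fun c => wind (m c) theta in
  fourier (lin_coef al w c) x = dnonlinearity g c
    (fourier (plane_wave theta false) x) (fourier (plane_wave theta true) x)
    (fourier (rotate al w false) x) (fourier (rotate al w true) x).
Proof.
move=> hw al; rewrite !fourier_plane_wave.
have hm := phase_space_mirror hw; have hc := phase_space_coupling hw.
pose v d := fourier (w d) x.
have rotE d : fourier (rotate al w d) x = expi (al d + p%:~R * x) * (expi (- (p%:~R * x)) * v d).
  rewrite /rotate (@fourierZ _ _ s_gt)//.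
  by rewrite expiD -mulrA [expi (p%:~R * x) * _]mulrA expiMN mul1r.
rewrite !rotE dnonlinearityE /lin_coef.
have mirE d : fourier (mirror w d) x = expi (p%:~R * x) * (2 * complex.Re (expi (- (p%:~R * x)) * v d))%:C.
  rewrite /mirror (@fourierD _ _ s_gt) ?(@fourier_conj_reflect _ _ s_gt) -/(v d); last 3 first.
  - exact: hw.
  - exact: hw.
  - exact: ell2_conj_reflect.
  have reE (z : C) : (2 * complex.Re z)%:C = z + conjc z.
    by case: z => z1 z2; apply/eqP; rewrite eq_complex /=; apply/andP; split; apply/eqP; ring.
  rewrite reE conjcM conj_expi opprK mulrDr !mulrA expiMN mul1r -expiD.
  by congr (_ + expi _ * _); ring.
rewrite (@fourierZ _ _ s_gt); last first.
  by apply: ell2D; [apply: ell2Z; exact: hw | exact: hc].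
rewrite (@fourierD _ _ s_gt); [|by apply: ell2Z; exact: hw|exact: hc].
rewrite (@fourierZ _ _ s_gt); last exact: hw.
rewrite /coupling (@fourierD _ _ s_gt); [|by apply: ell2Z; exact: hm|by apply: ell2Z; exact: hm].
rewrite (@fourierZ _ _ s_gt); last exact: hm.
rewrite (@fourierZ _ _ s_gt); last exact: hm.
rewrite !mirE -/(v c).
have -> : expi (if c then wind (m true) theta + p%:~R * x else wind (m false) theta + p%:~R * x)
   = expi (al c) * expi (p%:~R * x) by rewrite -expiD /al; case: c.
have -> : (if c then expi (- (p%:~R * x)) * v true else expi (- (p%:~R * x)) * v false) =
  expi (- (p%:~R * x)) * v c by case: c.
have eR (a b r r' : R) : (2 * a * r + 2 * b * r')%:C = a%:C * (2 * r)%:C + b%:C * (2 * r')%:C :> C.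
  by apply/eqP; rewrite eq_complex /=; apply/andP; split; apply/eqP; ring.
rewrite eR -mulrA; congr (_ * _); rewrite mulrDr; congr (_ + _).
  by rewrite mulrCA [expi (p%:~R * x) * _]mulrA expiMN mul1r.
by ring.
Qed.

(** Dividing each component by the phase of the wave removes the dependence on
    time. The right-hand side of the linearized system is determined by its
    Fourier series, which identifies its coefficients with those of [linF]. *)
Lemma linearized_rotating theta0 (Y : R -> phase R) :
  let al t := fun c => wind (m c) (line theta0 omega t) in
  linearized_solution s g plane_wave omega theta0 (fun t => rotate (al t) (Y t)) <->
  phase_continuous s Y /\
  forall t c k, is_cderive (fun y => Y y c k : C) t (- 'i%C * (linF (Y t) c k : C)).
Proof.
move=> al.
have alE t : al t = (fun c => wind (m c) theta0 + t * wind (m c) omega).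
  by apply/funext => c; rewrite /al wind_line.
have contE : phase_continuous s (fun t => rotate (al t) (Y t)) <-> phase_continuous s Y.
  split=> h.
    have := phase_continuous_rotate (fun c => - wind (m c) theta0) (fun c => - wind (m c) omega) h.
    congr (phase_continuous s); apply/funext => t; rewrite -[RHS](rotateK (al t)).
    by congr rotate; apply/funext => c; rewrite alE; ring.
  have := phase_continuous_rotate (fun c => wind (m c) theta0) (fun c => wind (m c) omega) h.
  by congr (phase_continuous s); apply/funext => t; rewrite alE.
have dexpi (sg : R) t c : is_cderive (fun y => expi (sg * al y c)) t
    ('i%C * (sg * wind (m c) omega)%:C * expi (sg * al t c)).
  have := is_cderive_expi (sg * wind (m c) omega) (sg * wind (m c) theta0) t.
  have -> : sg * wind (m c) theta0 + t * (sg * wind (m c) omega) = sg * al t c by rewrite alE; ring.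
  by apply: is_cderive_ext => y; congr expi; rewrite alE; ring.
split.
  move=> [/contE hY hX]; split=> // t c k.
  have [hYs _] := (phase_continuousP s _).1 hY.
  have [h [hh hf hd]] := hX t.
  have hE : h c k = lin_coef (al t) (Y t) c k.
    apply: (fourier_inj s_gt (hh c)).
      apply: ell2Z; apply: ell2D; last exact: phase_space_coupling.
      by apply: ell2Z; exact: hYs.
    by move=> x; rewrite hf fourier_lin_coef//.
  have := is_cderiveM (dexpi (-1) t c) (hd c k).
  rewrite hE /lin_coef /rotate => H.
  have YE y : expi (-1 * al y c) * (expi (al y c) * (Y y c k : C)) = Y y c k.
    by rewrite mulN1r mulrA expiNM mul1r.
  have {}H := is_cderive_ext YE H.
  move: H; congr is_cderive; rewrite mulN1r /linF omegaE mulN1r opprK.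
  have := expiNM (al t c); move: (expi (- al t c)) (expi (al t c)) => u v uv.
  move: (coupling (Y t) c k) (Y t c k) => A B; rewrite -[Rcomplex R]/C in A B *.
  rewrite rmorphB rmorphD.
  transitivity ((u * v) * ('i%C * ((p%:~R ^+ 2)%:C + (P c)%:C) * B
     - 'i%C * (((k%:~R : R) ^+ 2)%:C * B + ((P c)%:C * B + A)))); first by ring.
  by rewrite uv; ring.
move=> [hY hd]; split; first exact/contE.
have [hYs _] := (phase_continuousP s _).1 hY.
move=> t; exists (lin_coef (al t) (Y t)); split.
- move=> c; apply: ell2Z; apply: ell2D; last exact: phase_space_coupling.
  by apply: ell2Z; exact: hYs.
- by move=> c x; rewrite fourier_lin_coef.
move=> c k; have := is_cderiveM (dexpi 1 t c) (hd t c k).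
have YE y : expi (1 * al y c) * (Y y c k : C) = rotate (al y) (Y y) c k.
  by rewrite mul1r.
move=> /(is_cderive_ext YE); congr is_cderive.
rewrite !mul1r /linF /lin_coef /rotate omegaE.
move: (expi (al t c)) => v.
move: (coupling (Y t) c k) (Y t c k) => A B; rewrite -[Rcomplex R]/C in A B *.
rewrite rmorphB rmorphN rmorphD.
by ring.
Qed.

End RotatingFrame.

(** * Normal form around a plane wave *)

Section PhaseBound.
Variables (R : realType) (s : R) (p : int).
Hypothesis s_gt : 1 / 2 < s.
Local Notation C := R[i].
Implicit Types (w : phase R).

Definition mirror_const : R := 1 + (2 + 8 * p%:~R ^+ 2) `^ s.

Lemma mirror_const_ge1 : 1 <= mirror_const.
Proof. by rewrite lerDl powR_ge0. Qed.

(** A map whose entry at k depends only on the entries at k and 2p - k is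
    bounded in the weighted norm, since the weights at these modes are
    comparable. *)
Lemma phase_sq_pointwise w w' (M : R) : 0 <= M ->
  (forall c k, modulus (w c k) ^+ 2 <=
     M * (modulus (w' false k) ^+ 2 + modulus (w' false (2 * p - k)) ^+ 2
          + (modulus (w' true k) ^+ 2 + modulus (w' true (2 * p - k)) ^+ 2))) ->
  (phase_sq s w <= (2 * M * mirror_const)%:E * phase_sq s w')%E.
Proof.
move=> M0 h.
have m0 : 0 <= mirror_const by apply: le_trans mirror_const_ge1.
have one c : (hs_sq s (w c) <= (M * mirror_const)%:E * phase_sq s w')%E.
  apply: ge_ereal_sup => _ [X [finX _]] <-.
  rewrite fsbig_finite//= sumEFin.
  pose T (a : modes R) := \sum_(k <- fset_set X) hs_weight s k * modulus (a k) ^+ 2.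
  have Tle a : ((T a)%:E <= hs_sq s a)%E by exact: esum_fset_ge.
  have Tle' a : ((T (fun k => a (2 * p - k)))%:E <= (mirror_const - 1)%:E * hs_sq s a)%E.
    apply: le_trans (Tle _) _; apply: le_trans (hs_sq_reflect s_gt p a) _.
    by rewrite (_ : mirror_const - 1 = (2 + 8 * p%:~R ^+ 2) `^ s)// /mirror_const addrC addKr.
  apply: (@le_trans _ _ (M%:E * (((T (w' false))%:E + (T (fun k => w' false (2 * p - k)%R))%:E)
     + ((T (w' true))%:E + (T (fun k => w' true (2 * p - k)%R))%:E)))%E).
    rewrite -!EFinD -EFinM lee_fin /T -!big_split /= mulr_sumr ler_sum// => k _.
    rewrite -!mulrDr [leRHS]mulrCA ler_wpM2l ?(ltW (hs_weight_gt0 _ _))//.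
  rewrite EFinM -muleA; apply: lee_wpmul2l; first by rewrite lee_fin.
  rewrite /phase_sq ge0_muleDr ?hs_sq_ge0//.
  have cE a : (mirror_const%:E * hs_sq s a = hs_sq s a + (mirror_const - 1)%:E * hs_sq s a)%E.
    rewrite -[X in (X + _)%E]mul1e -ge0_muleDl ?hs_sq_ge0 ?lee_fin ?subr_ge0 ?mirror_const_ge1//.
    by rewrite -EFinD addrC subrK.
  by rewrite !cE; apply: leeD; apply: leeD.
rewrite {1}/phase_sq; apply: le_trans (leeD (one false) (one true)) _.
rewrite -ge0_muleDl ?phase_sq_ge0 ?lee_fin ?mulr_ge0// -EFinD.
by rewrite -mulrA mulr2n mulrDl mul1r.
Qed.

Lemma modulus_sq_le_hs (a : modes R) k : ((modulus (a k) ^+ 2)%:E <= hs_sq s a)%E.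
Proof.
apply: le_trans (esum_fset_ge _ [fset k]%fset); rewrite big_seq_fset1 lee_fin.
by rewrite ler_peMl ?sqr_ge0// (hs_weight_ge1 s_gt).
Qed.

End PhaseBound.

Section Frame.
Variables (R : realType) (s : R) (p : int).
Hypothesis s_gt : 1 / 2 < s.
Local Notation C := R[i].
Variables (amp lam : bool -> R) (Q : bool -> bool -> R) (m : bool -> int * int).
Hypothesis amp_gt0 : forall c, 0 < amp c.
Hypothesis lam_small : forall c, `|lam c| <= 1 / 4.
Hypothesis Q_rows : forall c c', Q c false * Q c' false + Q c true * Q c' true = (c == c')%:R.
Hypothesis Q_cols : forall d d', Q false d * Q false d' + Q true d * Q true d' = (d == d')%:R.

Let mR (c : bool) : R * R := ((m c).1%:~R, (m c).2%:~R).
Let det : R := (mR false).1 * (mR true).2 - (mR false).2 * (mR true).1.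
Hypothesis det_neq0 : det != 0.
Implicit Types (w z : phase R) (y : ncoord R) (c d : bool) (k : int).

(** ** Bogoliubov transformation *)

(** With q = k - p this is (1 + 2 lam / q^2)^(1/4): the real part of a mode
    oscillates against q^2, its imaginary part against q^2 + 2 lam, and
    rescaling them by kap and 1 / kap turns the ellipses of this flow into
    circles. At k = p the inverse of 0 is 0, so that kap = 1. *)
Definition kap c k : R := Num.sqrt (Num.sqrt (1 + 2 * lam c / (k - p)%:~R ^+ 2)).
Definition bog_a c k : R := ((kap c k)^-1 + kap c k) / 2.
Definition bog_b c k : R := ((kap c k)^-1 - kap c k) / 2.

Lemma kap4 c k : kap c k ^+ 4 = 1 + 2 * lam c / (k - p)%:~R ^+ 2 /\
   1 / 2 <= kap c k ^+ 4 <= 3 / 2.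
Proof.
have b : 1 / 2 <= 1 + 2 * lam c / (k - p)%:~R ^+ 2 <= 3 / 2.
  have [->|kp] := eqVneq (k - p) 0; first by rewrite expr0n invr0 mulr0 addr0; lra.
  have q1 : 1 <= ((k - p)%:~R : R) ^+ 2.
    rewrite -real_normK ?num_real// -intr_norm exprn_ege1// ler1z.
    by rewrite -gtz0_ge1 normr_gt0.
  have l4 := lam_small c.
  have : `|2 * lam c / (k - p)%:~R ^+ 2| <= 1 / 2.
    rewrite !normrM normfV ler_pdivrMr; last by rewrite normr_gt0 gt_eqF//; lra.
    by rewrite (ger0_norm (x := 2))// (ger0_norm (x := _ ^+ 2)) ?sqr_ge0//; lra.
  by rewrite ler_norml => /andP[h1 h2]; apply/andP; split; lra.
have e : kap c k ^+ 4 = 1 + 2 * lam c / (k - p)%:~R ^+ 2.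
  rewrite /kap (_ : 4 = 2 * 2)%N// exprM sqr_sqrtr ?sqrtr_ge0// sqr_sqrtr//.
  by case/andP: b => b _; apply: le_trans b; lra.
by rewrite e.
Qed.

Lemma kap_bounds c k : 1 / 2 <= kap c k <= 2.
Proof.
have k0 : 0 <= kap c k by exact: sqrtr_ge0.
have [_ /andP[h1 h2]] := kap4 c k.
have e4 (x : R) : x ^+ 4 = x * x * (x * x) by ring.
apply/andP; split.
  rewrite leNgt; apply/negP => hk; move: h1; apply/negP; rewrite -ltNge.
  apply: (@le_lt_trans _ _ ((1 / 2) ^+ 4)); last by rewrite e4; lra.
  by rewrite lerXn2r ?nnegrE ?(ltW hk)// divr_ge0.
rewrite leNgt; apply/negP => hk; move: h2; apply/negP; rewrite -ltNge.
apply: (@lt_le_trans _ _ (2 ^+ 4)); first by rewrite e4; lra.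
by rewrite lerXn2r ?nnegrE ?(ltW hk).
Qed.

Lemma kap_gt0 c k : 0 < kap c k.
Proof. by have /andP[h _] := kap_bounds c k; apply: lt_le_trans h; lra. Qed.

Lemma kap_mirror c k : kap c (2 * p - k) = kap c k.
Proof.
rewrite /kap; congr (Num.sqrt (Num.sqrt (1 + _ / _))).
by rewrite !intrB intrM; ring.
Qed.

Lemma bog_mirror c k : bog_a c (2 * p - k) = bog_a c k /\ bog_b c (2 * p - k) = bog_b c k.
Proof. by rewrite /bog_a /bog_b kap_mirror. Qed.

Lemma bog_det c k : bog_a c k ^+ 2 - bog_b c k ^+ 2 = 1.
Proof. by rewrite /bog_a /bog_b; field; rewrite gt_eqF// kap_gt0. Qed.

Lemma bog_le c k : `|bog_a c k| <= 2 /\ `|bog_b c k| <= 2.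
Proof.
have /andP[h1 h2] := kap_bounds c k; have k0 := kap_gt0 c k.
have i2 : (kap c k)^-1 <= 2.
  by rewrite -[leRHS]invrK lef_pV2 ?posrE ?invr_gt0//; lra.
have i0 : 0 < (kap c k)^-1 by rewrite invr_gt0.
by rewrite /bog_a /bog_b !ler_norml; split; apply/andP; split; lra.
Qed.

(** The shift 2p (k - p) is the transport by the group velocity of the wave;
    the other term is sqrt(q^4 + 2 lam q^2) with q = k - p. *)
Definition freq c k : R := 2 * p%:~R * (k - p)%:~R + kap c k ^+ 2 * (k - p)%:~R ^+ 2.

(** First entries of the eigenvector equations, for the vectors (bog_a, bog_b)
    and (bog_b, bog_a), of the block of the linearized flow in the variables
    z_k and conj z_(2p - k); the second entries are the same equations at 2p -
    k. *)
Lemma bog_eigen c k : k != p ->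
  bog_a c k * freq c k =
    (k%:~R ^+ 2 - p%:~R ^+ 2) * bog_a c k + lam c * (bog_a c k + bog_b c k) /\
  - (bog_b c k * freq c (2 * p - k)) =
    (k%:~R ^+ 2 - p%:~R ^+ 2) * bog_b c k + lam c * (bog_a c k + bog_b c k).
Proof.
move=> kp; have [e _] := kap4 c k; have k0 := kap_gt0 c k.
rewrite /freq kap_mirror /bog_a /bog_b.
have -> : (2 * p - k - p)%:~R = - (k - p)%:~R :> R by rewrite !intrB intrM; ring.
have -> : (k%:~R : R) = (k - p)%:~R + p%:~R by rewrite intrB subrK.
have q0 : (k - p)%:~R != 0 :> R by rewrite intr_eq0 subr_eq0.
move: q0 e k0; move: ((k - p)%:~R : R) (kap c k) (p%:~R : R) => q x P q0 e x0.
have -> : lam c = (x ^+ 4 - 1) * q ^+ 2 / 2 by rewrite e; field.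
by split; field; rewrite gt_eqF.
Qed.

Definition bog z : phase R := fun c k =>
  (bog_a c k)%:C * (z c k : C) + (bog_b c k)%:C * conjc (z c (2 * p - k) : C).
Definition unbog z : phase R := fun c k =>
  (bog_a c k)%:C * (z c k : C) - (bog_b c k)%:C * conjc (z c (2 * p - k) : C).
(** [Q] rotates the components u and v into the eigenvectors of the coupling. *)
Definition mix z : phase R := fun c k =>
  (Q false c)%:C * (z false k : C) + (Q true c)%:C * (z true k : C).
Definition unmix w : phase R := fun d k =>
  (Q d false)%:C * (w false k : C) + (Q d true)%:C * (w true k : C).

Lemma mirrorK k : 2 * p - (2 * p - k) = k.
Proof. by rewrite opprB addrC subrK. Qed.

Lemma mirror_eq k : (2 * p - k == p) = (k == p).
Proof. by apply/eqP/eqP; lia. Qed.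

Lemma unbog_bog z c k : unbog (bog z) c k = z c k.
Proof.
rewrite /unbog /bog; have [-> ->] := bog_mirror c k; rewrite mirrorK.
have := congr1 (fun x : R => x%:C) (bog_det c k).
rewrite rmorphB !rmorphXn /=.
rewrite conjcD !conjcM !conjc_real conjcK.
move: (z c k) (z c (2 * p - k)) (bog_a c k)%:C (bog_b c k)%:C => u v a b h.
rewrite -[Rcomplex R]/C in u v *.
transitivity ((a ^+ 2 - b ^+ 2) * u); first by ring.
by rewrite h mul1r.
Qed.

Lemma bog_unbog z c k : bog (unbog z) c k = z c k.
Proof.
rewrite /unbog /bog; have [-> ->] := bog_mirror c k; rewrite mirrorK.
have := congr1 (fun x : R => x%:C) (bog_det c k).
rewrite rmorphB !rmorphXn /=.
rewrite conjcD conjcN !conjcM !conjc_real conjcK.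
move: (z c k) (z c (2 * p - k)) (bog_a c k)%:C (bog_b c k)%:C => u v a b h.
rewrite -[Rcomplex R]/C in u v *.
transitivity ((a ^+ 2 - b ^+ 2) * u); first by ring.
by rewrite h mul1r.
Qed.

Lemma Q_rowsC c c' : (Q c false)%:C * (Q c' false)%:C + (Q c true)%:C * (Q c' true)%:C = (c == c')%:R :> C.
Proof. by rewrite -!rmorphM -rmorphD Q_rows rmorph_nat. Qed.

Lemma Q_colsC d d' : (Q false d)%:C * (Q false d')%:C + (Q true d)%:C * (Q true d')%:C = (d == d')%:R :> C.
Proof. by rewrite -!rmorphM -rmorphD Q_cols rmorph_nat. Qed.

Lemma unmix_mix z d k : unmix (mix z) d k = z d k.
Proof.
transitivity ((Q d false)%:C * (Q false false)%:C * (z false k : C)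
  + (Q d true)%:C * (Q false true)%:C * (z false k : C)
  + ((Q d false)%:C * (Q true false)%:C * (z true k : C)
  + (Q d true)%:C * (Q true true)%:C * (z true k : C))).
  rewrite /unmix /mix; move: (z false k) (z true k) => u v.
  by rewrite -[Rcomplex R]/C in u v *; ring.
rewrite -!mulrDl !Q_rowsC; case: d; rewrite /= ?mul0r ?mul1r ?add0r ?addr0//.
Qed.

Lemma mix_unmix w c k : mix (unmix w) c k = w c k.
Proof.
transitivity (((Q false c)%:C * (Q false false)%:C + (Q true c)%:C * (Q true false)%:C) * (w false k : C)
  + ((Q false c)%:C * (Q false true)%:C + (Q true c)%:C * (Q true true)%:C) * (w true k : C)).
  rewrite /unmix /mix; move: (w false k) (w true k) => u v.
  by rewrite -[Rcomplex R]/C in u v *; ring.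
rewrite !Q_colsC; case: c; rewrite /= ?mul0r ?mul1r ?add0r ?addr0//.
Qed.

Lemma eq_bog z z' c k : z c k = z' c k -> z c (2 * p - k) = z' c (2 * p - k) ->
  bog z c k = bog z' c k.
Proof. by rewrite /bog => -> ->. Qed.

(** ** Action-angle coordinates of the central modes *)

(** The coordinates of the actions that are conjugate to the phases [wind (m
    c)] of the two central modes: the contragredient of the matrix of winding
    numbers. *)
Definition dual c (r : R * R) : R :=
  if c then ((mR false).1 * r.2 - (mR false).2 * r.1) / det
  else ((mR true).2 * r.1 - (mR true).1 * r.2) / det.
Definition undual (e : bool -> R) : R * R :=
  ((mR false).1 * e false + (mR true).1 * e true,
   (mR false).2 * e false + (mR true).2 * e true).
Definition solve (e : bool -> R) : R * R :=
  (((mR true).2 * e false - (mR false).2 * e true) / det,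
   ((mR false).1 * e true - (mR true).1 * e false) / det).

Lemma windE c (phi : R * R) : wind (m c) phi = (mR c).1 * phi.1 + (mR c).2 * phi.2.
Proof. by rewrite /wind /=; ring. Qed.

Lemma wind_solve e c : wind (m c) (solve e) = e c.
Proof.
rewrite windE /solve; move: det_neq0; rewrite /det /=.
by case: c => h /=; field.
Qed.

Lemma solve_wind (phi : R * R) : solve (fun c => wind (m c) phi) = phi.
Proof.
rewrite /solve !windE; move: det_neq0; rewrite /det /=; case: phi => a b /= h.
by congr pair; field.
Qed.

Lemma dual_undual e c : dual c (undual e) = e c.
Proof.
by rewrite /dual /undual; move: det_neq0; rewrite /det /=; case: c => h /=; field.
Qed.

Lemma undual_dual r : undual (dual ^~ r) = r.
Proof.
rewrite /dual /undual; move: det_neq0; rewrite /det /=; case: r => a b /= h.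
by congr pair; field.
Qed.

(** The change from the angles and actions to the two phases and their
    conjugate variables preserves the pairing. *)
Lemma wind_dual (phi r : R * R) :
  wind (m false) phi * dual false r + wind (m true) phi * dual true r =
  phi.1 * r.1 + phi.2 * r.2.
Proof.
by rewrite !windE /dual; move: det_neq0; rewrite /det /= => h; field.
Qed.

(** The tangent vector of the phase space at the central mode of component c,
    in the rotating frame: a modulus sqrt r with phase phi varies by dr / (2
    sqrt r) + i sqrt r dphi. *)
Definition central y c : C :=
  (dual c (act y) / (2 * amp c)) +i* (amp c * wind (m c) (ang y)).

(** The frame in the rotating coordinates: the angles act on the phases and the
    actions on the moduli of the two central modes. *)
Definition frame0 y : phase R := fun c k =>
  (if k == p then central y c else 0) + (mix (bog (nrm y)) c k : C).

Definition frame0_inv w : ncoord R :=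
  (solve (fun c => complex.Im (w c p) / amp c),
   undual (fun c => 2 * amp c * complex.Re (w c p)),
   fun c k => if k == p then 0 else unbog (unmix w) c k).

Lemma bog_center z c : z c p = 0 -> bog z c p = 0.
Proof.
move=> z0; rewrite /bog (_ : 2 * p - p = p); last by lia.
by rewrite z0 -[(0 : Rcomplex R)]/(0 : C) conjc0 !mulr0 addr0.
Qed.

Lemma frame0_center y c : ncoord_space s p y -> frame0 y c p = central y c.
Proof.
move=> [_ y0]; rewrite /frame0 eqxx /mix !bog_center//.
by rewrite -[(0 : Rcomplex R)]/(0 : C) !mulr0 !addr0.
Qed.

Lemma frame0_off y c k : k != p -> frame0 y c k = mix (bog (nrm y)) c k.
Proof. by move=> /negbTE kp; rewrite /frame0 kp add0r. Qed.

Lemma frame0K w c k : frame0 (frame0_inv w) c k = w c k.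
Proof.
have [->|kp] := eqVneq k p.
  rewrite /frame0 eqxx /mix !bog_center /frame0_inv /= ?eqxx//.
  rewrite -[(0 : Rcomplex R)]/(0 : C) !mulr0 !addr0 /central /ang /act /= wind_solve dual_undual.
  have a0 : amp c != 0 by rewrite gt_eqF.
  by case: (w c p) => x y /=; congr (_ +i* _); field.
rewrite frame0_off// -[RHS]mix_unmix /mix; congr (_ * _ + _ * _).
  rewrite -[RHS]bog_unbog; apply: eq_bog; first by rewrite /= (negbTE kp).
  by rewrite /= mirror_eq (negbTE kp).
rewrite -[RHS]bog_unbog; apply: eq_bog; first by rewrite /= (negbTE kp).
by rewrite /= mirror_eq (negbTE kp).
Qed.

Lemma frame0_invK y : ncoord_space s p y -> frame0_inv (frame0 y) = y.
Proof.
move=> hy; rewrite /frame0_inv.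
have -> : solve (fun c => complex.Im (frame0 y c p) / amp c) = ang y.
  rewrite -[RHS]solve_wind; congr solve; apply/funext => c.
  by rewrite frame0_center//= mulrAC divff ?mul1r// gt_eqF.
have -> : undual (fun c => 2 * amp c * complex.Re (frame0 y c p)) = act y.
  rewrite -[RHS]undual_dual; congr undual; apply/funext => c.
  by rewrite frame0_center//= mulrC mulfVK// mulf_neq0// gt_eqF.
case: y hy => [[phi r] z] [_ z0] /=; congr pair; apply/funext => c; apply/funext => k.
have [->|kp] := eqVneq k p; first exact/esym/z0.
rewrite -[RHS]unbog_bog /unbog -(unmix_mix (bog z) c k) -(unmix_mix (bog z) c (2 * p - k)).
by rewrite /unmix !frame0_off// mirror_eq.
Qed.

Lemma nrm_linear (e : R) y y' c k :
  (nrm (e *: y + y') c k : C) = e%:C * (nrm y c k : C) + (nrm y' c k : C).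
Proof. by rewrite -modes_scaleE. Qed.

Lemma central_linear (e : R) y y' c :
  central (e *: y + y') c = e%:C * central y c + central y' c.
Proof.
have dE : dual c (act (e *: y + y')) = e * dual c (act y) + dual c (act y').
  rewrite /dual; case: y y' => [[a [r1 r2]] z] [[a' [r1' r2']] z'] /=.
  by rewrite -![_ *: _]/(_ * _); case: c; field.
have wE : wind (m c) (ang (e *: y + y')) = e * wind (m c) (ang y) + wind (m c) (ang y').
  rewrite /wind; case: y y' {dE} => [[[a1 a2] r] z] [[[a1' a2'] r'] z'] /=.
  by rewrite -![_ *: _]/(_ * _); ring.
have a0 : amp c != 0 by rewrite gt_eqF.
rewrite /central dE wE; apply/eqP; rewrite eq_complex /=.
by apply/andP; split; apply/eqP; [field | ring].
Qed.

Lemma frame0_linear (e : R) y y' : frame0 (e *: y + y') = e *: frame0 y + frame0 y'.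
Proof.
apply/funext => c; apply/funext => k.
rewrite -[RHS]/((e *: frame0 y c) k + frame0 y' c k) modes_scaleE.
rewrite /frame0 central_linear /mix /bog !nrm_linear.
rewrite !conjcD !conjcM !conjc_real.
case: (k == p); move: (nrm y false k) (nrm y true k) (nrm y' false k) (nrm y' true k)
  (nrm y false (2 * p - k)) (nrm y true (2 * p - k)) (nrm y' false (2 * p - k))
  (nrm y' true (2 * p - k)) => u1 u2 u3 u4 u5 u6 u7 u8;
  rewrite -[Rcomplex R]/C in u1 u2 u3 u4 u5 u6 u7 u8 *; by ring.
Qed.

(** ** Bounds *)

Definition fin_sq y : R :=
  (ang y).1 ^+ 2 + (ang y).2 ^+ 2 + (act y).1 ^+ 2 + (act y).2 ^+ 2.

Lemma fin_sq_ge0 y : 0 <= fin_sq y.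
Proof. by rewrite !addr_ge0 ?sqr_ge0. Qed.

Lemma linear_form_sq (a b x y : R) :
  (a * x + b * y) ^+ 2 <= (a ^+ 2 + b ^+ 2) * (x ^+ 2 + y ^+ 2).
Proof.
rewrite -subr_ge0.
have -> : (a ^+ 2 + b ^+ 2) * (x ^+ 2 + y ^+ 2) - (a * x + b * y) ^+ 2 =
  (a * y - b * x) ^+ 2 by ring.
exact: sqr_ge0.
Qed.

Lemma central_bound : exists2 N : R, 0 <= N & forall y c,
  modulus (central y c) ^+ 2 <= N * fin_sq y.
Proof.
pose al c : R := (if c then - (mR false).2 else (mR true).2) / det / (2 * amp c).
pose be c : R := (if c then (mR false).1 else - (mR true).1) / det / (2 * amp c).
pose n c : R := al c ^+ 2 + be c ^+ 2 +
  ((amp c * (mR c).1) ^+ 2 + (amp c * (mR c).2) ^+ 2).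
have n0 c : 0 <= n c by rewrite !addr_ge0 ?sqr_ge0.
exists (n false + n true); first by rewrite addr_ge0.
move=> y c; rewrite modulus_sq /=.
have e1 : dual c (act y) / (2 * amp c) = al c * (act y).1 + be c * (act y).2.
  have a0 : amp c != 0 by rewrite gt_eqF.
  by rewrite /dual /al /be; case: c a0 => a0; field; rewrite a0 det_neq0.
have e2 : amp c * wind (m c) (ang y) =
    amp c * (mR c).1 * (ang y).1 + amp c * (mR c).2 * (ang y).2.
  by rewrite windE; ring.
apply: (@le_trans _ _ (n c * fin_sq y)); last first.
  by rewrite ler_wpM2r ?fin_sq_ge0//; case: (c); rewrite ?lerDl ?lerDr.
rewrite e1 e2; apply: le_trans (lerD (linear_form_sq _ _ _ _) (linear_form_sq _ _ _ _)) _.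
rewrite /n /fin_sq.
have p1 : 0 <= al c ^+ 2 + be c ^+ 2 by rewrite addr_ge0 ?sqr_ge0.
have p2 : 0 <= (amp c * (mR c).1) ^+ 2 + (amp c * (mR c).2) ^+ 2 by rewrite addr_ge0 ?sqr_ge0.
have p3 : 0 <= (ang y).1 ^+ 2 + (ang y).2 ^+ 2 by rewrite addr_ge0 ?sqr_ge0.
have p4 : 0 <= (act y).1 ^+ 2 + (act y).2 ^+ 2 by rewrite addr_ge0 ?sqr_ge0.
move: (al c ^+ 2 + _) (_ + (amp c * _) ^+ 2) ((ang y).1 ^+ 2 + (ang y).2 ^+ 2) p1 p2 p3 p4 => A B X A0 B0 X0.
rewrite -(addrA X).
move: ((act y).1 ^+ 2 + _) => Y Y0; nra.
Qed.

Lemma real_complexM (a b : R) : (a * b)%:C = a%:C * b%:C :> C.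
Proof. by rewrite rmorphM. Qed.

Lemma real_complexN (a : R) : (- a)%:C = - a%:C :> C.
Proof. by rewrite rmorphN. Qed.

Lemma real_complexD (a b : R) : (a + b)%:C = a%:C + b%:C :> C.
Proof. by rewrite rmorphD. Qed.

Lemma Q_le1 c d : `|Q c d| <= 1.
Proof.
rewrite -(@ler_pXn2r _ 2) ?nnegrE// expr1n real_normK ?num_real//.
have h : Q c false ^+ 2 + Q c true ^+ 2 = 1 by rewrite !expr2 Q_rows eqxx.
have := sqr_ge0 (Q c false); have := sqr_ge0 (Q c true).
by case: d; lra.
Qed.

Lemma sq_sum4 (x1 x2 x3 x4 : R) :
  (x1 + x2 + (x3 + x4)) ^+ 2 <= 4 * (x1 ^+ 2 + x2 ^+ 2 + (x3 ^+ 2 + x4 ^+ 2)).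
Proof.
have := sqr_ge0 (x1 - x2); have := sqr_ge0 (x1 - x3); have := sqr_ge0 (x1 - x4).
have := sqr_ge0 (x2 - x3); have := sqr_ge0 (x2 - x4); have := sqr_ge0 (x3 - x4).
by rewrite !expr2; nra.
Qed.

(** Every entry of a product of the mixing and Bogoliubov maps is a combination,
    with coefficients of modulus at most 2, of the entries at k and 2p - k. *)
Lemma combination_bound (a1 a2 a3 a4 : R) (z1 z2 z3 z4 : C) :
  `|a1| <= 2 -> `|a2| <= 2 -> `|a3| <= 2 -> `|a4| <= 2 ->
  modulus (a1%:C * z1 + a2%:C * z2 + (a3%:C * z3 + a4%:C * z4)) ^+ 2 <=
  16 * (modulus z1 ^+ 2 + modulus z2 ^+ 2 + (modulus z3 ^+ 2 + modulus z4 ^+ 2)).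
Proof.
move=> h1 h2 h3 h4.
apply: (@le_trans _ _ ((2 * modulus z1 + 2 * modulus z2 + (2 * modulus z3 + 2 * modulus z4)) ^+ 2)).
  rewrite lerXn2r ?nnegrE ?modulus_ge0 ?addr_ge0 ?mulr_ge0 ?modulus_ge0//.
  apply: le_trans (modulus_triangle _ _) _.
  by apply: lerD; apply: le_trans (modulus_triangle _ _) _; apply: lerD;
    rewrite modulusM modulus_real ler_wpM2r ?modulus_ge0.
apply: le_trans (sq_sum4 _ _ _ _) _; rewrite !exprMn.
by rewrite -!mulrDr mulrA ler_wpM2r ?addr_ge0 ?sqr_ge0// -natrX -natrM ler_nat.
Qed.

Lemma prod_le2 (a b : R) : `|a| <= 1 -> `|b| <= 2 -> `|a * b| <= 2.
Proof.
by move=> h1 h2; rewrite normrM; have := normr_ge0 a; have := normr_ge0 b; nra.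
Qed.

Lemma mix_bog_bound z c k : modulus (mix (bog z) c k) ^+ 2 <=
  16 * (modulus (z false k) ^+ 2 + modulus (z false (2 * p - k)) ^+ 2
        + (modulus (z true k) ^+ 2 + modulus (z true (2 * p - k)) ^+ 2)).
Proof.
have := @combination_bound (Q false c * bog_a false k) (Q false c * bog_b false k)
  (Q true c * bog_a true k) (Q true c * bog_b true k)
  (z false k) (conjc (z false (2 * p - k))) (z true k) (conjc (z true (2 * p - k))).
rewrite !modulus_conj !(real_complexM (Q _ c)) => h.
have -> : mix (bog z) c k = (Q false c)%:C * (bog_a false k)%:C * z false k +
   (Q false c)%:C * (bog_b false k)%:C * conjc (z false (2 * p - k)) +
   ((Q true c)%:C * (bog_a true k)%:C * z true k +
    (Q true c)%:C * (bog_b true k)%:C * conjc (z true (2 * p - k))).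
  by rewrite /mix /bog !mulrDr !mulrA.
by apply: h; apply: prod_le2; rewrite ?Q_le1//; have [] := bog_le false k; have [] := bog_le true k.
Qed.

Lemma unbog_unmix_bound w c k : modulus (unbog (unmix w) c k) ^+ 2 <=
  16 * (modulus (w false k) ^+ 2 + modulus (w false (2 * p - k)) ^+ 2
        + (modulus (w true k) ^+ 2 + modulus (w true (2 * p - k)) ^+ 2)).
Proof.
have := @combination_bound (Q c false * bog_a c k) (Q c false * - bog_b c k)
  (Q c true * bog_a c k) (Q c true * - bog_b c k)
  (w false k) (conjc (w false (2 * p - k))) (w true k) (conjc (w true (2 * p - k))).
rewrite !modulus_conj !(real_complexM (Q c _)) !(rmorphN (real_complex R)) => h.
have -> : unbog (unmix w) c k = (Q c false)%:C * (bog_a c k)%:C * w false k +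
   (Q c false)%:C * - (bog_b c k)%:C * conjc (w false (2 * p - k)) +
   ((Q c true)%:C * (bog_a c k)%:C * w true k +
    (Q c true)%:C * - (bog_b c k)%:C * conjc (w true (2 * p - k))).
  rewrite /unbog /unmix conjcD !conjcM !conjc_real.
  move: (w false k) (w true k) (w false _) (w true _) => u1 u2 u3 u4.
  by rewrite -[Rcomplex R]/C in u1 u2 u3 u4 *; ring.
by apply: h; apply: prod_le2; rewrite ?normrN ?Q_le1//; have [] := bog_le c k.
Qed.

Lemma fin_sq_le_ncoord y : ((fin_sq y)%:E <= ncoord_sq s y)%E.
Proof. by rewrite /ncoord_sq leeDl// phase_sq_ge0. Qed.

Lemma nrm_le_ncoord y : (phase_sq s (nrm y) <= ncoord_sq s y)%E.
Proof. by rewrite /ncoord_sq leeDr// lee_fin fin_sq_ge0. Qed.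

Lemma frame0_bound : exists2 M : R, 0 <= M & forall y,
  (phase_sq s (frame0 y) <= M%:E * ncoord_sq s y)%E.
Proof.
have [N N0 hN] := central_bound.
pose W := hs_weight s p; have W0 : 0 <= W by rewrite ltW// hs_weight_gt0.
have m0 : 0 <= mirror_const s p by apply: le_trans (mirror_const_ge1 _ _).
pose M1 : R := 2 * (W * N + W * N); pose M2 : R := 2 * (2 * 16 * mirror_const s p).
have M10 : 0 <= M1 by rewrite mulr_ge0// addr_ge0// mulr_ge0.
have M20 : 0 <= M2 by rewrite mulr_ge0// mulr_ge0.
exists (M1 + M2); first by rewrite addr_ge0.
move=> y; pose c0 : phase R := fun c k => if k == p then central y c else 0.
have -> : frame0 y = (c0 + mix (bog (nrm y)))%R by [].
apply: le_trans (phase_sqD_le _ _ _) _.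
have h0 c : (hs_sq s (c0 c) <= (W * N * fin_sq y)%:E)%E.
  rewrite (@hs_sq_single _ _ p); last by move=> k /negbTE kp; rewrite /c0 kp.
  by rewrite lee_fin -/W -mulrA ler_wpM2l// /c0 eqxx hN.
have h1 : (phase_sq s (mix (bog (nrm y))) <= (2 * 16 * mirror_const s p)%:E * phase_sq s (nrm y))%E.
  by apply: phase_sq_pointwise => // c k; exact: mix_bog_bound.
have h2 : (2%:E * phase_sq s c0 <= M1%:E * ncoord_sq s y)%E.
  apply: (@le_trans _ _ (M1 * fin_sq y)%:E); last first.
    by rewrite EFinM lee_wpmul2l ?lee_fin// fin_sq_le_ncoord.
  have -> : (M1 * fin_sq y)%:E = (2%:E * ((W * N * fin_sq y)%:E + (W * N * fin_sq y)%:E))%E.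
    by rewrite -EFinD -EFinM; congr EFin; rewrite /M1; ring.
  by rewrite lee_wpmul2l// leeD.
have h3 : (2%:E * phase_sq s (mix (bog (nrm y))) <= M2%:E * ncoord_sq s y)%E.
  rewrite /M2 EFinM -muleA lee_wpmul2l//; apply: le_trans h1 _.
  by rewrite lee_wpmul2l ?lee_fin ?mulr_ge0// nrm_le_ncoord.
have nc0 : (0 <= ncoord_sq s y)%E.
  by apply: le_trans (fin_sq_le_ncoord y); rewrite lee_fin fin_sq_ge0.
have -> : ((M1 + M2)%:E * ncoord_sq s y = M1%:E * ncoord_sq s y + M2%:E * ncoord_sq s y)%E.
  by rewrite EFinD ge0_muleDl ?lee_fin.
by rewrite ge0_muleDr ?phase_sq_ge0//; exact: (leeD h2 h3).
Qed.

Lemma frame0_inv_bound : exists2 M : R, 0 <= M & forall w,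
  (ncoord_sq s (frame0_inv w) <= M%:E * phase_sq s w)%E.
Proof.
have m0 : 0 <= mirror_const s p by apply: le_trans (mirror_const_ge1 _ _).
(* squared coefficients of the inverse on the central modes *)
pose u c : R := (amp c)^-1 ^+ 2; pose v c : R := (2 * amp c) ^+ 2.
pose k1 : R := (((mR true).2 / det) ^+ 2 + ((mR false).2 / det) ^+ 2)
  + (((mR true).1 / det) ^+ 2 + ((mR false).1 / det) ^+ 2).
pose k2 : R := ((mR false).1 ^+ 2 + (mR true).1 ^+ 2)
  + ((mR false).2 ^+ 2 + (mR true).2 ^+ 2).
pose N : R := (k1 * (u false + u true) + k2 * (v false + v true)).
have u0 c : 0 <= u c by rewrite sqr_ge0.
have v0 c : 0 <= v c by rewrite sqr_ge0.
have k10 : 0 <= k1 by rewrite !addr_ge0 ?sqr_ge0.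
have k20 : 0 <= k2 by rewrite !addr_ge0 ?sqr_ge0.
have N0 : 0 <= N by rewrite addr_ge0// mulr_ge0// addr_ge0.
exists (N + 2 * 16 * mirror_const s p); first by rewrite addr_ge0// mulr_ge0.
move=> w; have h1 : ((fin_sq (frame0_inv w))%:E <= N%:E * phase_sq s w)%E.
  apply: (@le_trans _ _ (N%:E * (modulus (w false p) ^+ 2 + modulus (w true p) ^+ 2)%:E)%E); last first.
    by rewrite lee_wpmul2l ?lee_fin// EFinD leeD// modulus_sq_le_hs.
  rewrite -EFinM lee_fin.
  pose e c := complex.Im (w c p) / amp c; pose d c := 2 * amp c * complex.Re (w c p).
  have eu c : e c ^+ 2 <= u c * modulus (w c p) ^+ 2.
    rewrite /e /u exprMn mulrC ler_wpM2l ?sqr_ge0// modulus_sq lerDr sqr_ge0//.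
  have dv c : d c ^+ 2 <= v c * modulus (w c p) ^+ 2.
    by rewrite /d /v exprMn ler_wpM2l ?sqr_ge0// modulus_sq lerDl sqr_ge0.
  have h1 : fin_sq (frame0_inv w) <= k1 * (e false ^+ 2 + e true ^+ 2) + k2 * (d false ^+ 2 + d true ^+ 2).
    rewrite /fin_sq /frame0_inv /ang /act /= -/(e false) -/(e true) -/(d false) -/(d true).
    have -> : ((mR true).2 * e false - (mR false).2 * e true) / det =
      (mR true).2 / det * e false + - ((mR false).2 / det) * e true by field.
    have -> : ((mR false).1 * e true - (mR true).1 * e false) / det =
      - ((mR true).1 / det) * e false + (mR false).1 / det * e true by field.
    have l1 := linear_form_sq ((mR true).2 / det) (- ((mR false).2 / det)) (e false) (e true).
    have l2 := linear_form_sq (- ((mR true).1 / det)) ((mR false).1 / det) (e false) (e true).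
    have l3 := linear_form_sq (mR false).1 (mR true).1 (d false) (d true).
    have l4 := linear_form_sq (mR false).2 (mR true).2 (d false) (d true).
    apply: le_trans (lerD (lerD (lerD l1 l2) l3) l4) _.
    by rewrite le_eqVlt; apply/orP; left; apply/eqP; rewrite /k1 /k2; ring.
  apply: le_trans h1 _.
  have := eu false; have := eu true; have := dv false; have := dv true.
  have := sqr_ge0 (modulus (w false p : C)); have := sqr_ge0 (modulus (w true p : C)).
  move: (modulus (w false p) ^+ 2) (modulus (w true p) ^+ 2) (e false ^+ 2) (e true ^+ 2)
    (d false ^+ 2) (d true ^+ 2) => x y e1 e2 d1 d2 y0 x0 hd2 hd1 he2 he1.
  have -> : N * (x + y) = k1 * ((u false + u true) * (x + y)) + k2 * ((v false + v true) * (x + y)).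
    by rewrite /N; ring.
  have uf := u0 false; have ut := u0 true; have vf := v0 false; have vt := v0 true.
  by apply: lerD; apply: ler_wpM2l => //; nra.
have -> : ((N + 2 * 16 * mirror_const s p)%:E * phase_sq s w =
    N%:E * phase_sq s w + (2 * 16 * mirror_const s p)%:E * phase_sq s w)%E.
  by rewrite EFinD ge0_muleDl ?lee_fin ?mulr_ge0.
rewrite {1}/ncoord_sq; apply: leeD => //.
apply: phase_sq_pointwise => // c k.
rewrite /frame0_inv /nrm /=; case: ifP => _; last exact: unbog_unmix_bound.
by rewrite (modulus0 R) expr0n /= mulr_ge0 ?addr_ge0 ?sqr_ge0.
Qed.

Lemma ncoord_sq_fin y : ncoord_space s p y -> ncoord_sq s y \is a fin_num.
Proof. by move=> [hy _]; rewrite fin_numD phase_sq_fin// andbT. Qed.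

Lemma phase_space_of_sq w : (phase_sq s w < +oo)%E -> phase_space s w.
Proof.
move=> h c; apply: le_lt_trans h; rewrite /phase_sq.
by case: c; rewrite ?leeDl ?leeDr ?hs_sq_ge0.
Qed.

Lemma phase_space_frame0 y : ncoord_space s p y -> phase_space s (frame0 y).
Proof.
move=> hy; have [M M0 hM] := frame0_bound; apply: phase_space_of_sq.
apply: le_lt_trans (hM y) _; rewrite lte_mul_pinfty ?lee_fin//.
by rewrite ltey_eq ncoord_sq_fin.
Qed.

Lemma ncoord_space_frame0_inv w : phase_space s w -> ncoord_space s p (frame0_inv w).
Proof.
move=> hw; have [M M0 hM] := frame0_inv_bound; split; last first.
  by move=> c; rewrite /nrm /frame0_inv /= eqxx.
apply: phase_space_of_sq; apply: le_lt_trans (nrm_le_ncoord _) _.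
apply: le_lt_trans (hM w) _; rewrite lte_mul_pinfty ?lee_fin//.
by rewrite ltey_eq phase_sq_fin.
Qed.

(** ** Symplecticity *)

Definition sympl_term w w' k : R :=
  2 * (complex.Im ((w false k : C) * conjc (w' false k))
       + complex.Im ((w true k : C) * conjc (w' true k))).

Lemma sympl_term_summable w w' : phase_space s w -> phase_space s w' ->
  abs_summable (fun k => (sympl_term w w' k)%:C).
Proof.
have sq_summable u : phase_space s u -> forall c,
    exists M, forall A : {fset int}, \sum_(k <- A) modulus (u c k) ^+ 2 <= M.
  move=> hu c; have [M hM] := (ell2P s _).1 (hu c); exists M => A.
  apply: le_trans (hM A); apply: ler_sum => k _.
  by rewrite ler_peMl ?sqr_ge0// (hs_weight_ge1 s_gt).
move=> hw hw'.
have := bounded_sumD (bounded_sumD (sq_summable w hw false) (sq_summable w' hw' false))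
  (bounded_sumD (sq_summable w hw true) (sq_summable w' hw' true)).
move=> H; apply: abs_summable_le H _ => k; rewrite modulus_real /sympl_term.
have im2 (u v : C) : 2 * `|complex.Im (u * conjc v)| <= modulus u ^+ 2 + modulus v ^+ 2.
  have := Im_le_modulus (u * conjc v); rewrite modulusM modulus_conj.
  have := sqr_ge0 (modulus u - modulus v); rewrite !expr2; nra.
rewrite normrM (ger0_norm (x := 2))//.
have := im2 (w false k) (w' false k); have := im2 (w true k) (w' true k).
have := ler_normD (complex.Im ((w false k : C) * conjc (w' false k)))
  (complex.Im ((w true k : C) * conjc (w' true k))).
lra.
Qed.

Lemma symplectic_formE w w' (L : R) :
  has_sum (@cnorm R) (fun k => (sympl_term w w' k)%:C) L%:C ->
  symplectic_form w w' = L.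
Proof. by move=> /total_sum_Re. Qed.

Lemma sympl_term_rotate al w w' k :
  sympl_term (rotate al w) (rotate al w') k = sympl_term w w' k.
Proof.
have e c : ((rotate al w c k : C) * conjc (rotate al w' c k)) = (w c k : C) * conjc (w' c k).
  rewrite /rotate conjcM conj_expi; have := expiMN (al c).
  move: (w c k) (conjc (w' c k)) => u v h; rewrite -[Rcomplex R]/C in u v *.
  transitivity ((expi (al c) * expi (- al c)) * (u * v)); first by ring.
  by rewrite h mul1r.
by rewrite /sympl_term !e.
Qed.

Lemma sympl_term_mix z z' k : sympl_term (mix z) (mix z') k = sympl_term z z' k.
Proof.
have h00 := Q_rows false false; have h01 := Q_rows false true; have h11 := Q_rows true true.
rewrite /= in h00 h01 h11.
rewrite /sympl_term /mix; congr (2 * _).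
case: (z false k) (z true k) (z' false k) (z' true k) => a1 a2 [b1 b2] [c1 c2] [d1 d2] /=.
rewrite !mul0r !subr0 !addr0.
move: h00 h01 h11; move: (Q false false) (Q false true) (Q true false) (Q true true) => q1 q2 q3 q4 h00 h01 h11.
transitivity ((q1 * q1 + q2 * q2) * (a2 * c1 - a1 * c2) + (q3 * q3 + q4 * q4) * (b2 * d1 - b1 * d2)
  + (q1 * q3 + q2 * q4) * (a2 * d1 - a1 * d2 + b2 * c1 - b1 * c2)); first by ring.
by rewrite h00 h01 h11; ring.
Qed.

(** The Bogoliubov map changes the symplectic form mode by mode, but by a term
    that is odd under the reflection k -> 2p - k. *)
Lemma sympl_term_bog_odd z z' k :
  sympl_term (bog z) (bog z') (2 * p - k) - sympl_term z z' (2 * p - k) =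
  - (sympl_term (bog z) (bog z') k - sympl_term z z' k).
Proof.
have key d : complex.Im ((bog z d (2 * p - k) : C) * conjc (bog z' d (2 * p - k)))
    + complex.Im ((bog z d k : C) * conjc (bog z' d k)) =
  complex.Im ((z d (2 * p - k) : C) * conjc (z' d (2 * p - k)))
    + complex.Im ((z d k : C) * conjc (z' d k)).
  rewrite /bog mirrorK; have [-> ->] := bog_mirror d k.
  have := bog_det d k; move: (bog_a d k) (bog_b d k) => a b h.
  case: (z d k) (z d (2 * p - k)) (z' d k) (z' d (2 * p - k)) => a1 a2 [b1 b2] [c1 c2] [d1 d2] /=.
  transitivity ((a ^+ 2 - b ^+ 2) * (a2 * c1 - a1 * c2 + (b2 * d1 - b1 * d2))); first by ring.
  by rewrite h; ring.
have kf := key false; have kt := key true.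
rewrite /sympl_term; move: kf kt.
move: (complex.Im _) (complex.Im _) (complex.Im _) (complex.Im _) (complex.Im _)
  (complex.Im _) (complex.Im _) (complex.Im _) => x1 x2 x3 x4 x5 x6 x7 x8; lra.
Qed.

(** Subtract from the symplectic form its central and normal parts: the
    remaining terms are odd under the reflection k -> 2p - k, by
    [sympl_term_bog_odd], hence sum to their opposite. *)
Lemma symplectic_frame0 al y y' : ncoord_space s p y -> ncoord_space s p y' ->
  symplectic_form (rotate al (frame0 y)) (rotate al (frame0 y')) = ncoord_form y y'.
Proof.
move=> hy hy'; have [hz hz0] := hy; have [hz' hz0'] := hy'.
set z := nrm y in hz hz0; set z' := nrm y' in hz' hz0'.
pose cen k : R := if k == p then ncoord_form y y' - symplectic_form z z' else 0.
have cenp : 2 * (complex.Im (central y false * conjc (central y' false))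
    + complex.Im (central y true * conjc (central y' true))) =
    ncoord_form y y' - symplectic_form z z'.
  rewrite /ncoord_form -/z -/z' addrK -!(wind_dual (ang _) (act _)) /=.
  have := wind_dual (ang y) (act y'); have := wind_dual (ang y') (act y).
  rewrite /central /=.
  have a0 : amp false != 0 by rewrite gt_eqF.
  have a1 : amp true != 0 by rewrite gt_eqF.
  move=> e1 e2.
  transitivity (wind (m false) (ang y) * dual false (act y') + wind (m true) (ang y) * dual true (act y')
    - (wind (m false) (ang y') * dual false (act y) + wind (m true) (ang y') * dual true (act y))).
    by rewrite /dual /=; field; rewrite a0 a1 det_neq0.
  by rewrite e1 e2; ring.
have realsum (f : int -> R) (l : C) : has_sum (@cnorm R) (fun k => (f k)%:C) l ->
    l = (complex.Re l)%:C.
  move=> h; have hcj : has_sum (@cnorm R) (fun k => (f k)%:C) (conjc l).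
    by apply: eq_has_sum (has_sum_conj h) => k; rewrite conjc_real.
  have := has_sum_uniq h hcj; case: l {h hcj} => l1 l2 [] h.
  by apply/eqP; rewrite eq_complex /= eqxx /=; apply/eqP; lra.
have formE w w' : phase_space s w -> phase_space s w' ->
    has_sum (@cnorm R) (fun k => (sympl_term w w' k)%:C) (symplectic_form w w')%:C.
  move=> hw hw'; have [L hL] := abs_summable_ex (sympl_term_summable hw hw').
  have hL' := hL; rewrite (realsum _ _ hL) in hL'.
  by rewrite (symplectic_formE hL').
have hG := phase_space_frame0 hy; have hG' := phase_space_frame0 hy'.
have rotE : symplectic_form (rotate al (frame0 y)) (rotate al (frame0 y')) =
    symplectic_form (frame0 y) (frame0 y').
  apply: symplectic_formE; apply: eq_has_sum (formE _ _ hG hG') => k.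
  by rewrite sympl_term_rotate.
have hc : has_sum (@cnorm R) (fun k => (cen k)%:C) (ncoord_form y y' - symplectic_form z z')%:C.
  have -> : ncoord_form y y' - symplectic_form z z' = cen p by rewrite /cen eqxx.
  by apply: (has_sum_single (f := fun k => (cen k)%:C)) => k /negbTE kp; rewrite /cen kp.
pose tau k : R := sympl_term (frame0 y) (frame0 y') k - cen k - sympl_term z z' k.
have htau : has_sum (@cnorm R) (fun k => (tau k)%:C)
    (symplectic_form (frame0 y) (frame0 y') - ncoord_form y y')%:C.
  have := has_sumD (has_sumD (formE _ _ hG hG') (has_sumN hc)) (has_sumN (formE _ _ hz hz')).
  rewrite -!rmorphN -!rmorphD /=.
  have -> : symplectic_form (frame0 y) (frame0 y') + - (ncoord_form y y' - symplectic_form z z') +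
    - symplectic_form z z' = symplectic_form (frame0 y) (frame0 y') - ncoord_form y y' by ring.
  by apply: eq_has_sum => k; rewrite /tau -!rmorphN -!rmorphD.
have tau_odd k : tau (2 * p - k) = - tau k.
  have [->|kp] := eqVneq k p.
    rewrite (_ : 2 * p - p = p); last by lia.
    suff -> : tau p = 0 by rewrite oppr0.
    rewrite /tau /sympl_term !frame0_center// cenp /cen eqxx subrr sub0r.
    by rewrite !hz0 -[(0 : Rcomplex R)]/(0 : C) !mul0r /= addr0 mulr0 oppr0.
  have offE l : l != p -> tau l = sympl_term (bog z) (bog z') l - sympl_term z z' l.
    move=> lp; rewrite /tau /cen (negbTE lp) subr0 -(sympl_term_mix (bog z)).
    by rewrite /sympl_term !frame0_off.
  by rewrite !offE ?mirror_eq// sympl_term_bog_odd.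
have odd k : (tau (2 * p - k))%:C = - (tau k)%:C :> C by rewrite tau_odd rmorphN.
have cK : cancel (fun k : int => 2 * p - k) (fun k => 2 * p - k) := mirrorK.
have := eq_has_sum odd (has_sum_reindex cK cK htau).
move=> /has_sum_uniq /(_ (has_sumN htau)) /(congr1 (@complex.Re R)) /= e.
by rewrite rotE; lra.
Qed.

(** ** Normal form of the linearized flow *)

Variables (S : bool -> bool -> R) (omega : R * R).
Hypothesis Q_eigen : forall c e,
  S c false * Q e false + S c true * Q e true = lam e * Q e c.

Definition normal_matrix : mode_matrix R := fun a b =>
  if a == b then (freq a.1 a.2)%:C else 0.

Lemma block_apply_normal z c k :
  block_apply normal_matrix z c k = (freq c k)%:C * (z c k : C).
Proof.
rewrite /block_apply (bigD1 c)//= [X in _ + X]big1 ?addr0; last first.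
  move=> d dc; rewrite big1// => l _; rewrite /normal_matrix xpair_eqE.
  by rewrite eq_sym (negbTE dc) mul0r.
have kin : k \in undup [:: k; - k] by rewrite mem_undup inE eqxx.
rewrite (bigD1_seq k kin (undup_uniq _)) /= [X in _ + X]big1 ?addr0; last first.
  move=> l lk; rewrite /normal_matrix xpair_eqE eqxx /= eq_sym (negbTE lk).
  by rewrite mul0r.
by rewrite /normal_matrix eqxx.
Qed.

Lemma normal_matrix_hermitian : Defs.hermitian normal_matrix.
Proof.
move=> a b; rewrite /normal_matrix eq_sym; case: eqVneq => [->|_]; last by rewrite conjc0.
by rewrite conjc_real.
Qed.

Lemma normal_matrix_block_diagonal : block_diagonal normal_matrix.
Proof.
move=> a b ab; rewrite /normal_matrix; case: eqVneq => // e.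
by rewrite e eqxx in ab.
Qed.

(** The variation of the modulus of the central mode d. *)
Definition radial (r : R * R) d : R := dual d r / (2 * amp d).
Definition phase_drift (r : R * R) : R * R :=
  solve (fun c => - (2 * (S c false * radial r false + S c true * radial r true)) / amp c).
(** The actions change the moduli and hence, through the coupling, the
    frequencies of the wave; this moves the angles at a rate linear in the
    actions, and nothing else is driven. *)
Definition drift (theta : R * R) y : ncoord R := (phase_drift (act y), (0, 0), 0).

Lemma phase_drift_form r :
  (phase_drift r).1 = (phase_drift (1, 0)).1 * r.1 + (phase_drift (0, 1)).1 * r.2 /\
  (phase_drift r).2 = (phase_drift (1, 0)).2 * r.1 + (phase_drift (0, 1)).2 * r.2.
Proof.
have a0 : amp false != 0 by rewrite gt_eqF.
have a1 : amp true != 0 by rewrite gt_eqF.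
case: r => r1 r2; rewrite /phase_drift /solve /radial /dual /=.
by split; field; rewrite a0 a1 det_neq0.
Qed.

Lemma phase_drift0 : phase_drift (0, 0) = (0, 0).
Proof.
have [h1 h2] := phase_drift_form (0, 0).
by apply: injective_projections; [rewrite h1 | rewrite h2]; rewrite !mulr0 addr0.
Qed.

Lemma ncoord_space_linear (e : R) y y' : ncoord_space s p y -> ncoord_space s p y' ->
  ncoord_space s p (e *: y + y').
Proof.
move=> [hy y0] [hy' y0']; split => c; last first.
  have := nrm_linear e y y' c p; rewrite y0 y0' => ->.
  by rewrite -[(0 : Rcomplex R)]/(0 : C) mulr0 addr0.
have -> : nrm (e *: y + y') c = (fun k => e%:C * (nrm y c k : C)) + nrm y' c.
  by apply/funext => k; exact: nrm_linear.
by apply: ell2D => //; apply: ell2Z; exact: hy.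
Qed.

Lemma ncoord_space_pair (phi r : R * R) : ncoord_space s p (phi, r, 0).
Proof.
split=> c //; rewrite /nrm /=; apply: (@ell2_single _ s p) => k _.
by [].
Qed.

Lemma drift_coupling : exists2 M : R, 0 <= M & forall M', M <= M' ->
  triangular_coupling s p M' drift.
Proof.
pose n : R := (phase_drift (1, 0)).1 ^+ 2 + (phase_drift (0, 1)).1 ^+ 2
  + ((phase_drift (1, 0)).2 ^+ 2 + (phase_drift (0, 1)).2 ^+ 2).
have n0 : 0 <= n by rewrite !addr_ge0 ?sqr_ge0.
exists n => // M' nM theta; split.
  move=> e y y' _ _.
  have [h1 h2] := phase_drift_form (act (e *: y + y')).
  have [h3 h4] := phase_drift_form (act y); have [h5 h6] := phase_drift_form (act y').
  have dE : phase_drift (act (e *: y + y')) = e *: phase_drift (act y) + phase_drift (act y').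
    rewrite (surjective_pairing (phase_drift (act (e *: y + y')))) h1 h2.
    apply/eqP; rewrite xpair_eqE; apply/andP; split; apply/eqP.
      rewrite -[RHS]/(e * (phase_drift (act y)).1 + (phase_drift (act y')).1) h3 h5.
      rewrite -[(act _).1]/(e * (act y).1 + (act y').1) -[(act (e *: y + y')).2]/(e * (act y).2 + (act y').2).
      by ring.
    rewrite -[RHS]/(e * (phase_drift (act y)).2 + (phase_drift (act y')).2) h4 h6.
    rewrite -[(act (e *: y + y')).1]/(e * (act y).1 + (act y').1) -[(act (e *: y + y')).2]/(e * (act y).2 + (act y').2).
    by ring.
  rewrite /drift dE; congr (_, _, _).
    by apply: injective_projections; rewrite -[RHS]/(e * 0 + 0) mulr0 addr0.
  rewrite -[RHS]/(e *: (0 : phase R) + 0); by rewrite scaler0 addr0.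
move=> y hy; split=> //.
- exact: ncoord_space_pair.
- have -> : ncoord_sq s (drift theta y) = ((phase_drift (act y)).1 ^+ 2 + (phase_drift (act y)).2 ^+ 2)%:E.
    rewrite /ncoord_sq /drift /ang /act /nrm /= !expr0n /= !addr0.
    by rewrite /phase_sq !hs_sq0 !adde0.
  apply: (@le_trans _ _ (n * fin_sq y)%:E); last first.
    have nc0 : (0 <= ncoord_sq s y)%E.
      by apply: le_trans (fin_sq_le_ncoord y); rewrite lee_fin fin_sq_ge0.
    apply: (@le_trans _ _ (n%:E * ncoord_sq s y)%E).
      by rewrite EFinM lee_wpmul2l ?lee_fin// fin_sq_le_ncoord.
    by rewrite lee_wpmul2r// lee_fin.
  rewrite lee_fin; have [-> ->] := phase_drift_form (act y).
  apply: le_trans (lerD (linear_form_sq _ _ _ _) (linear_form_sq _ _ _ _)) _.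
  rewrite -mulrDl ler_wpM2l// /fin_sq -[leRHS]addrA lerDr addr_ge0 ?sqr_ge0//.
- by move=> ay0; rewrite /drift ay0 phase_drift0.
Qed.

Lemma bog_mirror_sum z e k :
  (bog z e k : C) + conjc (bog z e (2 * p - k) : C) =
  (bog_a e k + bog_b e k)%:C * ((z e k : C) + conjc (z e (2 * p - k) : C)).
Proof.
rewrite /bog mirrorK; have [-> ->] := bog_mirror e k.
rewrite conjcD !conjcM !conjc_real conjcK rmorphD.
move: (z e k) (conjc (z e _)) => u v; rewrite -[Rcomplex R]/C in u v *.
by ring.
Qed.

(** Image of the linearized vector field in the normal variables. *)
Definition normal_field z : phase R := fun e k =>
  (bog_a e k * freq e k)%:C * (z e k : C)
  - (bog_b e k * freq e (2 * p - k))%:C * conjc (z e (2 * p - k) : C).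

(** Mixing diagonalizes the coupling of the components, after which each pair
    of modes is diagonalized by [bog_eigen]. *)
Lemma linF_off y c k : k != p ->
  linF p S (frame0 y) c k = mix (normal_field (nrm y)) c k.
Proof.
move=> kp; have kp' : 2 * p - k != p by rewrite mirror_eq.
set z := nrm y.
have eig e : (normal_field z e k : C) =
    (k%:~R ^+ 2 - p%:~R ^+ 2)%:C * (bog z e k : C)
    + (lam e)%:C * ((bog z e k : C) + conjc (bog z e (2 * p - k) : C)).
  rewrite bog_mirror_sum /normal_field /bog; have [-> h2] := bog_eigen e kp.
  rewrite -[- ((bog_b e k * _)%:C * _)]mulNr -real_complexN h2.
  move: (k%:~R ^+ 2 - p%:~R ^+ 2) (lam e) (bog_a e k) (bog_b e k) (z e k) (conjc (z e _)).
  move=> K l a b u v; rewrite -[Rcomplex R]/C in u v *.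
  by rewrite !real_complexD !real_complexM !real_complexD; ring.
have mirE d : (mirror p (frame0 y) d k : C) =
    (Q false d)%:C * ((bog z false k : C) + conjc (bog z false (2 * p - k) : C))
    + (Q true d)%:C * ((bog z true k : C) + conjc (bog z true (2 * p - k) : C)).
  rewrite /mirror !frame0_off// /mix conjcD !conjcM !conjc_real -/z.
  move: (bog z false k) (bog z true k) (conjc (bog z false _)) (conjc (bog z true _)) => u1 u2 u3 u4.
  by rewrite -[Rcomplex R]/C in u1 u2 u3 u4 *; ring.
have cE e : (S c false)%:C * (Q e false)%:C + (S c true)%:C * (Q e true)%:C =
    (lam e)%:C * (Q e c)%:C :> C.
  by rewrite -!real_complexM -rmorphD Q_eigen.
rewrite /linF /coupling !mirE frame0_off// /mix -/z !eig.
move: (bog z false k) (bog z true k) (conjc (bog z false _)) (conjc (bog z true _)) => u1 u2 u3 u4.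
rewrite -[Rcomplex R]/C in u1 u2 u3 u4 *.
have ef := cE false; have et := cE true.
transitivity ((k%:~R ^+ 2 - p%:~R ^+ 2)%:C * ((Q false c)%:C * u1 + (Q true c)%:C * u2)
  + (((S c false)%:C * (Q false false)%:C + (S c true)%:C * (Q false true)%:C) * (u1 + u3)
  + ((S c false)%:C * (Q true false)%:C + (S c true)%:C * (Q true true)%:C) * (u2 + u4))).
  by ring.
by rewrite ef et; ring.
Qed.

(** At k = p the dispersive part vanishes, and the coupling sees only the real
    parts, that is the variations of the moduli. *)
Lemma linF_center y c : ncoord_space s p y -> linF p S (frame0 y) c p =
  (2 * (S c false * radial (act y) false + S c true * radial (act y) true))%:C.
Proof.
move=> hy; have pp : 2 * p - p = p by lia.
have mE d : (mirror p (frame0 y) d p : C) = (2 * radial (act y) d)%:C.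
  rewrite /mirror pp !frame0_center// /central -/(radial _ _).
  by apply/eqP; rewrite eq_complex /=; apply/andP; split; apply/eqP; ring.
rewrite /linF /coupling !mE subrr -[0%:C]/(0 : C) mul0r add0r.
move: (radial _ _) (radial _ _) => r1 r2.
by rewrite -!real_complexM -real_complexD; congr (_ +i* _); ring.
Qed.

Lemma normal_field_unbog z c k :
  (bog_a c k)%:C * (- 'i%C * (normal_field z c k : C))
  - (bog_b c k)%:C * conjc (- 'i%C * (normal_field z c (2 * p - k) : C)) =
  - 'i%C * ((freq c k)%:C * (z c k : C)).
Proof.
rewrite /normal_field mirrorK; have [-> ->] := bog_mirror c k.
rewrite conjcM conjcN conjc_i conjcD conjcN !conjcM !conjc_real conjcK opprK !(real_complexM _ (freq _ _)).
have := congr1 (fun x : R => x%:C) (bog_det c k).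
rewrite rmorphB !rmorphXn /=.
move: (z c k) (z c (2 * p - k)) (bog_a c k)%:C (bog_b c k)%:C => u v a b h.
rewrite -[Rcomplex R]/C in u v *.
transitivity ((a ^+ 2 - b ^+ 2) * (- 'i%C * ((freq c k)%:C * u))); first by ring.
by rewrite h mul1r.
Qed.

Lemma bog_normal z e k :
  (bog_a e k)%:C * (- 'i%C * ((freq e k)%:C * (z e k : C)))
  + (bog_b e k)%:C * conjc (- 'i%C * ((freq e (2 * p - k))%:C * (z e (2 * p - k) : C))) =
  - 'i%C * (normal_field z e k : C).
Proof.
rewrite /normal_field conjcM conjcN conjc_i conjcM conjc_real opprK !(real_complexM _ (freq _ _)).
move: (z e k) (z e (2 * p - k)) => u v; rewrite -[Rcomplex R]/C in u v *.
by ring.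
Qed.

Lemma is_derive_pairP (f : R -> R * R) (t : R) (l : R * R) :
  is_derive t (1 : R) f l <->
  is_derive t (1 : R) (fun e => (f e).1) l.1 /\ is_derive t (1 : R) (fun e => (f e).2) l.2.
Proof.
pose q (W : normedModType R) (h : R -> W) := fun e : R => e^-1 *: ((h \o shift t) (e *: (1 : R)) - h t).
have E (W : normedModType R) (h : R -> W) (w : W) :
    is_derive t (1 : R) h w <-> q W h @ 0^' --> w.
  split=> [[dh <-]|cv]; first exact: dh.
  by split; [apply/cvg_ex; exists w | exact: cvg_lim].
split=> [/E cv|[/E c1 /E c2]].
  split; apply/E.
    have := cvg_comp _ _ cv (@cvg_fst _ _ _ _ _); exact.
  have := cvg_comp _ _ cv (@cvg_snd _ _ _ _ _); exact.
apply/E; case: l c1 c2 => l1 l2 /= c1 c2.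
have := cvg_pair c1 c2; exact.
Qed.

Lemma frame0B y y' : frame0 (y - y') = frame0 y - frame0 y'.
Proof. by have := frame0_linear (-1) y' y; rewrite !scaleN1r !(addrC (- _)). Qed.

Lemma ncoord_spaceB y y' : ncoord_space s p y -> ncoord_space s p y' ->
  ncoord_space s p (y - y').
Proof.
by move=> hy hy'; have := ncoord_space_linear (-1) hy' hy; rewrite scaleN1r addrC.
Qed.

Lemma is_derive_sq_continuous (f : R -> R) (t l : R) : is_derive t (1 : R) f l ->
  forall e, 0 < e -> exists2 d, 0 < d & forall h, `|h| < d -> (f (t + h) - f t) ^+ 2 < e.
Proof.
move=> /is_derive_epsP /(_ 1 ltr01)[d d0 hd] e e0.
pose L := 1 + `|l|; have L1 : 1 <= L by rewrite lerDl.
have L2 : 0 < L ^+ 2 by rewrite exprn_gt0//; lra.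
exists (Num.min d (Num.min 1 (e / L ^+ 2))); first by rewrite !lt_min d0 ltr01 divr_gt0.
move=> h; rewrite !lt_min => /and3P[/hd h1 h2]; rewrite ltr_pdivlMr// => h3.
have h4 : `|f (t + h) - f t| <= L * `|h|.
  have := ler_normD (f (t + h) - f t - h * l) (h * l); rewrite subrK normrM /L; lra.
have h0 := normr_ge0 h.
rewrite -real_normK ?num_real//; apply: (@le_lt_trans _ _ ((L * `|h|) ^+ 2)).
  by rewrite lerXn2r ?nnegrE// (le_trans _ h4).
apply: le_lt_trans h3; rewrite exprMn mulrC ler_wpM2r ?(ltW L2)//.
by rewrite expr2 ler_piMr// ltW.
Qed.

Lemma frame0_continuous (y : R -> ncoord R) : (forall t, ncoord_space s p (y t)) ->
  phase_continuous s (fun t => nrm (y t)) ->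
  (forall t e, 0 < e -> exists2 d, 0 < d & forall h : R, `|h| < d -> fin_sq (y (t + h) - y t) < e) ->
  phase_continuous s (fun t => frame0 (y t)).
Proof.
move=> hy /phase_continuousP[_ hn] hf; apply/phase_continuousP; split.
  by move=> t; exact: phase_space_frame0.
have [M M0 hM] := frame0_bound.
move=> t e e0; have M1 : 0 < M + 1 by rewrite ltr_wpDl.
have q0 : 0 < e / (M + 1) / 2 by rewrite !divr_gt0.
have [d d0 hd] := hn t _ q0; have [d' d'0 hd'] := hf t _ q0.
exists (Num.min d d'); first by rewrite lt_min d0.
move=> h; rewrite lt_min => /andP[/hd h1 /hd' h2].
rewrite -frame0B; apply: le_lt_trans (hM _) _.
have hB := ncoord_spaceB (hy (t + h)) (hy t).
have fin := phase_sq_fin hB.1.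
have h3 : (ncoord_sq s (y (t + h) - y t)%R < (e / (M + 1))%:E)%E.
  rewrite /ncoord_sq -(fineK fin) -EFinD lte_fin.
  move: h1; rewrite -[nrm (y (t + h)) - _]/(nrm (y (t + h) - y t)) -(fineK fin) lte_fin.
  move: h2; rewrite /fin_sq; lra.
have nfin := ncoord_sq_fin hB.
move: h3; rewrite -(fineK nfin) -EFinM !lte_fin ltr_pdivlMr// => h3.
have n0 : 0 <= fine (ncoord_sq s (y (t + h) - y t)).
  by rewrite fine_ge0// (le_trans _ (fin_sq_le_ncoord _))// lee_fin fin_sq_ge0.
by nra.
Qed.

Lemma nrm_continuous (y : R -> ncoord R) : (forall t, ncoord_space s p (y t)) ->
  phase_continuous s (fun t => frame0 (y t)) -> phase_continuous s (fun t => nrm (y t)).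
Proof.
move=> hy /phase_continuousP[_ hn]; apply/phase_continuousP; split.
  by move=> t; have [] := hy t.
have [M M0 hM] := frame0_inv_bound.
move=> t e e0; have M1 : 0 < M + 1 by rewrite ltr_wpDl.
have [d d0 hd] := hn t (e / (M + 1)) (divr_gt0 e0 M1).
exists d => // h /hd; rewrite -frame0B => h1.
have hB := ncoord_spaceB (hy (t + h)) (hy t).
rewrite -[nrm (y (t + h)) - _]/(nrm (y (t + h) - y t)).
apply: le_lt_trans (nrm_le_ncoord _) _; rewrite -(frame0_invK hB).
apply: le_lt_trans (hM _) _.
have fin := phase_sq_fin (phase_space_frame0 hB).
move: h1; rewrite -(fineK fin) -EFinM !lte_fin ltr_pdivlMr// => h1.
have n0 : 0 <= fine (phase_sq s (frame0 (y (t + h) - y t))) by rewrite fine_ge0// phase_sq_ge0.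
by nra.
Qed.

Lemma is_derive_scale (f : R -> R) (t l a : R) : is_derive t (1 : R) f l ->
  is_derive t (1 : R) (fun e => a * f e) (a * l).
Proof.
move=> h; apply: (is_derive_eq (is_deriveM (is_derive_cst a t 1) h)).
by rewrite /GRing.scale /=; ring.
Qed.

Lemma is_derive_comb (f g : R -> R) (t l l' a b : R) : is_derive t (1 : R) f l ->
  is_derive t (1 : R) g l' -> is_derive t (1 : R) (fun e => a * f e + b * g e) (a * l + b * l').
Proof. by move=> hf hg; exact: (is_deriveD (is_derive_scale a hf) (is_derive_scale b hg)). Qed.

Lemma mulNi_real (x : R) : - 'i%C * x%:C = 0 +i* (- x) :> C.
Proof. by apply/eqP; rewrite eq_complex /=; apply/andP; split; apply/eqP; ring. Qed.

(** Apart from the continuity in norm, both systems are componentwise: at k =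
    p they are read on real and imaginary parts, elsewhere on the
    diagonalizing coordinates of the pair k, 2p - k. *)
Lemma normal_form_flow theta0 (y : R -> ncoord R) : (forall t, ncoord_space s p (y t)) ->
  normal_form_solution s p normal_matrix drift omega theta0 y <->
  phase_continuous s (fun t => frame0 (y t)) /\
  forall t c k, is_cderive (fun e => frame0 (y e) c k : C) t
    (- 'i%C * (linF p S (frame0 (y t)) c k : C)).
Proof.
move=> hy; split.
  move=> [_ hn ha hr hz].
  have hz' t c k : k != p -> is_cderive (fun e => nrm (y e) c k : C) t
      (- 'i%C * ((freq c k)%:C * (nrm (y t) c k : C))).
    move=> kp; have := hz t c k kp; rewrite block_apply_normal.
    by rewrite -[(nrm (drift _ _) c k : C)]/(0 : C) addr0.
  have ha' t := (is_derive_pairP _ _ _).1 (ha t).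
  have hr' t := (is_derive_pairP _ _ _).1 (hr t).
  split.
    apply: frame0_continuous => // t e e0.
    have e4 : 0 < e / 4 by rewrite divr_gt0.
    have [d1 d10 h1] := is_derive_sq_continuous (ha' t).1 e4.
    have [d2 d20 h2] := is_derive_sq_continuous (ha' t).2 e4.
    have [d3 d30 h3] := is_derive_sq_continuous (hr' t).1 e4.
    have [d4 d40 h4] := is_derive_sq_continuous (hr' t).2 e4.
    exists (Num.min (Num.min d1 d2) (Num.min d3 d4)); first by rewrite !lt_min d10 d20 d30 d40.
    move=> h; rewrite !lt_min => /andP[/andP[/h1 l1 /h2 l2] /andP[/h3 l3 /h4 l4]].
    rewrite /fin_sq -[(ang _).1]/((ang (y (t + h))).1 - (ang (y t)).1).
    rewrite -[(ang (_ - _)).2]/((ang (y (t + h))).2 - (ang (y t)).2).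
    rewrite -[(act (_ - _)).1]/((act (y (t + h))).1 - (act (y t)).1).
    rewrite -[(act (_ - _)).2]/((act (y (t + h))).2 - (act (y t)).2).
    lra.
  move=> t c k; have [->|kp] := eqVneq k p.
    rewrite linF_center// mulNi_real.
    have e0 e : central (y e) c = frame0 (y e) c p by rewrite frame0_center.
    apply: is_cderive_ext e0 _; split => /=.
      have := is_derive_comb (if c then - (mR false).2 / det / (2 * amp c) else (mR true).2 / det / (2 * amp c))
        (if c then (mR false).1 / det / (2 * amp c) else - (mR true).1 / det / (2 * amp c)) (hr' t).1 (hr' t).2.
      rewrite /= !mulr0 addr0; congr is_derive; apply/funext => e.
      by rewrite /dual; case: (c) => /=; ring.
    have := is_derive_comb (amp c * (mR c).1) (amp c * (mR c).2) (ha' t).1 (ha' t).2.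
    rewrite /drift /ang /=.
    have -> : amp c * (mR c).1 * (phase_drift (act (y t))).1 + amp c * (mR c).2 * (phase_drift (act (y t))).2
      = amp c * wind (m c) (phase_drift (act (y t))) by rewrite windE; ring.
    rewrite wind_solve [amp c * (_ / amp c)]mulrC mulfVK; last by rewrite gt_eqF.
    by congr is_derive; apply/funext => e; rewrite windE /=; ring.
  have kp' : 2 * p - k != p by rewrite mirror_eq.
  have e0 e : (mix (bog (nrm (y e))) c k : C) = frame0 (y e) c k by rewrite frame0_off.
  apply: is_cderive_ext e0 _; rewrite linF_off//.
  have db e : is_cderive (fun u => bog (nrm (y u)) e k : C) t (- 'i%C * (normal_field (nrm (y t)) e k : C)).
    rewrite -bog_normal; apply: is_cderiveD; apply: is_cderiveZ; first exact: hz'.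
    by apply: is_cderive_conj; exact: hz'.
  have := is_cderiveD (is_cderiveZ (Q false c)%:C (db false)) (is_cderiveZ (Q true c)%:C (db true)).
  by congr is_cderive; rewrite /mix; ring.
move=> [hc hd].
have off_derive t c k : k != p -> is_cderive (fun e => frame0 (y e) c k : C) t
    (- 'i%C * (mix (normal_field (nrm (y t))) c k : C)).
  by move=> kp; have := hd t c k; rewrite linF_off.
split=> //.
- exact: nrm_continuous.
- move=> t; apply/is_derive_pairP.
  have dI c := (hd t c p).2.
  have angE e : ang (y e) = solve (fun c => complex.Im (frame0 (y e) c p : C) / amp c).
    by rewrite -[in LHS](frame0_invK (hy e)).
  have fE : (fun e => (ang (y e)).1) = (fun e => (mR true).2 / det / amp false * complex.Im (frame0 (y e) false p : C)
       + - (mR false).2 / det / amp true * complex.Im (frame0 (y e) true p : C)).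
    by apply/funext => e; rewrite angE /solve /=; field; rewrite det_neq0 !gt_eqF.
  have fE' : (fun e => (ang (y e)).2) = (fun e => - (mR true).1 / det / amp false * complex.Im (frame0 (y e) false p : C)
       + (mR false).1 / det / amp true * complex.Im (frame0 (y e) true p : C)).
    by apply/funext => e; rewrite angE /solve /=; field; rewrite det_neq0 !gt_eqF.
  have imE (c : bool) : complex.Im (- 'i%C * (linF p S (frame0 (y t)) c p : C)) =
      - (2 * (S c false * radial (act (y t)) false + S c true * radial (act (y t)) true)).
    by rewrite linF_center// mulNi_real.
  rewrite fE fE'; split.
    apply: (is_derive_eq (is_derive_comb _ _ (dI false) (dI true))).
    by rewrite !imE /drift /ang /= /phase_drift /solve /=; field; rewrite det_neq0 !gt_eqF.
  apply: (is_derive_eq (is_derive_comb _ _ (dI false) (dI true))).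
  by rewrite !imE /drift /ang /= /phase_drift /solve /=; field; rewrite det_neq0 !gt_eqF.
- move=> t; apply/is_derive_pairP.
  have dR c := (hd t c p).1.
  have actE e : act (y e) = undual (fun c => 2 * amp c * complex.Re (frame0 (y e) c p : C)).
    by rewrite -[in LHS](frame0_invK (hy e)).
  have reE (c : bool) : complex.Re (- 'i%C * (linF p S (frame0 (y t)) c p : C)) = 0.
    by rewrite linF_center// mulNi_real.
  have fE : (fun e => (act (y e)).1) = (fun e => (mR false).1 * (2 * amp false) * complex.Re (frame0 (y e) false p : C)
       + (mR true).1 * (2 * amp true) * complex.Re (frame0 (y e) true p : C)).
    by apply/funext => e; rewrite actE /undual /=; ring.
  have fE' : (fun e => (act (y e)).2) = (fun e => (mR false).2 * (2 * amp false) * complex.Re (frame0 (y e) false p : C)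
       + (mR true).2 * (2 * amp true) * complex.Re (frame0 (y e) true p : C)).
    by apply/funext => e; rewrite actE /undual /=; ring.
  rewrite fE fE'; split;
    by apply: (is_derive_eq (is_derive_comb _ _ (dR false) (dR true))); rewrite !reE !mulr0 addr0.
- move=> t c k kp; have kp' : 2 * p - k != p by rewrite mirror_eq.
  rewrite block_apply_normal -[(nrm (drift _ _) c k : C)]/(0 : C) addr0.
  have e0 e : (unbog (unmix (frame0 (y e))) c k : C) = nrm (y e) c k.
    by rewrite -{2}(frame0_invK (hy e)) /frame0_inv /nrm /= (negbTE kp).
  apply: is_cderive_ext e0 _; rewrite -normal_field_unbog.
  have du l : l != p -> is_cderive (fun e => unmix (frame0 (y e)) c l : C) t
      (- 'i%C * (normal_field (nrm (y t)) c l : C)).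
    move=> lp; have := is_cderiveD (is_cderiveZ (Q c false)%:C (off_derive t false l lp))
      (is_cderiveZ (Q c true)%:C (off_derive t true l lp)).
    congr is_cderive; rewrite -(unmix_mix (normal_field (nrm (y t))) c l) /unmix.
    move: (mix _ false l) (mix _ true l) => u v; rewrite -[Rcomplex R]/C in u v *.
    by ring.
  have := is_cderiveD (is_cderiveZ (bog_a c k)%:C (du k kp))
    (is_cderiveZ (- (bog_b c k)%:C) (is_cderive_conj (du _ kp'))).
  rewrite !mulNr; apply: is_cderive_ext => e.
  by rewrite /unbog mulNr.
Qed.

(** The rotation by the phases of the torus, composed with the constant frame. *)
Definition frame (theta : R * R) y : phase R :=
  rotate (fun c => wind (m c) theta) (frame0 y).

Lemma rotate_linear al (e : R) w w' :
  rotate al (e *: w + w') = e *: rotate al w + rotate al w'.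
Proof.
apply/funext => c; apply/funext => k.
rewrite -[RHS]/((e *: rotate al w c) k + rotate al w' c k) modes_scaleE.
rewrite -[LHS]/(expi (al c) * (((e *: w c) k : C) + (w' c k : C))) modes_scaleE /rotate.
by move: (w c k) (w' c k) => u v; rewrite -[Rcomplex R]/C in u v *; ring.
Qed.

Lemma rotateNK al w : rotate al (rotate (fun c => - al c) w) = w.
Proof.
apply/funext => c; apply/funext => k.
by rewrite /rotate mulrA expiMN mul1r.
Qed.

Lemma frame_tangent theta (phi : R * R) c k :
  is_cderive (fun e => plane_wave p amp m (line theta phi e) c k : C) 0
    (frame theta (phi, (0, 0), 0) c k).
Proof.
rewrite /plane_wave; have [->|kp] := eqVneq k p; last first.
  rewrite /frame /rotate frame0_off// /mix /bog -![nrm _ _ _]/(0 : C).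
  by rewrite conjc0 !mulr0 addr0 !mulr0 addr0 mulr0; exact: is_cderive_cst.
rewrite /frame /rotate frame0_center; last exact: ncoord_space_pair.
have -> : central (phi, (0, 0), 0) c = 'i%C * (wind (m c) phi)%:C * (amp c)%:C.
  have d0 : dual c (0, 0) = 0 by rewrite /dual; case: (c); rewrite /= !mulr0 subr0 mul0r.
  rewrite /central /act /ang /= d0 mul0r.
  by apply/eqP; rewrite eq_complex /=; apply/andP; split; apply/eqP; ring.
have := is_cderiveM (is_cderive_expi (wind (m c) phi) (wind (m c) theta) 0)
  (is_cderive_cst (amp c)%:C 0).
rewrite mul0r addr0 mulr0 addr0.
have -> : 'i%C * (wind (m c) phi)%:C * expi (wind (m c) theta) * (amp c)%:C =
  expi (wind (m c) theta) * ('i%C * (wind (m c) phi)%:C * (amp c)%:C) by ring.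
by apply: is_cderive_ext => e; rewrite wind_line.
Qed.

Lemma frame_adapted : exists2 M : R, 0 <= M & forall M', M <= M' ->
  adapted_frame s p M' (plane_wave p amp m) frame.
Proof.
have [M1 M10 hM1] := frame0_bound; have [M2 M20 hM2] := frame0_inv_bound.
exists (M1 + M2) => [|M' hM']; first by rewrite addr_ge0.
have l1 : M1 <= M' by apply: le_trans hM'; rewrite lerDl.
have l2 : M2 <= M' by apply: le_trans hM'; rewrite lerDr.
split.
- move=> theta; split.
  + by move=> e y y' _ _; rewrite /frame frame0_linear rotate_linear.
  + move=> y hy; rewrite /frame phase_sq_rotate; split.
      apply: le_trans (hM1 y) _; rewrite lee_wpmul2r ?lee_fin//.
      by apply: le_trans (fin_sq_le_ncoord y); rewrite lee_fin fin_sq_ge0.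
    rewrite -{1}(frame0_invK hy); apply: le_trans (hM2 _) _.
    by rewrite lee_wpmul2r ?lee_fin ?phase_sq_ge0.
  + move=> w hw; exists (frame0_inv (rotate (fun c => - wind (m c) theta) w)).
      by apply: ncoord_space_frame0_inv; exact: phase_space_rotate.
    rewrite /frame (_ : frame0 _ = rotate (fun c => - wind (m c) theta) w) ?rotateNK//.
    by apply/funext => c; apply/funext => k; exact: frame0K.
  + by move=> y y' hy hy'; exact: symplectic_frame0.
- move=> y c hy; apply: torus_analytic_wind; exact: phase_space_frame0.
- by move=> theta phi c k; exact: frame_tangent.
Qed.

Variables (g : ('I_4 -> complex R) -> complex R) (P : bool -> R).
Hypothesis dnonlinearityE : forall c a b (w z : C),
  dnonlinearity g c (expi a * (amp false)%:C) (expi b * (amp true)%:C)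
    (expi a * w) (expi b * z) =
  expi (if c then b else a) * ((P c)%:C * (if c then z else w)
    + (2 * S c false * complex.Re w + 2 * S c true * complex.Re z)%:C).
Hypothesis omegaE : forall c, wind (m c) omega = - (p%:~R ^+ 2 + P c).

Lemma plane_wave_linearly_stable :
  linearly_stable s p g (plane_wave p amp m) omega.
Proof.
have [M1 M10 hM1] := frame_adapted; have [M2 M20 hM2] := drift_coupling.
exists (M1 + M2), frame, drift, normal_matrix; split.
- by apply: hM1; rewrite lerDl.
- by apply: hM2; rewrite lerDr.
- exact: normal_matrix_hermitian.
- exact: normal_matrix_block_diagonal.
- move=> theta0 y hy; apply: iff_trans (normal_form_flow theta0 hy) _.
  exact: iff_sym (linearized_rotating s_gt dnonlinearityE omegaE theta0 (fun t => frame0 (y t))).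
Qed.

End Frame.

(** * Diagonalization of the coupling *)

Section SymmetricMatrix.
Variable R : realType.

(** A real symmetric matrix of size 2 is diagonalized by the rotation whose
    angle makes the off-diagonal entry vanish; that entry changes sign on
    [0, pi/2]. *)
Lemma orthogonal_diagonalization (S : bool -> bool -> R) (t : R) :
  S true false = S false true -> (forall c d, `|S c d| <= t) ->
  exists (Q : bool -> bool -> R) (lam : bool -> R),
    [/\ forall c c', Q c false * Q c' false + Q c true * Q c' true = (c == c')%:R,
        forall d d', Q false d * Q false d' + Q true d * Q true d' = (d == d')%:R,
        forall c e, S c false * Q e false + S c true * Q e true = lam e * Q e c &
        forall e, `|lam e| <= 2 * t].
Proof.
move=> Ssym St.
pose a := S false false; pose b := S false true; pose d := S true true.
pose f (x : R) := b * (cos x * cos x - sin x * sin x) + (d - a) * (cos x * sin x).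
have fc : {within `[0, pi / 2], continuous f}.
  apply: continuous_subspaceT => x; apply: cvgD.
    by apply: cvgMr; apply: cvgB; apply: cvgM; (exact: continuous_cos || exact: continuous_sin).
  by apply: cvgMr; apply: cvgM; [exact: continuous_cos|exact: continuous_sin].
have pi2 : 0 <= pi / 2 :> R by rewrite divr_ge0 ?pi_ge0.
have f0 : f 0 = b by rewrite /f cos0 sin0; ring.
have f1 : f (pi / 2) = - b by rewrite /f cos_pihalf sin_pihalf; ring.
have mid : Num.min (f 0) (f (pi / 2)) <= 0 <= Num.max (f 0) (f (pi / 2)).
  by rewrite f0 f1 ge_min le_max; case: (leP b 0) => hb; apply/andP; split; apply/orP;
    [left|right|right|left]; lra.
have [x _ fx] := IVT pi2 fc mid.
have cs := cos2Dsin2 x.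
move: fx; rewrite /f -!expr2; move: (cos x) (sin x) cs => c s cs h {f fc f0 f1 mid}.
have [ha [hb hd]] : `|a| <= t /\ `|b| <= t /\ `|d| <= t by rewrite !St.
have Sft : S true false = b by rewrite Ssym.
exists (fun e k => if e then (if k then c else - s) else (if k then s else c)),
  (fun e => if e then a * s ^+ 2 - 2 * b * c * s + d * c ^+ 2
            else a * c ^+ 2 + 2 * b * c * s + d * s ^+ 2).
have cs1 : c ^+ 2 = 1 - s ^+ 2 by rewrite -cs; ring.
split.
- by case; case => /=; nra.
- by case; case => /=; nra.
- case; case => /=; rewrite -?/a -?/b -?/d ?Sft.
  + have : (b * (- s) + d * c) * 1 - (a * s ^+ 2 - 2 * b * c * s + d * c ^+ 2) * c =
      s * (b * (c ^+ 2 - s ^+ 2) + (d - a) * (c * s)) + (b * (- s) + d * c) * (1 - (c ^+ 2 + s ^+ 2)) by ring.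
    by rewrite cs h subrr; lra.
  + have : (b * c + d * s) * 1 - (a * c ^+ 2 + 2 * b * c * s + d * s ^+ 2) * s =
      c * (b * (c ^+ 2 - s ^+ 2) + (d - a) * (c * s)) + (b * c + d * s) * (1 - (c ^+ 2 + s ^+ 2)) by ring.
    by rewrite cs h subrr; lra.
  + have : (a * (- s) + b * c) * 1 - (a * s ^+ 2 - 2 * b * c * s + d * c ^+ 2) * (- s) =
      c * (b * (c ^+ 2 - s ^+ 2) + (d - a) * (c * s)) + (a * (- s) + b * c) * (1 - (c ^+ 2 + s ^+ 2)) by ring.
    by rewrite cs h subrr; lra.
  + have : (a * c + b * s) * 1 - (a * c ^+ 2 + 2 * b * c * s + d * s ^+ 2) * c =
      - s * (b * (c ^+ 2 - s ^+ 2) + (d - a) * (c * s)) + (a * c + b * s) * (1 - (c ^+ 2 + s ^+ 2)) by ring.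
    by rewrite cs h subrr; lra.
- have t0 : 0 <= t by exact: le_trans ha.
  move: ha hb hd; rewrite !ler_norml => /andP[a1 a2] /andP[b1 b2] /andP[d1 d2].
  have c2 := sqr_ge0 c; have s2 := sqr_ge0 s.
  have p1 := sqr_ge0 (c + s); have p2 := sqr_ge0 (c - s).
  have B1 u r : - t <= u -> u <= t -> 0 <= r -> - (t * r) <= u * r <= t * r.
    by move=> u1 u2 r0; apply/andP; split; nra.
  have /andP[x1 x2] := B1 _ _ b1 b2 p1; have /andP[y1 y2] := B1 _ _ b1 b2 p2.
  have /andP[z1 z2] := B1 _ _ a1 a2 c2; have /andP[w1 w2] := B1 _ _ a1 a2 s2.
  have /andP[z3 z4] := B1 _ _ d1 d2 c2; have /andP[w3 w4] := B1 _ _ d1 d2 s2.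
  have tcs : t * c ^+ 2 + t * s ^+ 2 = t by rewrite -mulrDr cs mulr1.
  have e1 : b * (c + s) ^+ 2 - b * (c - s) ^+ 2 = 4 * b * c * s by ring.
  have e2 : t * (c + s) ^+ 2 + t * (c - s) ^+ 2 = 2 * t by rewrite -{3}tcs; ring.
  by case; rewrite ler_norml; apply/andP; split; lra.
Qed.

End SymmetricMatrix.

(** * Choice of the winding numbers *)

Section WindingNumbers.
Variable R : realType.
Implicit Types (omega : R * R) (n : int).

(** The frequencies that a torus carries are fixed only up to the choice of
    its angles: when e0 and e1 differ, the two numbers are combinations
    delta.1 + n (delta.1 - delta.2) of an arbitrarily small delta, with
    n large. *)
Lemma small_detuning (e0 e1 tau : R) : e0 != e1 -> 0 < tau ->
  exists (n n' : int) (delta : R * R),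
    [/\ n != n', `|delta.1| <= tau, `|delta.2| <= tau,
        e0 = delta.1 + n%:~R * (delta.1 - delta.2) &
        e1 = delta.1 + n'%:~R * (delta.1 - delta.2)].
Proof.
move=> e01 tau0.
(* q steps of length d lead from e0 to e1, and e0 lies within d of a
   multiple of d *)
pose q := (Num.truncn (`|e0 - e1| / (tau / 2))).+1.
have q0 : 0 < q%:R :> R by rewrite ltr0n.
pose d := (e0 - e1) / q%:R.
have d0 : d != 0 by rewrite mulf_neq0 ?subr_eq0// invr_neq0// gt_eqF.
have dtau : `|d| <= tau / 2.
  rewrite /d normrM normfV (gtr0_norm q0) ler_pdivrMr// mulrC -ler_pdivrMr ?divr_gt0//.
  by rewrite ltW// truncnS_gt.
have dE : q%:R * d = e0 - e1 by rewrite /d mulrCA divff ?mulr1// gt_eqF.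
pose n : int := Num.floor (e0 / d).
have n1 : n%:~R <= e0 / d by exact: floor_le_tmp.
have n2 : e0 / d < n%:~R + 1 by rewrite -[1]/(1%:~R) -intrD floorD1_gt.
have e0E : e0 = (e0 / d) * d by rewrite divfK.
have h1 : `|e0 - n%:~R * d| <= `|d|.
  by rewrite {1}e0E -mulrBl normrM ler_piMl// ger0_norm; lra.
exists n, (n - q%:Z), (e0 - n%:~R * d, e0 - n%:~R * d - d); split=> /=.
- by rewrite -subr_eq0 opprB addrC subrK.
- by apply: le_trans h1 _; lra.
- by have := ler_normB (e0 - n%:~R * d) d; lra.
- by ring.
- rewrite intrB -[q%:Z%:~R]pmulrn.
  transitivity (e0 - q%:R * d); first by rewrite dE; ring.
  by move: (q%:R) (n%:~R) => Q x; ring.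
Qed.

(** A resonance of [omega] would give one of the two frequencies of the wave,
    through the adjugate of the matrix of winding numbers. *)
Lemma nonresonant_winding n n' omega : n != n' ->
  nonresonant (- wind (-1 - n, n) omega, - wind (-1 - n', n') omega) ->
  nonresonant omega.
Proof.
move=> nn' h k1 k2 k0; apply/eqP => hk.
have /h : (- k2 - n' * (k1 + k2), k2 + n * (k1 + k2)) != (0, 0).
  apply: contra k0; rewrite !xpair_eqE => /andP[/eqP h1 /eqP h2].
  have : (n - n') * (k1 + k2) == 0.
    have -> : (n - n') * (k1 + k2) = (- k2 - n' * (k1 + k2)) + (k2 + n * (k1 + k2)) by ring.
    by rewrite h1 h2.
  rewrite mulf_eq0 subr_eq0 (negbTE nn') /= => /eqP h3.
  by move: h1; rewrite h3 mulr0 subr0 => /eqP; rewrite oppr_eq0 => /eqP k20; move: h3; rewrite k20 addr0 => ->; rewrite !eqxx.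
rewrite /wind /= !(intrD, intrB, intrM, intrN) => /eqP; apply.
transitivity ((n%:~R - n'%:~R) * (omega.1 * k1%:~R + omega.2 * k2%:~R)); first by ring.
by rewrite hk mulr0.
Qed.

End WindingNumbers.

(** * Plane waves solve the system *)

Section PlaneWaveSolutions.
Variables (R : realType) (s : R) (p : int) (amp : bool -> R) (m : bool -> int * int).
Local Notation C := R[i].
Hypothesis amp_gt0 : forall c, 0 < amp c.

Lemma plane_wave_analytic c : torus_analytic s (fun theta => plane_wave p amp m theta c).
Proof.
pose e k : C := if k == p then (amp c)%:C else 0.
have he : ell2 s (e : modes R).
  by apply: (@ell2_single _ _ p) => k /negbTE kp; rewrite /e kp.
have := torus_analytic_wind (m c) he.
congr (torus_analytic s); apply/funext => theta; apply/funext => k.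
by rewrite /plane_wave /e; case: ifP => // _; rewrite mulr0.
Qed.

Lemma plane_wave_distance theta c :
  mode_distance s p (amp c) (plane_wave p amp m theta c) = 0%E.
Proof.
rewrite /mode_distance /plane_wave eqxx modulusM modulus_expi mul1r modulus_real.
rewrite gtr0_norm// subrr expr0n /= add0e; apply: esum1 => k /= /negbTE kp.
by rewrite kp -[(0 : Rcomplex R)]/(0 : C) modulus0 expr0n mulr0.
Qed.

(** A wave e^(i (p x + t wind)) is multiplied by - wind - p^2 under i d_t +
    d_xx, and by the potential under the nonlinearity. *)
Lemma plane_wave_solves (D : set ('I_4 -> C)) (g : ('I_4 -> C) -> C)
    (omega : R * R) (P : bool -> R) :
  (forall a b, D (diag4 (expi a * (amp false)%:C) (expi b * (amp true)%:C))) ->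
  (forall c a b, nonlinearity g c (expi a * (amp false)%:C) (expi b * (amp true)%:C) =
     expi (if c then b else a) * (P c * amp c)%:C) ->
  (forall c, wind (m c) omega = - (p%:~R ^+ 2 + P c)) ->
  solves_system D g
    (fun t x => fourier (plane_wave p amp m (line (0, 0) omega t) false) x)
    (fun t x => fourier (plane_wave p amp m (line (0, 0) omega t) true) x).
Proof.
move=> hD hN hom.
pose ph c (t x : R) := t * wind (m c) omega + p%:~R * x.
pose u c (t x : R) : C := expi (ph c t x) * (amp c)%:C.
have uE c : (fun t x => fourier (plane_wave p amp m (line (0, 0) omega t) c) x) = u c.
  apply/funext => t'; apply/funext => x'; rewrite fourier_plane_wave /u /ph wind_line.
  by rewrite {1}/wind /= !mul0r !add0r.
rewrite (uE false) (uE true) => t x.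
split; first exact: hD.
pose k c : C := 'i%C * (wind (m c) omega)%:C; pose l : C := 'i%C * (p%:~R)%:C.
have dt c : is_cderive (fun y => u c y x) t (k c * u c t x).
  have := is_cderiveM (is_cderive_expi (wind (m c) omega) (p%:~R * x) t)
    (is_cderive_cst (amp c)%:C t).
  rewrite mulr0 addr0 -mulrA [p%:~R * x + _]addrC.
  by apply: is_cderive_ext => y; rewrite /u /ph addrC.
have dx c y : is_cderive (u c t) y (l * u c t y).
  have := is_cderiveM (is_cderive_expi p%:~R (t * wind (m c) omega) y)
    (is_cderive_cst (amp c)%:C y).
  rewrite mulr0 addr0 -mulrA [y * _]mulrC.
  by apply: is_cderive_ext => z; rewrite /u /ph [z * _]mulrC.
have dxx c : is_cderive2 (u c t) x (l * (l * u c t x)).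
  have H y : is_cderive (fun y => l * u c t y) y (l * (l * u c t y)) := is_cderiveZ l (dx c y).
  by exists (fun y => l * u c t y); split; [exact: dx | exact: H].
have i2 : 'i%C * 'i%C = -1 :> C by rewrite -expr2 sqr_i.
have eqn c : 'i%C * (k c * u c t x) + l * (l * u c t x) = (P c)%:C * u c t x.
  transitivity (('i%C * 'i%C) * ((wind (m c) omega)%:C + (p%:~R)%:C ^+ 2) * u c t x).
    by rewrite /k /l; ring.
  by rewrite i2 hom; move: (u c t x) => v; rewrite rmorphN rmorphD rmorphXn; ring.
exists (k false * u false t x), (l * (l * u false t x)),
  (k true * u true t x), (l * (l * u true t x)).
by split; [split | rewrite !eqn /u !hN; split; rewrite rmorphM; ring].
Qed.

End PlaneWaveSolutions.

Section Linearization.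
Variables (R : realType) (g : ('I_4 -> complex R) -> complex R) (x y : R)
  (n : bool -> R) (A : bool -> bool -> R).
Local Notation C := R[i].
Hypotheses (x0 : 0 < x) (y0 : 0 < y).
Hypothesis dbarE : forall b a a', dbar g b (expi a * x%:C) (expi a' * y%:C) =
  expi (if b then a' else a) * (n b)%:C.
Hypothesis dbar_lin : forall b a a' (w z : C), is_cderive (fun e : R =>
    dbar g b (expi a * x%:C + e%:C * (expi a * w))
             (expi a' * y%:C + e%:C * (expi a' * z))) 0
  (expi (if b then a' else a) *
    ((n b / (if b then y else x))%:C * (if b then z else w)
     + ((A b b - n b / (if b then y else x))
        * complex.Re (if b then z else w))%:C
     + (A b (~~ b) * complex.Re (if b then w else z))%:C)).

(** The frequency of the wave is p^2 + [potential]. *)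
Definition potential c : R := if c then x ^+ 2 + n true / y else y ^+ 2 + n false / x.
(** Half the Jacobian of the amplitudes of the nonlinearity in the two moduli,
    less the potential on the diagonal, which acts as a rotation of the
    phases. *)
Definition hessian c d : R :=
  if c == d then (A c c - n c / (if c then y else x)) / 2 else x * y + A c d / 2.

Lemma modulus_sqC (z : C) : (modulus z ^+ 2)%:C = z * conjc z.
Proof.
by rewrite modulus_sq; case: z => a b; apply/eqP; rewrite eq_complex /=; apply/andP; split; apply/eqP; ring.
Qed.

Lemma nonlinearityE c (u v : C) : nonlinearity g c u v =
  (if c then (u * conjc u) * v else (v * conjc v) * u) + dbar g c u v.
Proof. by rewrite /nonlinearity /dbar; case: c; rewrite modulus_sqC. Qed.

Lemma nonlinearity_wave c a b :
  nonlinearity g c (expi a * x%:C) (expi b * y%:C) =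
  expi (if c then b else a) * (potential c * (if c then y else x))%:C.
Proof.
have conjE (r t : R) : expi r * t%:C * conjc (expi r * t%:C) = (t ^+ 2)%:C.
  by rewrite -modulus_sqC modulusM modulus_expi mul1r modulus_real real_normK ?num_real.
rewrite nonlinearityE dbarE !conjE /potential.
case: c; rewrite -mulrCA -mulrDr -?rmorphM -?rmorphD; congr (_ * _%:C); field;
  by rewrite gt_eqF.
Qed.

(** In the frame rotating with the wave the linearized nonlinearity is the
    real multiplication by the potential plus a coupling of the real parts of
    the perturbation. *)
Lemma dnonlinearity_wave c a b (w z : C) :
  dnonlinearity g c (expi a * x%:C) (expi b * y%:C) (expi a * w) (expi b * z) =
  expi (if c then b else a) * ((potential c)%:C * (if c then z else w)
    + (2 * hessian c false * complex.Re w + 2 * hessian c true * complex.Re z)%:C).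
Proof.
apply: cderiveE.
have path (r t : R) (v : C) := is_cderive_path (expi r * t%:C) (expi r * v) 0.
have p0 (r t : R) (v : C) : expi r * t%:C + 0%:C * (expi r * v) = expi r * t%:C by rewrite mul0r addr0.
have sq (r t : R) (v : C) := is_cderiveM (path r t v) (is_cderive_conj (path r t v)).
have reE (v : C) : conjc v = (2 * complex.Re v)%:C - v.
  by case: v => v1 v2; apply/eqP; rewrite eq_complex /=; apply/andP; split; apply/eqP; ring.
have conjt (t : R) : conjc t%:C = t%:C by rewrite /= oppr0.
have eN (r : R) : expi r * expi (- r) = 1 by rewrite mulrC expiNM.
have h2 b' c' : 2 * hessian b' c' = if b' == c' then A b' b' - n b' / (if b' then y else x)
    else 2 * x * y + A b' c'.
  by rewrite /hessian; move: (n b' / _) => q; case: (b' == c'); field.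
case: c.
  have := is_cderiveD (is_cderiveM (sq a x w) (path b y z)) (dbar_lin true a b w z).
  move=> /(is_cderive_ext (fun e => esym (nonlinearityE true _ _))).
  congr is_cderive; rewrite !p0 !conjcM !conj_expi conjt !h2 /potential /= reE.
  move: (eN a) (n true / y); move: (expi a) (expi (- a)) (expi b) => u u' v uu q.
  rewrite !(real_complexM, real_complexD, real_complexN).
  transitivity ((u * u') * (v * (x%:C * (2%:C * (complex.Re w)%:C) * y%:C + x%:C * x%:C * z))
    + v * (q%:C * z + (A true true)%:C * (complex.Re z)%:C - q%:C * (complex.Re z)%:C
       + (A true false)%:C * (complex.Re w)%:C)); first by ring.
  by rewrite uu mul1r; ring.
have := is_cderiveD (is_cderiveM (sq b y z) (path a x w)) (dbar_lin false a b w z).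
move=> /(is_cderive_ext (fun e => esym (nonlinearityE false _ _))).
congr is_cderive; rewrite !p0 !conjcM !conj_expi conjt !h2 /potential /= reE.
move: (eN b) (n false / x); move: (expi b) (expi (- b)) (expi a) => u u' v uu q.
rewrite !(real_complexM, real_complexD, real_complexN).
transitivity ((u * u') * (v * (y%:C * (2%:C * (complex.Re z)%:C) * x%:C + y%:C * y%:C * w))
  + v * (q%:C * w + (A false false)%:C * (complex.Re w)%:C - q%:C * (complex.Re w)%:C
     + (A false true)%:C * (complex.Re z)%:C)); first by ring.
by rewrite uu mul1r; ring.
Qed.

End Linearization.

(** * Waves of small amplitude *)

Section SmallWaves.
Variables (R : realType) (mu x y K : R) (n : bool -> R) (A : bool -> bool -> R).
Hypotheses (mu0 : 0 < mu) (mu8 : mu <= 1 / 8) (K0 : 0 <= K) (Kmu : 192 * K * mu <= 1).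
Hypotheses (xmu : mu <= x <= 2 * mu) (ymu : mu <= y <= 2 * mu).
Hypothesis n_small : forall b, `|n b| <= K * (2 * mu) ^+ 4.
Hypothesis A_small : forall b d, `|A b d| <= K * (2 * mu) ^+ 3.

(** The cubic coupling contributes at most 4 mu^2, and the terms that come
    from g are O(mu^3). *)
Lemma hessian_small c d : `|hessian x y n A c d| <= 1 / 8.
Proof.
have mu2 : mu ^+ 2 <= 1 / 64.
  have -> : 1 / 64 = (1 / 8) ^+ 2 :> R by field.
  by rewrite ler_pXn2r ?nnegrE ?(ltW mu0) ?divr_ge0.
have mu20 := sqr_ge0 mu.
have k3 : 192 * (K * mu ^+ 3) <= 1 / 64.
  have -> : 192 * (K * mu ^+ 3) = 192 * K * mu * mu ^+ 2 by ring.
  by apply: le_trans mu2; rewrite ler_piMl.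
have m3 : 0 <= K * mu ^+ 3 by rewrite mulr_ge0 // exprn_ge0 // ltW.
have hA b e : `|A b e| <= 8 * (K * mu ^+ 3).
  by apply: le_trans (A_small b e) _; rewrite exprMn; lra.
have hn b : `|n b / (if b then y else x)| <= 16 * (K * mu ^+ 3).
  have [X0 Xmu] : 0 < (if b then y else x) /\ mu <= (if b then y else x).
    case/andP: xmu => x1 _; case/andP: ymu => y1 _.
    by case: b; split=> //; exact: lt_le_trans mu0 _.
  rewrite normrM normfV (gtr0_norm X0) ler_pdivrMr//.
  apply: le_trans (n_small b) _.
  have -> : K * (2 * mu) ^+ 4 = 16 * (K * mu ^+ 3) * mu by ring.
  by rewrite ler_wpM2l// mulr_ge0.
rewrite /hessian; case: eqP => _.
  by have := ler_normB (A c c) (n c / (if c then y else x)); rewrite (normrM _ 2^-1) (ger0_norm (x := 2^-1))//; have := hA c c; have := hn c; lra.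
have hxy : `|x * y| <= 4 * mu ^+ 2.
  move: xmu ymu => /andP[x1 x2] /andP[y1 y2]; rewrite ger0_norm; last by rewrite mulr_ge0//; lra.
  have -> : 4 * mu ^+ 2 = (2 * mu) * (2 * mu) by ring.
  by rewrite ler_pM//; lra.
by have := ler_normD (x * y) (A c d / 2); rewrite (normrM _ 2^-1) (ger0_norm (x := 2^-1))//; have := hA c d; lra.
Qed.

End SmallWaves.

Theorem corollary4p9 (R : realType) (p : int) (s : R)
    (D : set ('I_4 -> complex R)) (g : ('I_4 -> complex R) -> complex R)
    (s_gt : 1 / 2 < s) (g_adm : admissible D g) :
  exists (nu0 K : R) (Cnu : R -> set (measurableTypeR R * measurableTypeR R)),
    [/\ 0 < nu0,
        (fun nu : R => area (square12 R `\` Cnu nu)) @ 0^'+ --> 0%E &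
        forall nu : R, 0 < nu -> nu < nu0 ->
          [/\ measurable (Cnu nu),
              Cnu nu `<=` square12 R &
              forall rho : R * R, Cnu nu rho ->
                exists (U V : R * R -> modes R) (omega : R * R),
                  [/\ torus_analytic s U /\ torus_analytic s V,
                      solves_system D g
                        (fun t x => fourier (U (line (0, 0) omega t)) x)
                        (fun t x => fourier (V (line (0, 0) omega t)) x),
                      forall theta : R * R,
                        (mode_distance s p (Num.sqrt (nu * rho.1)) (U theta)
                           <= (K * nu ^+ 3)%:E)%E /\
                        (mode_distance s p (Num.sqrt (nu * rho.2)) (V theta)
                           <= (K * nu ^+ 3)%:E)%E,
                      nonresonant omega /\
                      (`|omega.1 - (p%:~R) ^+ 2| <= K * nu `^ (3 / 2) /\
                       `|omega.2 - (p%:~R) ^+ 2| <= K * nu `^ (3 / 2)) &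
                      linearly_stable s p g (torus_map U V) omega]]].
Proof.
have [r [K [N [A [r0 K0 HN]]]]] := nonlinearity_structure g_adm.
have dN b x y : 0 < x < r -> 0 < y < r ->
    is_derive x (1 : R) (N b ^~ y) (A b false x y) /\
    is_derive y (1 : R) (N b x) (A b true x y).
  by move=> hx hy; have [_ _ h _ _] := HN x y hx hy.
have small b d x y t : 0 < x < r -> 0 < y < r -> x <= t -> y <= t -> t < r ->
    `|N b x y| <= K * t ^+ 4 /\ `|A b d x y| <= K * t ^+ 3.
  by move=> hx hy; have [_ _ _ [_ h] _] := HN x y hx hy; exact: h.
(* bounds on sqrt nu: the wave stays in the domain of g, the coupling is
   at most 1/8, and the frequency map keeps its twist *)
pose m0 := Num.min (r / 2) (Num.min (1 / 8) (1 / (192 * (K + 1)))).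
have K1 : 0 < 192 * (K + 1).
  by apply: mulr_gt0; [rewrite ltr0n | exact: ltr_wpDl].
have m00 : 0 < m0.
  by rewrite !lt_min; apply/and3P; split; apply: divr_gt0; rewrite ?ltr01 ?ltr0n.
have sqrt_small nu : 0 < nu -> nu < m0 ^+ 2 ->
    [/\ 0 < Num.sqrt nu, 2 * Num.sqrt nu < r, Num.sqrt nu <= 1 / 8 &
        192 * K * Num.sqrt nu <= 1].
  move=> nu0 num; have mu0 : 0 < Num.sqrt nu by rewrite sqrtr_gt0.
  have : Num.sqrt nu < m0.
    by rewrite -(ger0_norm (ltW m00)) -sqrtr_sqr ltr_sqrt// exprn_gt0.
  rewrite !lt_min => /and3P[h1 h2 h3]; split=> //; [lra|exact: ltW|].
  move: h3; rewrite (ltr_pdivlMr _ _ K1) => /ltW; apply: le_trans.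
  by rewrite [leRHS]mulrC ler_wpM2r ?(ltW mu0)// ler_wpM2l ?ler0n// lerDl ler01.
pose good nu (S : set (measurableTypeR R * measurableTypeR R)) :=
  [/\ measurable S, S `<=` square12 R, area (square12 R `\` S) = 0%E &
      forall z, S z -> nonresonant (frequency N p nu false z, frequency N p nu true z)].
pose Cnu nu := xget (square12 R) [set S | good nu S].
have CnuP nu : 0 < nu -> nu < m0 ^+ 2 -> good nu (Cnu nu).
  move=> nu0 /(sqrt_small _ nu0)[_ h1 _ h2]; apply: (@xgetPex _ _ [set S | good nu S]).
  exact: (nonresonant_full_measure K0 dN small p nu0 h1 h2).
exists (m0 ^+ 2), 1, Cnu; split; first by rewrite exprn_gt0.
  apply: cvg_near_cst; near=> nu.
  have nu0 : 0 < nu by near: nu; exact: nbhs_right_gt.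
  have num : nu < m0 ^+ 2 by near: nu; apply: nbhs_right_lt; rewrite exprn_gt0.
  by have [] := CnuP nu nu0 num.
move=> nu nu0 num; have [mC sC _ nrC] := CnuP nu nu0 num; split=> // rho Crho.
have [mu0 mur mu8 Kmu] := sqrt_small nu nu0 num.
have [rho1 rho2] := square12P (sC _ Crho).
pose x := Num.sqrt (nu * rho.1); pose y := Num.sqrt (nu * rho.2).
have xmu : Num.sqrt nu <= x <= 2 * Num.sqrt nu := sqrt_scale_bounds nu0 rho1.
have ymu : Num.sqrt nu <= y <= 2 * Num.sqrt nu := sqrt_scale_bounds nu0 rho2.
have hx : 0 < x < r by case/andP: xmu => ? ?; apply/andP; split; lra.
have hy : 0 < y < r by case/andP: ymu => ? ?; apply/andP; split; lra.
have [inD dbarE _ [Asym _] dbar_lin] := HN x y hx hy.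
have bnd b d := small b d x y _ hx hy (andP xmu).2 (andP ymu).2 mur.
pose n b := N b x y; pose a b d := A b d x y.
have x0 : 0 < x by case/andP: hx.
have y0 : 0 < y by case/andP: hy.
pose P := potential x y n; pose H := hessian x y n a.
have freqE b : frequency N p nu b rho = p%:~R ^+ 2 + P b.
  rewrite /frequency /freq_shift -/x -/y /P /potential /n -addrA; congr (_ + _).
  case: b; rewrite sqr_sqrtr// mulr_ge0 ?(ltW nu0)//.
    by case/andP: rho1 => /(le_trans ler01).
  by case/andP: rho2 => /(le_trans ler01).
(* the frequencies of the wave itself, within O(nu) of p^2 *)
have nrP : nonresonant (p%:~R ^+ 2 + P false, p%:~R ^+ 2 + P true).
  by rewrite -!freqE; exact: nrC.
(* equal potentials would give the resonance (1, -1) *)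
have P_neq : P false != P true.
  apply: contraTneq isT => h; 
  have := nrP 1 (-1) isT; rewrite -![(_, _).1]/(_ + P _) -![(_, _).2]/(_ + P _) h.
  by move: (P true) => q; rewrite intrN mulr1 mulrN1 subrr eqxx.
have tau0 : 0 < nu `^ (3 / 2) by exact: powR_gt0.
have [k [k' [delta [kk' d1 d2 e0 e1]]]] := small_detuning P_neq tau0.
(* the entries of a row add up to -1, so that (p^2, p^2) pairs to - p^2 *)
pose m (c : bool) : int * int := if c then (-1 - k', k') else (-1 - k, k).
pose omega : R * R := (p%:~R ^+ 2 + delta.1, p%:~R ^+ 2 + delta.2).
have omegaE c : wind (m c) omega = - (p%:~R ^+ 2 + P c).
  by rewrite /wind /m; case: c; rewrite ?e0 ?e1 /= intrB intrN; ring.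
pose amp (c : bool) := if c then y else x.
have amp_gt0 c : 0 < amp c by case: c.
exists (fun theta => plane_wave p amp m theta false),
  (fun theta => plane_wave p amp m theta true), omega; split.
- by split; exact: plane_wave_analytic.
- apply: (plane_wave_solves inD _ omegaE) => c u v.
  exact: (nonlinearity_wave (n := n) x0 y0 dbarE).
- have dist theta c := plane_wave_distance s p m amp_gt0 theta c.
  by move=> theta; rewrite (dist theta false) (dist theta true) lee_fin mul1r exprn_ge0// ltW.
- split; last by rewrite /omega /= [_ + delta.1]addrC [_ + delta.2]addrC !addrK mul1r.
  apply: (nonresonant_winding kk').
  rewrite -[(-1 - k, k)]/(m false) -[(-1 - k', k')]/(m true).
  by rewrite !omegaE !opprK.
- have Hsym : H true false = H false true by rewrite /H /hessian /= /a Asym.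
  have Hsmall c d : `|H c d| <= 1 / 8.
    by apply: (hessian_small mu0 mu8 K0 Kmu xmu ymu) => [b|b e]; [exact: (bnd b b).1|exact: (bnd b e).2].
  have [Q [lam [Qr Qc Qe lamE]]] := orthogonal_diagonalization Hsym Hsmall.
  have -> : torus_map (fun theta => plane_wave p amp m theta false)
     (fun theta => plane_wave p amp m theta true) = plane_wave p amp m.
    by apply/funext => theta; apply/funext; case.
  apply: (plane_wave_linearly_stable s_gt amp_gt0 _ Qr Qc _ Qe _ omegaE).
  + by move=> c; apply: le_trans (lamE c) _; lra.
  + rewrite /m /= !intrB !intrN.
    have -> : (-1%:~R - k%:~R) * k'%:~R - k%:~R * (-1%:~R - k'%:~R) = k%:~R - k'%:~R :> R by ring.
    by rewrite subr_eq0 eqr_int.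
  + exact: (dnonlinearity_wave (n := n) (A := a) dbar_lin).
Unshelve. all: by end_near.
Qed.
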